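(* Let $K|k$ be an extension of degree $n$ of finite fields. Let $A'$ be an abelian variety over $K$, and let $W=\mathrm{Res}^K_k(A')$ be the Weil restriction of $A'$ with respect to $K|k$. Let $\pi_K\in\mathrm{End}(A')$ be the Frobenius endomorphism of $A'$ and $\pi_k\in\mathrm{End}(W)$ the Frobenius endomorphism of $W$. Then the ring homomorphism $$\mathrm{End}^{\circ}(A')\otimes_{\mathbb{Q}[\pi_K]}\mathbb{Q}[\pi_K][X]/(X^n-\pi_K)\longrightarrow \mathrm{End}^{\circ}(W),\qquad \lambda\mapsto \mathrm{Res}^K_k(\lambda),\quad X\mapsto \pi_k,$$ is an isomorphism.
   Context: For an abelian group $M$, $M^{\circ}:=M\otimes\mathbb{Q}$; so $\mathrm{End}^{\circ}(A')=\mathrm{End}(A')\otimes\mathbb{Q}$. Homomorphisms and endomorphisms of abelian varieties over a field are always defined over that field. Weil restriction: for a finite Galois extension $K|k$ and an abelian $K$-variety $A'$, $\mathrm{Res}^K_k(A')$ is the abelian $k$-variety representing the functor $Z\mapsto A'(Z\otimes_k K)$ from $k$-schemes to abelian groups; its universal element $u_{A'}:\mathrm{Res}^K_k(A')\otimes_k K\to A'$ is a homomorphism of abelian $K$-varieties. $\mathrm{Res}^K_k$ is an additive covariant functor: for a homomorphism $\lambda:A'\to B'$ of abelian $K$-varieties, $\mathrm{Res}^K_k(\lambda)$ is the unique homomorphism with $u_{B'}\circ(\mathrm{Res}^K_k(\lambda)\otimes_k\mathrm{id}_K)=\lambda\circ u_{A'}$. It gives ring homomorphisms $\mathrm{End}(A')\to\mathrm{End}(\mathrm{Res}^K_k(A'))$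 and $\mathrm{End}^{\circ}(A')\to\mathrm{End}^{\circ}(\mathrm{Res}^K_k(A'))$. For an abelian variety over a finite field with $q$ elements, its Frobenius endomorphism is the identity on the underlying topological space and $f\mapsto f^q$ on the structure sheaf. $\mathbb{Q}[\pi_K]$ denotes the (commutative, central) $\mathbb{Q}$-subalgebra of $\mathrm{End}^{\circ}(A')$ generated by $\pi_K$. One has $\mathrm{Res}^K_k(\pi_K)=\pi_k^n$ and $\pi_k$ is central in $\mathrm{End}(W)$, so that the displayed map is a well-defined ring homomorphism. *)

(* Defs.v *)
From HB Require Import structures.
From mathcomp Require Import all_boot all_order all_algebra all_field.
From mathcomp Require Import boolp classical_sets.

Set Implicit Arguments.
Unset Strict Implicit.
Unset Printing Implicit Defensive.

Import GRing.Theory.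
Local Open Scope quotient_scope.
Local Open Scope ring_scope.
#[local] Obligation Tactic := try done.

(* Algebraic geometry is set up through functors of points (Demazure-Gabriel):
   a scheme over F is a functor on small commutative F-algebras that is a
   Zariski sheaf with an open cover by representable functors; morphisms of
   schemes are natural transformations.  The universe Set plays the role of
   the fixed universe of small rings, so that the endomorphism rings below
   live in the universe of MathComp's ring structures.  The zero ring is
   allowed, as it must be. *)

Record smallRing := SmallRing {
  carrier :> Set;
  sr0 : carrier;
  sr1 : carrier;
  srN : carrier -> carrier;
  srD : carrier -> carrier -> carrier;
  srM : carrier -> carrier -> carrier;
  srDA : associative srD;
  srDC : commutative srD;
  sr0D : left_id sr0 srD;
  srND : left_inverse sr0 srN srD;
  srMA : associative srM;
  srMC : commutative srM;
  sr1M : left_id sr1 srM;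
  srMDl : left_distributive srM srD }.

HB.instance Definition _ (R : smallRing) := gen_eqMixin (carrier R).
HB.instance Definition _ (R : smallRing) := gen_choiceMixin (carrier R).
HB.instance Definition _ (R : smallRing) := GRing.isZmodule.Build (carrier R)
  (@srDA R) (@srDC R) (@sr0D R) (@srND R).
HB.instance Definition _ (R : smallRing) :=
  GRing.Zmodule_isComPzRing.Build (carrier R)
    (@srMA R) (@srMC R) (@sr1M R) (@srMDl R).

Section Algebras.
Variable F : comPzRingType.

Record alg := Alg {
  alg_ring :> smallRing;
  alg_str : {rmorphism F -> alg_ring} }.

Record algHom (R S : alg) := AlgHom {
  algHom_fun :> {rmorphism R -> S};
  algHom_str : forall c, algHom_fun (alg_str R c) = alg_str S c }.

Lemma algHomP (R S : alg) (f g : algHom R S) : f =1 g -> f = g.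
Proof.
case: f g => [f hf] [g hg] /= e.
have efg : f = g.
  case: f {hf} e => [f [[a] [b]]]; case: g {hg} => [g [[a'] [b']]] /= e.
  have e' : f = g by apply/funext.
  by subst g; rewrite (Prop_irrelevance a a') (Prop_irrelevance b b').
by subst g; congr AlgHom; apply: Prop_irrelevance.
Qed.

Program Definition algHom_id (R : alg) : algHom R R := @AlgHom R R idfun _.

Program Definition algHom_comp (R S T : alg) (g : algHom S T) (f : algHom R S) :
  algHom R T := @AlgHom R T (g \o f) _.
Next Obligation. by move=> R S T g f c /=; rewrite !algHom_str. Qed.

End Algebras.

Section Restriction.
Variables (F F' : comPzRingType) (iota : {rmorphism F -> F'}).

Definition alg_restr (R : alg F') : alg F := @Alg F R (alg_str R \o iota).

Program Definition algHom_restr (R S : alg F') (f : algHom R S) :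
  algHom (alg_restr R) (alg_restr S) := @AlgHom F (alg_restr R) (alg_restr S) f _.
Next Obligation. by move=> R S f c /=; rewrite algHom_str. Qed.

End Restriction.

Section Functors.
Variable F : comPzRingType.

Record functor := Functor {
  pts :> alg F -> Type;
  fmap : forall R S, algHom R S -> pts R -> pts S;
  fmap_id : forall R x, fmap (algHom_id R) x = x;
  fmap_comp : forall R S T (g : algHom S T) (f : algHom R S) x,
    fmap (algHom_comp g f) x = fmap g (fmap f x) }.

Record mor (X Y : functor) := Mor {
  mor_fun :> forall R, X R -> Y R;
  morE : forall R S (f : algHom R S) x,
    mor_fun (fmap f x) = fmap f (mor_fun x) }.
Arguments mor_fun {X Y} _ R _ : rename.

Program Definition Spec (B : alg F) : functor :=
  @Functor (algHom B) (fun R S f x => algHom_comp f x) _ _.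
Next Obligation. by move=> B R x; apply: algHomP. Qed.
Next Obligation. by move=> B R S T g f x; apply: algHomP. Qed.

Program Definition prodF (X Y : functor) : functor :=
  @Functor (fun R => X R * Y R)%type
    (fun R S f p => (fmap f p.1, fmap f p.2)) _ _.
Next Obligation. by move=> X Y R [x y] /=; rewrite !fmap_id. Qed.
Next Obligation. by move=> X Y R S T g f [x y] /=; rewrite !fmap_comp. Qed.

Definition vanishes (R S : alg F) (f : algHom R S) (E : set R) :=
  forall e, E e -> f e = 0.

Definition generates_unit (R S : alg F) (f : algHom R S) (E : set R) :=
  exists m (e : 'I_m -> R) (s : 'I_m -> S),
    (forall i, E (e i)) /\ \sum_i s i * f (e i) = 1.

(* A subset P of the points of X is closed (resp. open) when, for every point
   x : Spec R -> X, its preimage in Spec R is the closed subscheme V(E)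
   (resp. the open subscheme D(E)) for some subset E of R. *)
Definition closed_sub (X : functor) (P : forall R, set (X R)) :=
  forall R (x : X R), exists E : set R,
    forall S (f : algHom R S), P S (fmap f x) <-> vanishes f E.

Definition open_sub (X : functor) (P : forall R, set (X R)) :=
  forall R (x : X R), exists E : set R,
    forall S (f : algHom R S), P S (fmap f x) <-> generates_unit f E.

Definition open_immersion (Y X : functor) (i : mor Y X) :=
  (forall R, injective (i R)) /\ open_sub (fun R => range (i R)).

Definition is_localization (R S : alg F) (f : algHom R S) (a : R) :=
  [/\ exists b, f a * b = 1,
      forall s, exists m r, s * f a ^+ m = f r
    & forall r, f r = 0 -> exists m, a ^+ m * r = 0].

Definition zariski_sheaf (X : functor) :=
  forall (R : alg F) m (a : 'I_m -> R) (Ri : 'I_m -> alg F)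
    (f : forall i, algHom R (Ri i)) (x : forall i, X (Ri i)),
  (exists b : 'I_m -> R, \sum_i b i * a i = 1) ->
  (forall i, is_localization (f i) (a i)) ->
  (forall i j (S : alg F) (g : algHom (Ri i) S) (h : algHom (Ri j) S),
     algHom_comp g (f i) = algHom_comp h (f j) ->
     fmap g (x i) = fmap h (x j)) ->
  exists! y : X R, forall i, fmap (f i) y = x i.

Definition is_field (R : alg F) :=
  (1 : R) <> 0 /\ forall a : R, a <> 0 -> exists b, a * b = 1.

Definition is_domain (R : alg F) :=
  (1 : R) <> 0 /\ forall a b : R, a * b = 0 -> a = 0 \/ b = 0.

Definition affine_open_cover (X : functor) (J : Type) (B : J -> alg F)
    (i : forall j, mor (Spec (B j)) X) :=
  (forall j, open_immersion (i j)) /\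
  forall (L : alg F) (x : X L), is_field L -> exists j, range (i j L) x.

Definition scheme (X : functor) :=
  zariski_sheaf X /\
  exists (J : Type) (B : J -> alg F) (i : forall j, mor (Spec (B j)) X),
    affine_open_cover i.

Definition finitely_generated (B : alg F) :=
  exists m (b : 'I_m -> B), forall P : set B,
    (forall c, P (alg_str B c)) -> (forall i, P (b i)) ->
    (forall x y, P x -> P y -> P (x + y)) ->
    (forall x y, P x -> P y -> P (x * y)) -> forall x, P x.

Definition finite_type (X : functor) :=
  exists m (B : 'I_m -> alg F) (i : forall j, mor (Spec (B j)) X),
    affine_open_cover i /\ forall j, finitely_generated (B j).

Definition separated (X : functor) :=
  @closed_sub (prodF X X) (fun R p => p.1 = p.2).

(* A point of the topological space of a scheme is represented by its values
   in fields; a point t of T with values in a field M lies on the image of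
   Z in T iff it lifts to Z after some extension of M.  Closed subsets are
   represented by closed subschemes. *)
Definition universally_closed (X : functor) :=
  forall (T : functor) (Z : forall R, set (prodF X T R)),
  scheme T -> closed_sub Z ->
  exists C : forall R, set (T R), closed_sub C /\
    forall (M : alg F) (t : T M), is_field M ->
      (C M t <-> exists (N : alg F) (f : algHom M N) (x : X N),
                   is_field N /\ Z N (x, fmap f t)).

Definition proper (X : functor) :=
  [/\ finite_type X, separated X & universally_closed X].

(* The coordinate rings of the nonempty affine opens are domains; taking the
   union of two disjoint affine opens, this includes irreducibility. *)
Definition integral_scheme (X : functor) :=
  (exists (M : alg F) (x : X M), is_field M) /\
  forall (B : alg F) (i : mor (Spec B) X),
    open_immersion i -> (1 : B) <> 0 -> is_domain B.

Record gfunctor := GFunctor {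
  gpts : alg F -> zmodType;
  gmap : forall R S, algHom R S -> {additive gpts R -> gpts S};
  gmap_id : forall R x, gmap (algHom_id R) x = x;
  gmap_comp : forall R S T (g : algHom S T) (f : algHom R S) x,
    gmap (algHom_comp g f) x = gmap g (gmap f x) }.

Definition gfunctor_functor (A : gfunctor) : functor :=
  @Functor (gpts A) (gmap A) (@gmap_id A) (@gmap_comp A).
Coercion gfunctor_functor : gfunctor >-> functor.

Record ghom (A B : gfunctor) := GHom {
  ghom_fun :> forall R, gpts A R -> gpts B R;
  ghomE : forall R S (f : algHom R S) x,
    ghom_fun (gmap A f x) = gmap B f (ghom_fun x);
  ghomD : forall R x y, ghom_fun (x + y) = @ghom_fun R x + ghom_fun y }.
Arguments ghom_fun {A B} _ R _ : rename.

Lemma ghomP (A B : gfunctor) (f g : ghom A B) : (forall R, f R =1 g R) -> f = g.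
Proof.
case: f g => [f nf af] [g ng ag] /= e.
have efg : f = g by apply: functional_extensionality_dep => R; apply/funext/e.
by subst g; rewrite (Prop_irrelevance nf ng) (Prop_irrelevance af ag).
Qed.

HB.instance Definition _ A B := gen_eqMixin (ghom A B).
HB.instance Definition _ A B := gen_choiceMixin (ghom A B).

Section HomGroup.
Variables A B : gfunctor.
Implicit Types f g h : ghom A B.

Program Definition ghom0 : ghom A B := @GHom A B (fun R _ => 0) _ _.
Next Obligation. by move=> *; rewrite raddf0. Qed.
Next Obligation. by move=> *; rewrite addr0. Qed.

Program Definition ghom_opp f : ghom A B := @GHom A B (fun R x => - f R x) _ _.
Next Obligation. by move=> f R S a x /=; rewrite ghomE raddfN. Qed.
Next Obligation. by move=> f R x y /=; rewrite ghomD opprD. Qed.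

Program Definition ghom_add f g : ghom A B :=
  @GHom A B (fun R x => f R x + g R x) _ _.
Next Obligation. by move=> f g R S a x /=; rewrite !ghomE raddfD. Qed.
Next Obligation. by move=> f g R x y /=; rewrite !ghomD addrACA. Qed.

Fact ghom_addA : associative ghom_add.
Proof. by move=> f g h; apply: ghomP => R x /=; rewrite addrA. Qed.
Fact ghom_addC : commutative ghom_add.
Proof. by move=> f g; apply: ghomP => R x /=; rewrite addrC. Qed.
Fact ghom_add0 : left_id ghom0 ghom_add.
Proof. by move=> f; apply: ghomP => R x /=; rewrite add0r. Qed.
Fact ghom_addN : left_inverse ghom0 ghom_opp ghom_add.
Proof. by move=> f; apply: ghomP => R x /=; rewrite addNr. Qed.

HB.instance Definition _ := GRing.isZmodule.Build (ghom A B)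
  ghom_addA ghom_addC ghom_add0 ghom_addN.

End HomGroup.

Program Definition ghom_id (A : gfunctor) : ghom A A :=
  @GHom A A (fun R x => x) _ _.

Program Definition ghom_comp (A B C : gfunctor) (g : ghom B C) (f : ghom A B) :
  ghom A C := @GHom A C (fun R x => g R (f R x)) _ _.
Next Obligation. by move=> A B C g f R S a x /=; rewrite !ghomE. Qed.
Next Obligation. by move=> A B C g f R x y /=; rewrite !ghomD. Qed.

Definition End (A : gfunctor) : Type := ghom A A.

Section EndRing.
Variable A : gfunctor.

HB.instance Definition _ := GRing.Zmodule.on (End A).

Fact End_mulA : associative (@ghom_comp A A A).
Proof. by move=> f g h; apply: ghomP. Qed.
Fact End_mul1 : left_id (ghom_id A) (@ghom_comp A A A).
Proof. by move=> f; apply: ghomP. Qed.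
Fact End_mul1r : right_id (ghom_id A) (@ghom_comp A A A).
Proof. by move=> f; apply: ghomP. Qed.
Fact End_mulDl : left_distributive (@ghom_comp A A A) +%R.
Proof. by move=> f g h; apply: ghomP. Qed.
Fact End_mulDr : right_distributive (@ghom_comp A A A) +%R.
Proof. by move=> f g h; apply: ghomP => R x /=; rewrite ghomD. Qed.

HB.instance Definition _ := GRing.Zmodule_isPzRing.Build (End A)
  End_mulA End_mul1 End_mul1r End_mulDl End_mulDr.

End EndRing.
End Functors.

(* The fibre product of X with Spec F' over Spec F, as a functor on
   F'-algebras. *)
Section BaseChange.
Variables (F F' : comPzRingType) (iota : {rmorphism F -> F'}).

Program Definition base_change (X : functor F) : functor F' :=
  @Functor F' (fun R => X (alg_restr iota R))
    (fun R S f => fmap (algHom_restr iota f)) _ _.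
Next Obligation.
move=> X R x /=; rewrite -[RHS](@fmap_id _ X); congr (fmap _ x).
exact: algHomP.
Qed.
Next Obligation.
move=> X R S T g f x /=; rewrite -fmap_comp; congr (fmap _ x).
exact: algHomP.
Qed.

Program Definition gbase_change (A : gfunctor F) : gfunctor F' :=
  @GFunctor F' (fun R => gpts A (alg_restr iota R))
    (fun R S f => gmap A (algHom_restr iota f)) _ _.
Next Obligation.
move=> A R x; rewrite -[RHS](@gmap_id _ A); congr (gmap A _ x).
exact: algHomP.
Qed.
Next Obligation.
move=> A R S T g f x /=; rewrite -gmap_comp; congr (gmap A _ x).
exact: algHomP.
Qed.

Definition mor_base_change (X Y : functor F) (g : mor X Y) :
    mor (base_change X) (base_change Y) :=
  @Mor _ (base_change X) (base_change Y) (fun R => g (alg_restr iota R))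
    (fun R S f => morE g (algHom_restr iota f)).

Definition ghom_base_change (A B : gfunctor F) (g : ghom A B) :
    ghom (gbase_change A) (gbase_change B) :=
  @GHom _ (gbase_change A) (gbase_change B) (fun R => g (alg_restr iota R))
    (fun R S f => ghomE g (algHom_restr iota f))
    (fun R => ghomD g (R := alg_restr iota R)).

End BaseChange.

Definition geometrically_integral (F : comPzRingType) (X : functor F) :=
  forall L : alg F, is_field L -> integral_scheme (base_change (alg_str L) X).

(* Abelian varieties are commutative, so the group law is written additively
   from the start. *)
Definition abelian_variety (F : fieldType) (A : gfunctor F) :=
  [/\ scheme A, proper A & geometrically_integral A].

(* (W, u) represents Z |-> A(Z x_F F') on F-schemes. *)
Definition is_weil_restriction (F F' : comPzRingType)
    (iota : {rmorphism F -> F'}) (A : gfunctor F') (W : gfunctor F)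
    (u : ghom (gbase_change iota W) A) :=
  forall Z : functor F, scheme Z ->
  forall f : mor (base_change iota Z) A,
  exists! g : mor Z W,
    forall R (z : base_change iota Z R), u R (mor_base_change iota g R z) = f R z.

(* The homomorphism mu with u_B o mu_F' = lam o u_A; it exists and is unique
   by the universal property of u_B (0 is only the default value of xget). *)
Definition weil_res (F F' : comPzRingType) (iota : {rmorphism F -> F'})
    (A B : gfunctor F') (WA WB : gfunctor F)
    (uA : ghom (gbase_change iota WA) A) (uB : ghom (gbase_change iota WB) B)
    (lam : ghom A B) : ghom WA WB :=
  xget (0 : ghom WA WB)
    [set mu | ghom_comp uB (ghom_base_change iota mu) = ghom_comp lam uA]%classic.

Section Frobenius.
Variable F : finFieldType.

Fact exprD_pz (R : comPzRingType) p (x y : R) :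
  prime p -> p%:R = 0 :> R -> (x + y) ^+ p = x ^+ p + y ^+ p.
Proof.
move=> pr_p p0; rewrite exprDn; case: p pr_p p0 => // p pr_p p0.
rewrite big_ord_recl big_ord_recr /= subn0 expr0 mulr1 bin0 mulr1n subnn.
rewrite expr0 mul1r binn mulr1n big1 ?add0r // => i _.
have /dvdnP[m ->] : (p.+1 %| 'C(p.+1, bump 0 i))%N.
  by rewrite prime_dvd_bin //= /bump /= add1n ltnS ltn_ord.
by rewrite mulrnA -mulr_natr p0 mulr0.
Qed.

Definition frob_fun (R : alg F) (x : R) : R := x ^+ #|F|.

Fact frob_nmod (R : alg F) : nmod_morphism (@frob_fun R).
Proof.
split; first by rewrite /frob_fun expr0n; case: #|F| (card_finNzRing_gt1 F).
rewrite /frob_fun; have [p pr_p pF] := finPcharP F.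
have p0 : p%:R = 0 :> R by rewrite -(rmorph_nat (alg_str R)) pcharf0 // rmorph0.
have [d ->] : exists d, #|F| = (p ^ d)%N by eexists; exact: card_pprimeChar pF.
by move=> x y; elim: d => [|d IHd]; rewrite ?expr1 // expnSr !exprM IHd exprD_pz.
Qed.

Fact frob_monoid (R : alg F) : monoid_morphism (@frob_fun R).
Proof. by split=> [|x y]; rewrite /frob_fun ?expr1n ?exprMn. Qed.

HB.instance Definition _ (R : alg F) :=
  GRing.isNmodMorphism.Build R R (@frob_fun R) (frob_nmod R).
HB.instance Definition _ (R : alg F) :=
  GRing.isMonoidMorphism.Build R R (@frob_fun R) (frob_monoid R).

Program Definition frob (R : alg F) : algHom R R := @AlgHom F R R (@frob_fun R) _.
Next Obligation. by move=> R c /=; rewrite /frob_fun -rmorphXn expf_card. Qed.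

(* On an affine open subscheme Spec B, the endomorphism that is the identity
   on the space and f |-> f ^+ #|F| on functions sends a point x : B -> R
   to x o frob B = frob R o x. *)
Program Definition frobenius (A : gfunctor F) : End A :=
  @GHom F A A (fun R => gmap A (frob R)) _ _.
Next Obligation.
move=> A R S f x; rewrite -!gmap_comp; congr (gmap _ _ x).
by apply: algHomP => a /=; rewrite /frob_fun rmorphXn.
Qed.
Next Obligation. by move=> A R x y /=; rewrite raddfD. Qed.

Lemma frobenius_central (A : gfunctor F) (lam : End A) :
  GRing.comm (frobenius A) lam.
Proof. by apply: ghomP => R x /=; rewrite ghomE. Qed.

End Frobenius.

(* Ring homomorphisms with central image; over a commutative R these are the
   R-algebra structures on A. *)
Record central_hom (R A : pzRingType) := CentralHom {
  central_fun :> {rmorphism R -> A};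
  centralP : forall r a, GRing.comm (central_fun r) a }.

Section Tensor.
Variables (R A B : pzRingType) (f : central_hom R A) (g : central_hom R B).

(* The balanced biadditive relations on formal sums of pure tensors a ox b. *)
Inductive tens_rel : seq (A * B) -> seq (A * B) -> Prop :=
| tens_refl s : tens_rel s s
| tens_sym s t : tens_rel s t -> tens_rel t s
| tens_trans t s u : tens_rel s t -> tens_rel t u -> tens_rel s u
| tens_cat s s' t t' :
    tens_rel s s' -> tens_rel t t' -> tens_rel (s ++ t) (s' ++ t')
| tens_catC s t : tens_rel (s ++ t) (t ++ s)
| tens_0l b : tens_rel [:: (0, b)] [::]
| tens_Dl a a' b : tens_rel [:: (a + a', b)] [:: (a, b); (a', b)]
| tens_Dr a b b' : tens_rel [:: (a, b + b')] [:: (a, b); (a, b')]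
| tens_bal a r b : tens_rel [:: (a * f r, b)] [:: (a, g r * b)].

Fact tens_equiv_class : equiv_class_of (fun s t => `[< tens_rel s t >]).
Proof.
split=> [s | s t | t s u].
- exact/asboolP/tens_refl.
- by apply/asboolP/asboolP; apply: tens_sym.
- by move=> /asboolP st /asboolP tu; apply/asboolP/(tens_trans st).
Qed.
Canonical tens_equiv := EquivRelPack tens_equiv_class.

(* A ox_R B *)
Definition tensor : Type := {eq_quot tens_equiv}.
HB.instance Definition _ := Choice.on tensor.
HB.instance Definition _ := EqQuotient.on tensor.

Definition tens_cls (s : seq (A * B)) : tensor := \pi_tensor s.
Definition tens (a : A) (b : B) : tensor := tens_cls [:: (a, b)].

Lemma tens_clsP s t : tens_rel s t <-> tens_cls s = tens_cls t.
Proof.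
split=> [st | /eqmodP/asboolP //].
exact/eqmodP/asboolP.
Qed.

Lemma tens_clsE (x : tensor) : exists s, x = tens_cls s.
Proof. by exists (repr x); rewrite /tens_cls reprK. Qed.

Definition tens_neg (s : seq (A * B)) := [seq (- p.1, p.2) | p <- s].
Definition tens_add (x y : tensor) := tens_cls (repr x ++ repr y).
Definition tens_opp (x : tensor) := tens_cls (tens_neg (repr x)).

Lemma tens_repr s : tens_rel (repr (tens_cls s)) s.
Proof. by apply/tens_clsP; rewrite /tens_cls reprK. Qed.

Lemma tens_addE s t : tens_add (tens_cls s) (tens_cls t) = tens_cls (s ++ t).
Proof. by apply/tens_clsP/tens_cat; apply: tens_repr. Qed.

Lemma tens_negK s : tens_rel (tens_neg s ++ s) [::].
Proof.
elim: s => [|[a b] s IHs]; first exact: tens_refl.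
rewrite /= -cat1s -[(a, b) :: s]cat1s.
apply: (@tens_trans ([:: (- a, b); (a, b)] ++ (tens_neg s ++ s))).
  rewrite -[[:: (- a, b); _]]cat1s -!catA.
  apply: tens_cat; first exact: tens_refl.
  rewrite !catA; apply: tens_cat; [exact: tens_catC | exact: tens_refl].
rewrite -[[::]]cats0; apply: tens_cat => //.
apply: (@tens_trans [:: (- a + a, b)]); first exact/tens_sym/tens_Dl.
by rewrite addNr; apply: tens_0l.
Qed.

Fact tens_addA : associative tens_add.
Proof.
move=> x y z; have [[s ->] [t ->] [u ->]] := And3 (tens_clsE x) (tens_clsE y) (tens_clsE z).
by rewrite !tens_addE catA.
Qed.
Fact tens_addC : commutative tens_add.
Proof.
move=> x y; have [[s ->] [t ->]] := conj (tens_clsE x) (tens_clsE y).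
by rewrite !tens_addE; apply/tens_clsP/tens_catC.
Qed.
Fact tens_add0 : left_id (tens_cls [::]) tens_add.
Proof. by move=> x; have [s ->] := tens_clsE x; rewrite tens_addE. Qed.
Fact tens_addN : left_inverse (tens_cls [::]) tens_opp tens_add.
Proof.
move=> x; rewrite /tens_opp; have [s ->] := tens_clsE x.
rewrite -{2}[tens_cls s]reprK -/(tens_cls _) tens_addE.
exact/tens_clsP/tens_negK.
Qed.

HB.instance Definition _ := GRing.isZmodule.Build tensor
  tens_addA tens_addC tens_add0 tens_addN.

Lemma tens_cls_sum s : tens_cls s = \sum_(p <- s) tens p.1 p.2.
Proof.
elim: s => [|[a b] s IHs]; first by rewrite big_nil.
by rewrite big_cons -IHs -cat1s -tens_addE.
Qed.

Lemma tensDl a a' b : tens (a + a') b = tens a b + tens a' b.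
Proof. by rewrite [RHS]tens_addE; apply/tens_clsP/tens_Dl. Qed.
Lemma tensDr a b b' : tens a (b + b') = tens a b + tens a b'.
Proof. by rewrite [RHS]tens_addE; apply/tens_clsP/tens_Dr. Qed.
Lemma tens_balanced a r b : tens (a * f r) b = tens a (g r * b).
Proof. exact/tens_clsP/tens_bal. Qed.

Lemma tens_lift (G : zmodType) (phi : A -> B -> G) :
  (forall a a' b, phi (a + a') b = phi a b + phi a' b) ->
  (forall a b b', phi a (b + b') = phi a b + phi a b') ->
  (forall a r b, phi (a * f r) b = phi a (g r * b)) ->
  forall s t, tens_cls s = tens_cls t ->
  \sum_(p <- s) phi p.1 p.2 = \sum_(p <- t) phi p.1 p.2.
Proof.
move=> Dl Dr bal s t /tens_clsP.
elim=> {s t} [s|s t _ ->|t s u _ -> _ ->|s s' t t' _ es _ et|s t|b|a a' b|a b b'|a r b] //.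
- by rewrite !big_cat /= es et.
- by rewrite !big_cat /= addrC.
- rewrite big_seq1 big_nil /=; apply: (@addIr _ (phi 0 b)).
  by rewrite -Dl !add0r.
- by rewrite !big_cons !big_nil /= Dl !addr0.
- by rewrite !big_cons !big_nil /= Dr !addr0.
- by rewrite !big_seq1 /= bal.
Qed.

(* (a ox b) * (a' ox b') = (a * a') ox (b * b') *)
Definition tens_mul (x y : tensor) : tensor :=
  \sum_(p <- repr x) \sum_(q <- repr y) tens (p.1 * q.1) (p.2 * q.2).

Lemma tens_mulE s t : tens_mul (tens_cls s) (tens_cls t) =
  \sum_(p <- s) \sum_(q <- t) tens (p.1 * q.1) (p.2 * q.2).
Proof.
rewrite /tens_mul.
transitivity (\sum_(p <- s) \sum_(q <- repr (tens_cls t))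
    tens (p.1 * q.1) (p.2 * q.2)).
  apply: (@tens_lift tensor (fun a b => \sum_(q <- _) tens (a * q.1) (b * q.2)));
    last by rewrite /tens_cls reprK.
  - by move=> a a' b; rewrite -big_split; apply: eq_bigr => q _; rewrite mulrDl tensDl.
  - by move=> a b b'; rewrite -big_split; apply: eq_bigr => q _; rewrite mulrDl tensDr.
  - move=> a r b; apply: eq_bigr => q _.
    by rewrite -mulrA centralP mulrA tens_balanced mulrA.
apply: eq_bigr => p _.
apply: (@tens_lift tensor (fun a b => tens (p.1 * a) (p.2 * b)));
  last by rewrite /tens_cls reprK.
- by move=> a a' b; rewrite mulrDr tensDl.
- by move=> a b b'; rewrite mulrDr tensDr.
- by move=> a r b; rewrite mulrA tens_balanced mulrA centralP -mulrA.
Qed.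

Fact tens_mulDl : left_distributive tens_mul +%R.
Proof.
move=> x y z; have [[s ->] [t ->] [u ->]] := And3 (tens_clsE x) (tens_clsE y) (tens_clsE z).
by rewrite [_ + _]tens_addE !tens_mulE big_cat.
Qed.

Fact tens_mulDr : right_distributive tens_mul +%R.
Proof.
move=> x y z; have [[s ->] [t ->] [u ->]] := And3 (tens_clsE x) (tens_clsE y) (tens_clsE z).
rewrite [_ + _]tens_addE !tens_mulE -big_split.
by apply: eq_bigr => p _; rewrite big_cat.
Qed.

Lemma tens_mul_pure a b a' b' :
  tens_mul (tens a b) (tens a' b') = tens (a * a') (b * b').
Proof. by rewrite /tens tens_mulE !big_seq1. Qed.

Lemma tens_ind (P : tensor -> Prop) :
  P 0 -> (forall x y, P x -> P y -> P (x + y)) -> (forall a b, P (tens a b)) ->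
  forall x, P x.
Proof.
move=> P0 PD Pt x; have [s ->] := tens_clsE x.
by rewrite tens_cls_sum; apply: big_ind.
Qed.

Fact tens_mul0r : left_zero 0 tens_mul.
Proof. by move=> x; apply: (@addIr _ (tens_mul 0 x)); rewrite -tens_mulDl !add0r. Qed.
Fact tens_mulr0 : right_zero 0 tens_mul.
Proof. by move=> x; apply: (@addIr _ (tens_mul x 0)); rewrite -tens_mulDr !add0r. Qed.

Fact tens_mulA : associative tens_mul.
Proof.
move=> x y z; elim/tens_ind: x => [|x x' ex ex'|a b].
- by rewrite !tens_mul0r.
- by rewrite !tens_mulDl ex ex'.
elim/tens_ind: y => [|y y' ey ey'|a' b'].
- by rewrite tens_mul0r !tens_mulr0 tens_mul0r.
- by rewrite tens_mulDl !tens_mulDr ey ey' tens_mulDl.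
elim/tens_ind: z => [|z z' ez ez'|a'' b''].
- by rewrite !tens_mulr0.
- by rewrite !tens_mulDr ez ez'.
by rewrite !tens_mul_pure !mulrA.
Qed.

Fact tens_mul1r : left_id (tens 1 1) tens_mul.
Proof.
move=> x; elim/tens_ind: x => [|x y ex ey|a b]; first exact: tens_mulr0.
  by rewrite tens_mulDr ex ey.
by rewrite tens_mul_pure !mul1r.
Qed.

Fact tens_mulr1 : right_id (tens 1 1) tens_mul.
Proof.
move=> x; elim/tens_ind: x => [|x y ex ey|a b]; first exact: tens_mul0r.
  by rewrite tens_mulDl ex ey.
by rewrite tens_mul_pure !mulr1.
Qed.

HB.instance Definition _ := GRing.Zmodule_isPzRing.Build tensor
  tens_mulA tens_mul1r tens_mulr1 tens_mulDl tens_mulDr.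

Lemma tensM a b a' b' : tens a b * tens a' b' = tens (a * a') (b * b').
Proof. exact: tens_mul_pure. Qed.

Definition tens_inr (b : B) : tensor := tens 1 b.

Fact tens_inr_nmod : nmod_morphism tens_inr.
Proof.
split; last by move=> b b'; rewrite /tens_inr tensDr.
by apply: (@addIr _ (tens_inr 0)); rewrite /tens_inr -tensDr !add0r.
Qed.
Fact tens_inr_monoid : monoid_morphism tens_inr.
Proof. by split=> // b b'; rewrite /tens_inr tensM mulr1. Qed.

HB.instance Definition _ :=
  GRing.isNmodMorphism.Build B tensor tens_inr tens_inr_nmod.
HB.instance Definition _ :=
  GRing.isMonoidMorphism.Build B tensor tens_inr tens_inr_monoid.

End Tensor.

Program Definition central_int (A : pzRingType) : central_hom int A :=
  @CentralHom int A ( *~%R 1) _.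
Next Obligation. by move=> A r a; apply/commr_sym/commr_int. Qed.

Section Rationalization.
Variable A : pzRingType.

(* A^o = A ox_Z Q *)
Definition rationalize : Type := tensor (central_int A) (central_int rat).
HB.instance Definition _ := GRing.PzRing.on rationalize.

Program Definition rat_scalar : central_hom rat rationalize :=
  @CentralHom rat rationalize
    (tens_inr (central_int A) (central_int rat)) _.
Next Obligation.
move=> r x; elim/tens_ind: x => [|x y ex ey|a b].
- exact: commr0.
- exact: commrD.
by rewrite /GRing.comm /= /tens_inr !tensM mul1r mulr1 mulrC.
Qed.

End Rationalization.

(* The R-subalgebra R[a] of A generated by a. *)
Section Adjoin.
Variables (R A : pzRingType) (f : central_hom R A) (a : A).

Inductive adjoin_gen : A -> Prop :=
| adjoin_scalar r : adjoin_gen (f r)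
| adjoin_self : adjoin_gen a
| adjoin_add x y : adjoin_gen x -> adjoin_gen y -> adjoin_gen (x + y)
| adjoin_mul x y : adjoin_gen x -> adjoin_gen y -> adjoin_gen (x * y).

Definition adjoin_pred : {pred A} := fun x => `[< adjoin_gen x >].

Fact adjoin_subring : subring_closed adjoin_pred.
Proof.
split=> [|x y /asboolP ax /asboolP ay|x y /asboolP ax /asboolP ay]; apply/asboolP.
- by rewrite -(rmorph1 f); apply: adjoin_scalar.
- apply: adjoin_add => //; rewrite -mulN1r -(rmorphN1 f).
  by apply: adjoin_mul => //; apply: adjoin_scalar.
- exact: adjoin_mul.
Qed.

Record adjoin := Adjoin { adjoin_val : A; adjoinP : adjoin_pred adjoin_val }.

HB.instance Definition _ := [isSub for adjoin_val].
HB.instance Definition _ := [Choice of adjoin by <:].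
HB.instance Definition _ :=
  GRing.SubChoice_isSubPzRing.Build A adjoin_pred adjoin adjoin_subring.

Fact adjoin_mulC : commutative (@GRing.mul adjoin).
Proof.
have comm_gen y z : adjoin_gen y -> GRing.comm z a -> GRing.comm z y.
  move=> ay za; elim: ay => {y} [r||y y' _ ey _ ey'|y y' _ ey _ ey'] //.
  - exact/commr_sym/centralP.
  - exact: commrD.
  - exact: commrM.
move=> [x hx] [y hy]; apply: val_inj.
rewrite !rmorphM /=; move/asboolP: hx => ax; move/asboolP: hy => ay.
by apply: (comm_gen _ _ ay); apply/commr_sym/(comm_gen _ _ ax).
Qed.
HB.instance Definition _ := GRing.PzRing_hasCommutativeMul.Build adjoin adjoin_mulC.

Definition adjoin_elt : adjoin := Adjoin (introT (asboolP _) adjoin_self).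

Hypothesis aC : forall x, GRing.comm a x.

Program Definition adjoin_incl : central_hom adjoin A :=
  @CentralHom adjoin A val _.
Next Obligation.
move=> [x hx] y /=; apply/commr_sym.
move/asboolP: hx => ax.
elim: ax => {x} [r||x x' _ ex _ ex'|x x' _ ex _ ex'].
- exact/commr_sym/centralP.
- exact/commr_sym/aC.
- exact: commrD.
- exact: commrM.
Qed.

End Adjoin.

(* Univariate polynomials as sequences of coefficients with finite support;
   unlike {poly R}, the coefficient ring may be the zero ring, which occurs as
   End^o(0). *)
Section Polynomials.
Variable R : comPzRingType.

Record pol := Pol {
  pcoef : nat -> R;
  pcoef_fin : exists N, forall i, (N <= i)%N -> pcoef i = 0 }.

HB.instance Definition _ := gen_eqMixin pol.
HB.instance Definition _ := gen_choiceMixin pol.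

Lemma polP (p q : pol) : (forall i, pcoef p i = pcoef q i) -> p = q.
Proof.
case: p q => [p hp] [q hq] /= /funext epq.
by subst q; congr Pol; apply: Prop_irrelevance.
Qed.

Program Definition pol0 := @Pol (fun _ => 0) _.
Next Obligation. by exists 0%N. Qed.
Program Definition pol_opp p := @Pol (fun i => - pcoef p i) _.
Next Obligation.
by move=> p /=; have [N hN] := pcoef_fin p; exists N => i /hN ->; rewrite oppr0.
Qed.
Program Definition pol_add p q := @Pol (fun i => pcoef p i + pcoef q i) _.
Next Obligation.
move=> p q /=; have [[N hN] [M hM]] := conj (pcoef_fin p) (pcoef_fin q).
exists (maxn N M) => i; rewrite geq_max => /andP[/hN -> /hM ->].
by rewrite addr0.
Qed.

Fact pol_addA : associative pol_add.
Proof. by move=> p q r; apply: polP => i /=; rewrite addrA. Qed.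
Fact pol_addC : commutative pol_add.
Proof. by move=> p q; apply: polP => i /=; rewrite addrC. Qed.
Fact pol_add0 : left_id pol0 pol_add.
Proof. by move=> p; apply: polP => i /=; rewrite add0r. Qed.
Fact pol_addN : left_inverse pol0 pol_opp pol_add.
Proof. by move=> p; apply: polP => i /=; rewrite addNr. Qed.
HB.instance Definition _ := GRing.isZmodule.Build pol
  pol_addA pol_addC pol_add0 pol_addN.

Program Definition pol_const (c : R) := @Pol (fun i => c *+ (i == 0)%N) _.
Next Obligation. by move=> c; exists 1%N => -[|i]. Qed.
Program Definition pol_mul p q :=
  @Pol (fun i => \sum_(j < i.+1) pcoef p j * pcoef q (i - j)) _.
Next Obligation.
move=> p q /=; have [[N hN] [M hM]] := conj (pcoef_fin p) (pcoef_fin q).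
exists (N + M)%N => i NMi; rewrite big1 // => j _.
have [/hN ->|ltjN] := leqP N j; first by rewrite mul0r.
rewrite hM ?mulr0 // leq_subRL ?leq_ord //.
by rewrite (leq_trans _ NMi) // leq_add2r ltnW.
Qed.

Fact pol_mulC : commutative pol_mul.
Proof.
move=> p q; apply: polP => i /=; rewrite (reindex_inj rev_ord_inj) /=.
by apply: eq_bigr => j _; rewrite subSS sub_ordK mulrC.
Qed.

Fact pol_mulA : associative pol_mul.
Proof.
have mul_rev p q i :
    pcoef (pol_mul p q) i = \sum_(j < i.+1) pcoef p (i - j) * pcoef q j.
  by rewrite pol_mulC; apply: eq_bigr => j _; rewrite mulrC.
have mulE p q i :
    pcoef (pol_mul p q) i = \sum_(j < i.+1) pcoef p j * pcoef q (i - j).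
  by [].
move=> p q r; apply: polP => i; rewrite mulE mul_rev.
pose coef3 j k := pcoef p j * (pcoef q (i - j - k)%N * pcoef r k).
transitivity (\sum_(j < i.+1) \sum_(k < i.+1 | (k <= i - j)%N) coef3 j k).
  apply: eq_bigr => j _; rewrite mul_rev big_distrr /=.
  by rewrite (big_ord_narrow_leq (leq_subr _ _)).
rewrite (exchange_big_dep predT) //=; apply: eq_bigr => k _.
transitivity (\sum_(j < i.+1 | (j <= i - k)%N) coef3 j k).
  apply: eq_bigl => j; rewrite -ltnS -(ltnS j) -!subSn ?leq_ord //.
  by rewrite -subn_gt0 -(subn_gt0 j) -!subnDA addnC.
rewrite (big_ord_narrow_leq (leq_subr _ _)) big_distrl /=.
by apply: eq_bigr => j _; rewrite /coef3 -!subnDA addnC mulrA.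
Qed.

Fact pol_mul1 : left_id (pol_const 1) pol_mul.
Proof.
move=> p; apply: polP => i /=; rewrite big_ord_recl subn0 /= mul1r.
by rewrite big1 ?addr0 // => j _; rewrite mulr0n mul0r.
Qed.

Fact pol_mulDl : left_distributive pol_mul +%R.
Proof.
move=> p q r; apply: polP => i /=; rewrite -big_split.
by apply: eq_bigr => j _; rewrite mulrDl.
Qed.

HB.instance Definition _ := GRing.Zmodule_isComPzRing.Build pol
  pol_mulA pol_mulC pol_mul1 pol_mulDl.

Program Definition polX := @Pol (fun i => (i == 1)%:R) _.
Next Obligation. by exists 2%N => -[|[]]. Qed.

Fact pol_const_nmod : nmod_morphism pol_const.
Proof. by split=> [|c d]; apply: polP => i /=; rewrite ?mul0rn ?mulrnDl. Qed.
Fact pol_const_monoid : monoid_morphism pol_const.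
Proof.
split=> // c d; apply: polP => i /=.
rewrite big_ord_recl subn0 /= mulr1n mulrnAr big1 ?addr0 // => j _.
by rewrite mulr0n mul0r.
Qed.
HB.instance Definition _ :=
  GRing.isNmodMorphism.Build R pol pol_const pol_const_nmod.
HB.instance Definition _ :=
  GRing.isMonoidMorphism.Build R pol pol_const pol_const_monoid.

End Polynomials.

(* R / (d); MathComp's ring quotients require a proper ideal. *)
Section PrincipalQuotient.
Variables (R : comPzRingType) (d : R).

Fact pquot_equiv_class : equiv_class_of (fun x y => `[< exists z, x - y = z * d >]).
Proof.
split=> [x | x y | y x z].
- by apply/asboolP; exists 0; rewrite subrr mul0r.
- by apply/asboolP/asboolP => -[z e]; exists (- z); rewrite mulNr -e opprB.
- move=> /asboolP[u eu] /asboolP[v ev]; apply/asboolP; exists (u + v).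
  by rewrite mulrDl -eu -ev addrA subrK.
Qed.
Canonical pquot_equiv := EquivRelPack pquot_equiv_class.

Definition pquot : Type := {eq_quot pquot_equiv}.
HB.instance Definition _ := Choice.on pquot.
HB.instance Definition _ := EqQuotient.on pquot.

Definition pquot_pi (x : R) : pquot := \pi_pquot x.

Lemma pquotP x y : (exists z, x - y = z * d) <-> pquot_pi x = pquot_pi y.
Proof. by split=> [xy | /eqmodP/asboolP //]; exact/eqmodP/asboolP. Qed.

Lemma pquotE (x : pquot) : exists a, x = pquot_pi a.
Proof. by exists (repr x); rewrite /pquot_pi reprK. Qed.

Lemma pquot_repr x : exists z, repr (pquot_pi x) - x = z * d.
Proof. by apply/pquotP; rewrite /pquot_pi reprK. Qed.

Definition pquot_opp (x : pquot) := pquot_pi (- repr x).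
Definition pquot_add (x y : pquot) := pquot_pi (repr x + repr y).
Definition pquot_mul (x y : pquot) := pquot_pi (repr x * repr y).

Lemma pquot_oppE a : pquot_opp (pquot_pi a) = pquot_pi (- a).
Proof.
apply/pquotP; have [z ez] := pquot_repr a.
by exists (- z); rewrite mulNr -ez opprD.
Qed.
Lemma pquot_addE a b : pquot_add (pquot_pi a) (pquot_pi b) = pquot_pi (a + b).
Proof.
apply/pquotP; have [[y ey] [z ez]] := conj (pquot_repr a) (pquot_repr b).
by exists (y + z); rewrite mulrDl -ey -ez opprD addrACA.
Qed.
Lemma pquot_mulE a b : pquot_mul (pquot_pi a) (pquot_pi b) = pquot_pi (a * b).
Proof.
apply/pquotP; have [[y ey] [z ez]] := conj (pquot_repr a) (pquot_repr b).
exists (y * repr (pquot_pi b) + a * z); rewrite mulrDl -(mulrA a) -ez.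
by rewrite mulrAC -ey mulrBl mulrBr addrA subrK.
Qed.

Local Ltac lift := repeat (let x := fresh in move=> x; case: (pquotE x) => {x} ? ->).

Fact pquot_addA : associative pquot_add.
Proof. by lift; rewrite !pquot_addE addrA. Qed.
Fact pquot_addC : commutative pquot_add.
Proof. by lift; rewrite !pquot_addE addrC. Qed.
Fact pquot_add0 : left_id (pquot_pi 0) pquot_add.
Proof. by lift; rewrite !pquot_addE add0r. Qed.
Fact pquot_addN : left_inverse (pquot_pi 0) pquot_opp pquot_add.
Proof. by lift; rewrite pquot_oppE pquot_addE addNr. Qed.
HB.instance Definition _ := GRing.isZmodule.Build pquot
  pquot_addA pquot_addC pquot_add0 pquot_addN.

Fact pquot_mulA : associative pquot_mul.
Proof. by lift; rewrite !pquot_mulE mulrA. Qed.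
Fact pquot_mulC : commutative pquot_mul.
Proof. by lift; rewrite !pquot_mulE mulrC. Qed.
Fact pquot_mul1 : left_id (pquot_pi 1) pquot_mul.
Proof. by lift; rewrite pquot_mulE mul1r. Qed.
Fact pquot_mulDl : left_distributive pquot_mul pquot_add.
Proof. by lift; rewrite !(pquot_addE, pquot_mulE) mulrDl. Qed.
HB.instance Definition _ := GRing.Zmodule_isComPzRing.Build pquot
  pquot_mulA pquot_mulC pquot_mul1 pquot_mulDl.

Fact pquot_pi_nmod : nmod_morphism pquot_pi.
Proof. by split=> // a b; rewrite [RHS]pquot_addE. Qed.
Fact pquot_pi_monoid : monoid_morphism pquot_pi.
Proof. by split=> // a b; rewrite [RHS]pquot_mulE. Qed.
HB.instance Definition _ :=
  GRing.isNmodMorphism.Build R pquot pquot_pi pquot_pi_nmod.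
HB.instance Definition _ :=
  GRing.isMonoidMorphism.Build R pquot pquot_pi pquot_pi_monoid.

End PrincipalQuotient.

(* R[X] / (X ^ n - c) as an R-algebra. *)
Section RootExtension.
Variables (R : comPzRingType) (n : nat) (c : R).

Definition root_ext := pquot (polX R ^+ n - pol_const c).
HB.instance Definition _ := GRing.ComPzRing.on root_ext.

Definition root_ext_X : root_ext := pquot_pi _ (polX R).

Program Definition root_ext_scalar : central_hom R root_ext :=
  @CentralHom R root_ext
    (pquot_pi (polX R ^+ n - pol_const c) \o @pol_const R) _.
Next Obligation. by move=> r x; apply: mulrC. Qed.

End RootExtension.

Lemma rationalize_central (A : pzRingType) (a : A) :
  (forall x, GRing.comm a x) ->
  forall x : rationalize A, GRing.comm (tens _ _ a 1 : rationalize A) x.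
Proof.
move=> aC x; elim/tens_ind: x => [|x y ex ey|b r].
- exact: commr0.
- exact: commrD.
by rewrite /GRing.comm !tensM mul1r mulr1 aC.
Qed.

(* The Q-algebra Q[pi_A] in End^o(A) for the Frobenius endomorphism pi_A, with
   its inclusion in End^o(A). *)
Section FrobeniusAlgebra.
Variables (F : finFieldType) (A : gfunctor F).

Definition EndQ : Type := rationalize (End A).
HB.instance Definition _ := GRing.PzRing.on EndQ.

Definition EndQ_of (lam : End A) (r : rat) : EndQ := tens _ _ lam r.

Definition frobQ : EndQ := EndQ_of (frobenius A) 1.

Definition Qfrob : Type := adjoin (rat_scalar (End A)) frobQ.
HB.instance Definition _ := GRing.ComPzRing.on Qfrob.

Definition Qfrob_pi : Qfrob := adjoin_elt (rat_scalar (End A)) frobQ.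

Definition Qfrob_incl : central_hom Qfrob EndQ :=
  adjoin_incl (rat_scalar (End A))
    (rationalize_central (@frobenius_central F A)).

(* End^o(A) ox_{Q[pi_A]} Q[pi_A][X] / (X ^ n - pi_A) *)
Definition EndQ_root (n : nat) : Type :=
  tensor Qfrob_incl (root_ext_scalar n Qfrob_pi).
HB.instance Definition _ n := GRing.PzRing.on (EndQ_root n).

Definition EndQ_root_tens n (x : EndQ) (y : root_ext n Qfrob_pi) :
  EndQ_root n := tens _ _ x y.

End FrobeniusAlgebra.

(* Main.v *)
(* Write q = #|k|, Q = #|F| = q ^ n for the fields k and F = L.

   Base change: for an F-algebra S with underlying k-algebra S|k, the algebra
   S|k (x)_k F is the product of the Galois twists of S, so W(S|k) is the product
   of the groups A(S^(i)), for S^(i) the algebra S with structure map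
   c |-> c ^ (q ^ (n - i)).  Homomorphisms W -> W correspond to homomorphisms
   W_F -> A, that is, to families of homomorphisms f_i from the twists of A to A,
   and pi_k ^ i corresponds to the relative Frobenius Fr_i : A(S^(i)) -> A(S).

   Isogeny: since there is V in End(A) with V pi_K = Q, each Q f_i is of the form
   lam_i Fr_i, and lam_i Fr_i = 0 forces Q lam_i = 0.  Thus, up to torsion,
   End(W) is free over Res(End(A)) with basis 1, pi_k, ..., pi_k ^ (n - 1).

   Verschiebung: let x be the point of A over the coordinate ring B of an affine
   open subset.  The sum of the Q conjugates of x in the Q-th tensor power T of B
   is invariant under a group G of order Q permuting the factors, and it restricts
   to Q x on the diagonal.  Invariant elements of T restrict to Q-th powers on the
   diagonal, so Q x comes from a point v with Frob(v) = Q x.  As A is separated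
   and B is a domain, v is unique; the points v then glue to a morphism V, which
   is additive because tensor products of reduced F-algebras are reduced. *)
Require Import Defs.
From HB Require Import structures.
From mathcomp Require Import all_boot all_order all_algebra all_fingroup all_solvable all_field.
From mathcomp Require Import boolp classical_sets.
From mathcomp Require Import ring.

Set Implicit Arguments.
Unset Strict Implicit.
Unset Printing Implicit Defensive.

Import GRing.Theory Num.Theory.
Local Open Scope ring_scope.
#[local] Obligation Tactic := idtac.

(** * Constructions of small rings *)

(** The factor Q has one source: a homomorphism f from a twist of A to A need not factor through the
    relative Frobenius, but Q f does, because multiplication by Q on the twist is its Frobenius
    after V, and this Frobenius passes through A(S). Hence the statements about End(W) hold up to
    Q-torsion, and inverting Q in the rational algebras removes the defect. The equation Frob(v) = Q
    x determines v only over reduced algebras, whereas morphisms are natural transformations on all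
    algebras. Each identity for V is therefore proved over a reduced algebra that carries the
    universal case, a localization of a chart or a tensor product of two charts, and then
    transported along a homomorphism. Finiteness of F enters through c ^ #|F| = c: Frobenius is
    F-linear, so it preserves linear independence in reduced algebras. The functions m |-> b ^ (#|F|
    ^ m i) replace pure tensors faithfully because additive polynomials separate independent
    elements of a domain. *)

Record setoidRing := SetoidRing {
  src :> Set;
  setoid_rel : src -> src -> Prop;
  setoid0 : src; setoid1 : src; setoidN : src -> src; setoidD : src -> src -> src;
  setoidM : src -> src -> src;
  setoid_refl : forall x, setoid_rel x x;
  setoid_sym : forall x y, setoid_rel x y -> setoid_rel y x;
  setoid_trans : forall x y z, setoid_rel x y -> setoid_rel y z -> setoid_rel x z;
  setoidNE : forall x x', setoid_rel x x' -> setoid_rel (setoidN x) (setoidN x');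
  setoidDE : forall x x' y y',
    setoid_rel x x' -> setoid_rel y y' -> setoid_rel (setoidD x y) (setoidD x' y');
  setoidME : forall x x' y y',
    setoid_rel x x' -> setoid_rel y y' -> setoid_rel (setoidM x y) (setoidM x' y');
  setoidDA : forall x y z, setoid_rel (setoidD x (setoidD y z)) (setoidD (setoidD x y) z);
  setoidDC : forall x y, setoid_rel (setoidD x y) (setoidD y x);
  setoidD0 : forall x, setoid_rel (setoidD setoid0 x) x;
  setoidDN : forall x, setoid_rel (setoidD (setoidN x) x) setoid0;
  setoidMA : forall x y z, setoid_rel (setoidM x (setoidM y z)) (setoidM (setoidM x y) z);
  setoidMC : forall x y, setoid_rel (setoidM x y) (setoidM y x);
  setoidM1 : forall x, setoid_rel (setoidM setoid1 x) x;
  setoidMD : forall x y z, setoid_rel (setoidM (setoidD x y) z)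
    (setoidD (setoidM x z) (setoidM y z)) }.

HB.instance Definition _ (S : setoidRing) := gen_eqMixin (src S).
HB.instance Definition _ (S : setoidRing) := gen_choiceMixin (src S).

Section SetoidQuotient.
Variable S : setoidRing.

(* The carrier consists of chosen representatives, since the type of
   equivalence classes would not be in Set. *)
Definition canon (x : S) : S := xget x [set y | setoid_rel x y]%classic.

Lemma canon_rel x : setoid_rel x (canon x).
Proof. by rewrite /canon; apply: xgetPex; exists x; apply: setoid_refl. Qed.

Lemma canon_eq x y : setoid_rel x y -> canon x = canon y.
Proof.
move=> xy; rewrite /canon.
have -> : [set z | setoid_rel x z]%classic = [set z | setoid_rel y z]%classic.
  apply/seteqP; split=> z /= h; first exact: setoid_trans (setoid_sym xy) h.
  exact: setoid_trans xy h.
(* The two sides differ only in the default of [xget], which is not reached: the set contains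
   [y]. *)
rewrite /xget; case: pselect => // -[]; exists y.
exact/asboolP/setoid_refl.
Qed.

Definition squot_carrier : Set := {x : S | canon x = x}.

Lemma canonK x : canon (canon x) = canon x.
Proof. by apply/esym/canon_eq/canon_rel. Qed.

Definition spi (x : S) : squot_carrier := exist _ (canon x) (canonK x).
Definition srepr (x : squot_carrier) : S := sval x.

Lemma spiK x : spi (srepr x) = x.
Proof. by case: x => x hx; rewrite /spi /=; apply: eq_exist; rewrite hx. Qed.

Lemma spi_eqP x y : spi x = spi y <-> setoid_rel x y.
Proof.
split=> [[e]|/canon_eq e]; last by apply: eq_exist.
apply: setoid_trans (canon_rel x) _; rewrite e; exact/setoid_sym/canon_rel.
Qed.

Lemma srepr_pi x : setoid_rel (srepr (spi x)) x.
Proof. exact/setoid_sym/canon_rel. Qed.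

Lemma spi_surj (x : squot_carrier) : exists y, x = spi y.
Proof. by exists (srepr x); rewrite spiK. Qed.

Let qN x := spi (setoidN (srepr x)).
Let qD x y := spi (setoidD (srepr x) (srepr y)).
Let qM x y := spi (setoidM (srepr x) (srepr y)).

Let qNE x : qN (spi x) = spi (setoidN x).
Proof. exact/spi_eqP/setoidNE/srepr_pi. Qed.
Let qDE x y : qD (spi x) (spi y) = spi (setoidD x y).
Proof. exact/spi_eqP/setoidDE/srepr_pi/srepr_pi. Qed.
Let qME x y : qM (spi x) (spi y) = spi (setoidM x y).
Proof. exact/spi_eqP/setoidME/srepr_pi/srepr_pi. Qed.

Local Ltac lift := repeat (let x := fresh in move=> x; case: (spi_surj x) => {x} ? ->);
  rewrite ?(qNE, qDE, qME); apply/spi_eqP.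

Fact squot_DA : associative qD. Proof. by lift; apply: setoidDA. Qed.
Fact squot_DC : commutative qD. Proof. by lift; apply: setoidDC. Qed.
Fact squot_D0 : left_id (spi (setoid0 S)) qD. Proof. by lift; apply: setoidD0. Qed.
Fact squot_DN : left_inverse (spi (setoid0 S)) qN qD. Proof. by lift; apply: setoidDN. Qed.
Fact squot_MA : associative qM. Proof. by lift; apply: setoidMA. Qed.
Fact squot_MC : commutative qM. Proof. by lift; apply: setoidMC. Qed.
Fact squot_M1 : left_id (spi (setoid1 S)) qM. Proof. by lift; apply: setoidM1. Qed.
Fact squot_MD : left_distributive qM qD. Proof. by lift; apply: setoidMD. Qed.

(** Localizations, residue fields, tensor powers and tensor products below are all quotients of this
    kind, which keeps them within [Set]. *)
Definition squot : smallRing :=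
  SmallRing squot_DA squot_DC squot_D0 squot_DN squot_MA squot_MC squot_M1 squot_MD.

Definition squot_pi (x : S) : squot := spi x.

Lemma squot_piP x y : squot_pi x = squot_pi y <-> setoid_rel x y.
Proof. exact: spi_eqP. Qed.
Lemma squot_surj (x : squot) : exists y, x = squot_pi y.
Proof. exact: spi_surj. Qed.
Lemma squot_pi0 : squot_pi (setoid0 S) = 0. Proof. by []. Qed.
Lemma squot_pi1 : squot_pi (setoid1 S) = 1. Proof. by []. Qed.
Lemma squot_piD x y : squot_pi (setoidD x y) = squot_pi x + squot_pi y.
Proof. by rewrite [RHS]qDE. Qed.
Lemma squot_piM x y : squot_pi (setoidM x y) = squot_pi x * squot_pi y.
Proof. by rewrite [RHS]qME. Qed.

End SetoidQuotient.

Section MkRmorphism.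
Variables (R S : pzRingType) (f : R -> S).
Hypotheses (f1 : f 1 = 1) (fD : forall x y, f (x + y) = f x + f y)
  (fM : forall x y, f (x * y) = f x * f y).

Fact mk_rmorphism_nmod : nmod_morphism f.
Proof. by split=> [|//]; apply: (@addIr _ (f 0)); rewrite -fD !add0r. Qed.
Fact mk_rmorphism_monoid : monoid_morphism f.
Proof. by split. Qed.

Definition mk_rmorphism : {rmorphism R -> S} :=
  HB.pack f (GRing.isNmodMorphism.Build R S f mk_rmorphism_nmod)
    (GRing.isMonoidMorphism.Build R S f mk_rmorphism_monoid).

Lemma mk_rmorphismE x : mk_rmorphism x = f x.
Proof. by []. Qed.
End MkRmorphism.

Section SetoidLift.
Variables (S : setoidRing) (R : pzRingType) (f : S -> R).
Hypotheses (fE : forall x y, setoid_rel x y -> f x = f y) (f1 : f (setoid1 S) = 1)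
  (fD : forall x y, f (setoidD x y) = f x + f y)
  (fM : forall x y, f (setoidM x y) = f x * f y).

Definition squot_lift_fun (x : squot S) : R := f (srepr x).

Lemma squot_liftE x : squot_lift_fun (squot_pi x) = f x.
Proof. exact/fE/srepr_pi. Qed.

Fact squot_lift1 : squot_lift_fun 1 = 1.
Proof. by rewrite -squot_pi1 squot_liftE. Qed.
Fact squot_liftD x y :
  squot_lift_fun (x + y) = squot_lift_fun x + squot_lift_fun y.
Proof.
have [[a ->] [b ->]] := conj (squot_surj x) (squot_surj y).
by rewrite -squot_piD !squot_liftE.
Qed.
Fact squot_liftM x y :
  squot_lift_fun (x * y) = squot_lift_fun x * squot_lift_fun y.
Proof.
have [[a ->] [b ->]] := conj (squot_surj x) (squot_surj y).
by rewrite -squot_piM !squot_liftE.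
Qed.

Definition squot_lift : {rmorphism squot S -> R} :=
  mk_rmorphism squot_lift1 squot_liftD squot_liftM.

End SetoidLift.

(* ring treats a sum in an exponent as an atom *)
Ltac ringx := rewrite ?exprD; ring.

(** * Localization at one element *)

Section LocRing.
Variables (R : smallRing) (a : R).

(** The pair [(r, m)] stands for the fraction r / a^m; the factor a^k makes the relation transitive
    when [a] is a zero divisor. *)
Definition loc_rel (x y : R * nat) :=
  exists k, a ^+ (k + y.2) * x.1 = a ^+ (k + x.2) * y.1.

Program Definition loc_setoid : setoidRing :=
  @SetoidRing (R * nat)%type loc_rel (0, 0%N) (1, 0%N)
    (fun x => (- x.1, x.2))
    (fun x y => (a ^+ y.2 * x.1 + a ^+ x.2 * y.1, (x.2 + y.2)%N))
    (fun x y => (x.1 * y.1, (x.2 + y.2)%N)) _ _ _ _ _ _ _ _ _ _ _ _ _ _.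
Next Obligation. by move=> x; exists 0%N. Qed.
Next Obligation. by move=> x y [k e]; exists k. Qed.
Next Obligation.
move=> [x m] [y l] [z p] [k /= e] [k' /= e']; exists (k + k' + l)%N => /=.
transitivity (a ^+ (k' + p) * (a ^+ (k + l) * x)); first by ringx.
rewrite e; transitivity (a ^+ (k + m) * (a ^+ (k' + p) * y)); first by ringx.
by rewrite e'; ringx.
Qed.
Next Obligation. by move=> [x m] [y l] [k /= e]; exists k => /=; rewrite !mulrN e. Qed.
Next Obligation.
move=> [x m] [y l] [z p] [t s] [k /= e] [k' /= e']; exists (k + k')%N => /=.
transitivity (a ^+ (k + l) * x * a ^+ (k' + s + p) +
              a ^+ (k' + s) * z * a ^+ (k + l + m)); first by ringx.
by rewrite e e'; ringx.
Qed.
Next Obligation.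
move=> [x m] [y l] [z p] [t s] [k /= e] [k' /= e']; exists (k + k')%N => /=.
transitivity ((a ^+ (k + l) * x) * (a ^+ (k' + s) * z)); first by ringx.
by rewrite e e'; ringx.
Qed.
Next Obligation. by move=> [x m] [y l] [z p]; exists 0%N => /=; ringx. Qed.
Next Obligation. by move=> [x m] [y l]; exists 0%N => /=; ringx. Qed.
Next Obligation. by move=> [x m]; exists 0%N => /=; ringx. Qed.
Next Obligation. by move=> [x m]; exists 0%N => /=; ringx. Qed.
Next Obligation. by move=> [x m] [y l] [z p]; exists 0%N => /=; ringx. Qed.
Next Obligation. by move=> [x m] [y l]; exists 0%N => /=; ringx. Qed.
Next Obligation. by move=> [x m]; exists 0%N => /=; ringx. Qed.
Next Obligation. by move=> [x m] [y l] [z p]; exists 0%N => /=; ringx. Qed.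

Definition loc_ring := squot loc_setoid.

Definition loc_fun (r : R) : loc_ring := squot_pi (S := loc_setoid) (r, 0%N).

Fact loc_funD x y : loc_fun (x + y) = loc_fun x + loc_fun y.
Proof. by rewrite -squot_piD; apply/squot_piP; exists 0%N => /=; ringx. Qed.
Fact loc_funM x y : loc_fun (x * y) = loc_fun x * loc_fun y.
Proof. by rewrite -squot_piM. Qed.

Definition loc_hom : {rmorphism R -> loc_ring} :=
  mk_rmorphism (f := loc_fun) (erefl _) loc_funD loc_funM.

Lemma loc_inv : exists b, loc_hom a * b = 1.
Proof.
exists (squot_pi (S := loc_setoid) (1, 1%N)).
by rewrite mk_rmorphismE -squot_piM; apply/squot_piP; exists 0%N => /=; ringx.
Qed.

Lemma loc_surj s : exists m r, s * loc_hom a ^+ m = loc_hom r.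
Proof.
have [[r m] ->] := squot_surj s; exists m, r.
rewrite -rmorphXn /= /loc_fun -squot_piM.
by apply/squot_piP; exists 0%N => /=; ringx.
Qed.

Lemma loc_ker r : loc_hom r = 0 -> exists m, a ^+ m * r = 0.
Proof.
rewrite mk_rmorphismE /loc_fun -squot_pi0 => /squot_piP[k] /= e.
by exists (k + 0)%N; rewrite e mulr0.
Qed.

End LocRing.

Section Alg.
Variable F : comPzRingType.

Lemma algHom_compE (R S T : alg F) (g : algHom S T) (f : algHom R S) x :
  algHom_comp g f x = g (f x).
Proof. by []. Qed.

Definition loc_alg (R : alg F) (a : R) : alg F :=
  @Alg F (loc_ring a) (loc_hom a \o alg_str R).

Definition loc (R : alg F) (a : R) : algHom R (loc_alg a) :=
  @AlgHom F R (loc_alg a) (loc_hom a) (fun c => erefl _).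

Lemma loc_localization (R : alg F) (a : R) : is_localization (loc a) a.
Proof. by split; [exact: loc_inv | exact: loc_surj | exact: loc_ker]. Qed.

Section Universal.
Variables (R R' S : alg F) (f : algHom R R') (a : R) (g : algHom R S).
Hypothesis locf : is_localization f a.

Lemma loc_hom_ext (h h' : algHom R' S) :
  algHom_comp h f = algHom_comp h' f -> h = h'.
Proof.
case: locf => [[b fab] lsurj _] e; apply: algHomP => s.
have [m [r er]] := lsurj s.
have hfr x : h (f x) = h' (f x).
  by have /(congr1 (fun k : algHom R S => k x)) := e.
have -> : s = f r * b ^+ m.
  by rewrite -er -mulrA -exprMn fab expr1n mulr1.
have hb : h b = h' b.
  have e1 : h (f a) * h b = 1 by rewrite -rmorphM fab rmorph1.
  have e2 : h (f a) * h' b = 1 by rewrite hfr -rmorphM fab rmorph1.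
  by rewrite -[h b]mulr1 -e2 mulrA [h b * _]mulrC e1 mul1r.
by rewrite !rmorphM !rmorphXn hfr hb.
Qed.

Lemma loc_lift : (exists b, g a * b = 1) ->
  exists h : algHom R' S, algHom_comp h f = g.
Proof.
case: locf => [_ lsurj lker] [c gac].
have /choice[num hnum] s :
    exists p : nat * R, s * f a ^+ p.1 = f p.2.
  by have [m [r e]] := lsurj s; exists (m, r).
pose h s := g (num s).2 * c ^+ (num s).1.
have gac_n m : g a ^+ m * c ^+ m = 1 by rewrite -exprMn gac expr1n.
have g_eq x y : f x = f y -> g x = g y.
  move=> /eqP; rewrite -subr_eq0 -rmorphB => /eqP/lker[m] e.
  apply/eqP; rewrite -subr_eq0 -rmorphB; apply/eqP.
  by rewrite -[g _]mul1r -(gac_n m) mulrAC -rmorphXn -rmorphM e rmorph0 mul0r.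
(* Any numerator and exponent compute [h s], not only the chosen ones; additivity and
   multiplicativity then reduce to common denominators. *)
have hE s m r : s * f a ^+ m = f r -> h s = g r * c ^+ m.
  move=> e; rewrite /h; move: (hnum s); case: (num s) => l t /= e'.
  have : g (t * a ^+ m) = g (r * a ^+ l).
    by apply: g_eq; rewrite !rmorphM !rmorphXn -e -e'; ringx.
  rewrite !rmorphM !rmorphXn => e2.
  transitivity (g t * g a ^+ m * (c ^+ l * c ^+ m)).
    by rewrite -[LHS]mulr1 -(gac_n m); ringx.
  by rewrite e2 -[RHS]mulr1 -(gac_n l); ringx.
have hf r : h (f r) = g r.
  by rewrite (hE (f r) 0%N r) ?expr0 ?mulr1.
have h1 : h 1 = 1 by rewrite -(rmorph1 f) hf rmorph1.
have hD x y : h (x + y) = h x + h y.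
  rewrite (hE (x + y) ((num x).1 + (num y).1)%N
     ((num x).2 * a ^+ (num y).1 + (num y).2 * a ^+ (num x).1)).
    rewrite rmorphD !rmorphM !rmorphXn /h.
    transitivity (g (num x).2 * c ^+ (num x).1 * (g a ^+ (num y).1 * c ^+ (num y).1)
      + g (num y).2 * c ^+ (num y).1 * (g a ^+ (num x).1 * c ^+ (num x).1)).
      by ringx.
    by rewrite !gac_n !mulr1.
  by rewrite rmorphD !rmorphM !rmorphXn -!hnum; ringx.
have hM x y : h (x * y) = h x * h y.
  rewrite (hE (x * y) ((num x).1 + (num y).1)%N ((num x).2 * (num y).2)).
    by rewrite rmorphM /h; ringx.
  by rewrite rmorphM -!hnum; ringx.
have hstr d : mk_rmorphism h1 hD hM (alg_str R' d) = alg_str S d.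
  by rewrite mk_rmorphismE -(algHom_str f) hf algHom_str.
by exists (AlgHom hstr); apply: algHomP => r; apply: hf.
Qed.

End Universal.
End Alg.

Section GeneratesUnit.
Variables (F : comPzRingType) (R : alg F).

Lemma generates_unitP (S : alg F) (f : algHom R S) (E : set R) :
  generates_unit f E <-> exists l : seq (S * R),
    (forall p, p \in l -> E p.2) /\ \sum_(p <- l) p.1 * f p.2 = 1.
Proof.
split=> [[m [e [s [Ee es]]]] | [l [lE el]]].
  exists [seq (s i, e i) | i <- enum 'I_m]; split.
    by move=> p /mapP[i _ ->]; apply: Ee.
  by rewrite big_map big_enum.
exists (size l), (fun i => (tnth (in_tuple l) i).2),
  (fun i => (tnth (in_tuple l) i).1).
split=> [i|]; first by apply: lE; apply: mem_tnth.
by rewrite -el [RHS]big_tnth.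
Qed.

Lemma generates_unit_inv (S : alg F) (f : algHom R S) (E : set R) a :
  E a -> (exists b, f a * b = 1) -> generates_unit f E.
Proof.
move=> Ea [b eb]; exists 1%N, (fun _ => a), (fun _ => b); split=> //.
by rewrite big_ord1 mulrC.
Qed.

End GeneratesUnit.

(** * Ideals, quotients and residue fields *)

Definition ideal (R : comPzRingType) (I : set R) :=
  [/\ I 0, forall x y, I x -> I y -> I (x + y) & forall x y, I y -> I (x * y)].

Section IdealQuotient.
Variables (R : smallRing) (I : set R).
Hypothesis idealI : ideal I.

Let IN x : I x -> I (- x).
Proof. by case: idealI => _ _ IM Ix; rewrite -mulN1r; apply: IM. Qed.
Let I_eq x : x = 0 -> I x.
Proof. by move=> ->; case: idealI. Qed.

Program Definition ideal_setoid : setoidRing :=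
  @SetoidRing R (fun x y => I (x - y)) 0 1 (fun x => - x) (fun x y => x + y)
    (fun x y => x * y) _ _ _ _ _ _ _ _ _ _ _ _ _ _.
Next Obligation. by move=> x; apply: I_eq; ring. Qed.
Next Obligation. by move=> x y /IN; rewrite opprB. Qed.
Next Obligation.
move=> x y z xy yz; case: idealI => _ ID _.
by have := ID _ _ xy yz; rewrite addrA subrK.
Qed.
Next Obligation. by move=> x y /IN; rewrite opprB opprK addrC. Qed.
Next Obligation.
move=> x x' y y' xx yy; case: idealI => _ ID _.
by have := ID _ _ xx yy; rewrite opprD addrACA.
Qed.
Next Obligation.
move=> x x' y y' xx yy; case: idealI => _ ID IM.
have := ID _ _ (IM y _ xx) (IM x' _ yy).
by rewrite !mulrBr [y * x]mulrC [y * x']mulrC addrA subrK.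
Qed.
Next Obligation. by move=> x y z; apply: I_eq; ring. Qed.
Next Obligation. by move=> x y; apply: I_eq; ring. Qed.
Next Obligation. by move=> x; apply: I_eq; ring. Qed.
Next Obligation. by move=> x; apply: I_eq; ring. Qed.
Next Obligation. by move=> x y z; apply: I_eq; ring. Qed.
Next Obligation. by move=> x y; apply: I_eq; ring. Qed.
Next Obligation. by move=> x; apply: I_eq; ring. Qed.
Next Obligation. by move=> x y z; apply: I_eq; ring. Qed.

Definition ideal_quot := squot ideal_setoid.

Definition ideal_pi : {rmorphism R -> ideal_quot} :=
  mk_rmorphism (f := squot_pi (S := ideal_setoid)) (erefl _)
    (squot_piD (S := ideal_setoid)) (squot_piM (S := ideal_setoid)).

Lemma ideal_piP x y : ideal_pi x = ideal_pi y <-> I (x - y).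
Proof. exact: squot_piP. Qed.

Lemma ideal_pi_surj x : exists y, x = ideal_pi y.
Proof. by have [y ->] := squot_surj x; exists y. Qed.

End IdealQuotient.

(** [Zorn_bigcup] also asks for the union of the empty chain, so the empty set is added to [P]. The
    set [A0] ensures that the maximal element still satisfies [P]. *)
Lemma Zorn_above (T : Type) (P : set (set T)) (A0 : set T) :
  P A0 ->
  (forall C : set (set T), (exists A, C A) -> (forall A, C A -> P A) ->
     (forall A B, C A -> C B -> (A `<=` B \/ B `<=` A)%classic) ->
     P (\bigcup_(X in C) X)%classic) ->
  exists A, P A /\ forall B, P B -> (A `<=` B)%classic -> B = A.
Proof.
move=> PA0 Pchain.
have [C CP totC|A [PA Amax]] := @Zorn_bigcup T (fun X => X = set0 \/ P X)%classic.
  have [[A CA]|noA] := pselect (exists A, C A /\ A <> set0)%classic; last first.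
    left; apply/seteqP; split=> // x [A CA Ax]; apply: noA; exists A; split=> //.
    by move=> A0E; rewrite A0E in Ax.
  right; have -> : (\bigcup_(X in C) X =
      \bigcup_(X in [set X | C X /\ X <> set0]) X)%classic.
    apply/seteqP; split=> x [B CB Bx]; exists B => //; last by case: CB.
    by split=> // B0; rewrite B0 in Bx.
  apply: Pchain => [|B [/CP[] // CB nB]|B B' [CB _] [CB' _]].
  - by exists A.
  - by apply: totC.
have PA' : P A.
  case: PA => // A0E; subst A; have [A00|nA0] := pselect (A0 = set0)%classic.
    by rewrite A00 in PA0.
  case: (Amax A0); last by right.
  by split=> // A0s; apply/nA0/seteqP; split.
exists A; split=> // B PB AB; apply: contrapT => nBA.
apply: (Amax B); last by right.
by split=> // BA; apply: nBA; apply/seteqP; split.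
Qed.

Section ResidueField.
Variables (F : comPzRingType) (R : alg F) (E : set R).
Hypothesis nE : ~ generates_unit (algHom_id R) E.

Definition ideal_gen : set R := fun x => exists l : seq (R * R),
  (forall p, p \in l -> E p.2) /\ \sum_(p <- l) p.1 * p.2 = x.

Lemma ideal_gen_ideal : ideal ideal_gen.
Proof.
split.
- by exists [::]; rewrite big_nil.
- move=> x y [l [lE <-]] [l' [lE' <-]]; exists (l ++ l'); split.
    by move=> p; rewrite mem_cat => /orP[/lE|/lE'].
  by rewrite big_cat.
- move=> x y [l [lE <-]]; exists [seq (x * p.1, p.2) | p <- l]; split.
    by move=> p /mapP[p1 /lE lp ->]; apply: lp.
  by rewrite big_map big_distrr; apply: eq_bigr => p _ /=; rewrite mulrA.
Qed.

Lemma ideal_gen_sub x : E x -> ideal_gen x.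
Proof.
move=> Ex; exists [:: (1, x)]; rewrite big_seq1 mul1r; split=> // p.
by rewrite inE => /eqP ->.
Qed.

Lemma exists_maximal_ideal : exists I : set R, [/\ ideal I, ~ I 1,
  forall x, E x -> I x & forall J, ideal J -> ~ J 1 -> (I `<=` J)%classic -> J = I].
Proof.
pose P (I : set R) := [/\ ideal I, ~ I 1 & forall x, E x -> I x].
have [||I [[Iid nI EI] Imax]] := @Zorn_above R P ideal_gen.
- split; [exact: ideal_gen_ideal| |exact: ideal_gen_sub].
  by move=> g1; apply: nE; apply/generates_unitP.
- move=> C [A CA] CP totC; split.
  + have [[A0 AD AM] _ _] := CP _ CA; split; first by exists A.
      move=> x y [B CB Bx] [B' CB' By].
      have [BB|BB] := totC _ _ CB CB'.
        by exists B' => //; have [[_ D _] _ _] := CP _ CB'; apply: D => //; apply: BB.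
      by exists B => //; have [[_ D _] _ _] := CP _ CB; apply: D => //; apply: BB.
    move=> x y [B CB By]; exists B => //.
    by have [[_ _ M] _ _] := CP _ CB; apply: M.
  + by move=> [B /CP[]].
  + by move=> x Ex; exists A => //; have [_ _] := CP _ CA; apply.
exists I; split=> // J Jid nJ IJ; apply: Imax => //; split=> // x Ex.
exact/IJ/EI.
Qed.

(** The field is the quotient by a maximal ideal containing [E]. Open covers are tested on
    field-valued points only, and this lemma carries them over to arbitrary algebras. *)
Lemma exists_residue_field :
  exists (M : alg F) (f : algHom R M), is_field M /\ vanishes f E.
Proof.
have [I [Iid nI EI Imax]] := exists_maximal_ideal.
pose M := @Alg F (ideal_quot Iid) (ideal_pi Iid \o alg_str R).
exists M, (@AlgHom F R M (ideal_pi Iid) (fun c => erefl _)); split; last first.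
  move=> e /EI Ie; rewrite -[RHS](rmorph0 (ideal_pi Iid)).
  by apply/ideal_piP; rewrite subr0.
split=> [/ideal_piP|a]; first by rewrite subr0.
have [x ->] := ideal_pi_surj a => nx.
have nIx : ~ I x.
  by move=> Ix; apply: nx; rewrite -(rmorph0 (ideal_pi Iid)); apply/ideal_piP; rewrite subr0.
pose J : set R := fun y => exists i r, I i /\ y = i + r * x.
have [I0 ID IM] := Iid.
have Jid : ideal J.
  split.
  - by exists 0, 0; split=> //; ring.
  - move=> y z [i [r [Ii ->]]] [i' [r' [Ii' ->]]]; exists (i + i'), (r + r').
    by split; [exact: ID | ring].
  - move=> y z [i [r [Ii ->]]]; exists (y * i), (y * r).
    by split; [exact: IM | ring].
have [J1|nJ1] := pselect (J 1).
  have [i [r [Ii e]]] := J1; exists (ideal_pi Iid r).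
  rewrite -rmorphM -[RHS](rmorph1 (ideal_pi Iid)); apply/ideal_piP.
  have -> : x * r - 1 = (-1) * i by rewrite [X in _ - X]e; ring.
  exact: IM.
case: nIx; rewrite -(Imax J Jid nJ1).
  by exists 0, 1; split=> //; ring.
by move=> y Iy; exists y, 0; split=> //; ring.
Qed.

End ResidueField.

(** * Zariski covers *)

Section Cover.
Variables (F : comPzRingType).

(** Otherwise all a_i^N vanish in some residue field; then so do all a_i, and hence 1. *)
Lemma unit_ideal_pow (R : alg F) m (a b : 'I_m -> R) N :
  \sum_i b i * a i = 1 -> exists c : 'I_m -> R, \sum_i c i * a i ^+ N = 1.
Proof.
move=> ba1; apply: contrapT => nc.
pose E : set R := fun x => exists c : 'I_m -> R, \sum_i c i * a i ^+ N = x.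
have E0 : E 0 by exists (fun _ => 0); rewrite big1 // => i _; rewrite mul0r.
have ED x y : E x -> E y -> E (x + y).
  move=> [c <-] [d <-]; exists (fun i => c i + d i).
  by rewrite -big_split; apply: eq_bigr => i _; rewrite mulrDl.
have EM x y : E y -> E (x * y).
  move=> [c <-]; exists (fun i => x * c i).
  by rewrite big_distrr; apply: eq_bigr => i _; rewrite /= mulrA.
have [M [f [[M1 Mf] fE]]] : exists (M : alg F) (f : algHom R M),
    is_field M /\ vanishes f E.
  apply: exists_residue_field => -[l [e [s [Ee es]]]]; apply: nc.
  rewrite -/(E 1) -es; apply: big_ind => // i _.
  exact/EM/Ee.
have fa i : f (a i) = 0.
  apply: contrapT => /Mf[b' fab].
  have : f (a i ^+ N) = 0.
    apply: fE; exists (fun j => (j == i)%:R).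
    rewrite (bigD1 i) //= eqxx mul1r big1 ?addr0 // => j /negPf ->.
    by rewrite mul0r.
  move=> fN0; apply: M1.
  by rewrite -(expr1n M N) -fab exprMn -rmorphXn fN0 mul0r.
apply: M1; rewrite -(rmorph1 f) -ba1 rmorph_sum big1 // => i _ /=.
by rewrite rmorphM fa mulr0.
Qed.

Section Glue.
Variables (R : alg F) (m : nat) (a : 'I_m -> R) (Ri : 'I_m -> alg F)
  (f : forall i, algHom R (Ri i)).
Hypothesis a1 : exists b : 'I_m -> R, \sum_i b i * a i = 1.
Hypothesis locf : forall i, is_localization (f i) (a i).

Lemma glue_uniq (x y : R) : (forall i, f i x = f i y) -> x = y.
Proof.
move=> fxy; have /choice[N hN] i : exists N, a i ^+ N * (x - y) = 0.
  by case: (locf i) => _ _; apply; rewrite rmorphB fxy subrr.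
have [b ab] := a1; have [c ac] := unit_ideal_pow (\max_i N i) ab.
apply/eqP; rewrite -subr_eq0 -[_ - _]mul1r -ac big_distrl big1 //= => i _.
have /subnK <- := leq_bigmax (F := N) i.
by rewrite exprD mulrA -!mulrA hN !mulr0.
Qed.

(** Numerators over the common denominators a_i^N agree on overlaps only after multiplication by a
    power of a_i a_j; the exponent [M] absorbs all of these. The numerators are then combined with
    coefficients c_i such that the sum of c_i a_i^(N+M) is 1. *)
Lemma glue_elem (r : forall i, Ri i) :
  (forall i j (S : alg F) (g : algHom (Ri i) S) (h : algHom (Ri j) S),
     algHom_comp g (f i) = algHom_comp h (f j) -> g (r i) = h (r j)) ->
  exists y : R, forall i, f i y = r i.
Proof.
move=> compat.
have /choice[N0 /choice[p0 hp0]] i : exists N p, r i * f i (a i) ^+ N = f i p.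
  by case: (locf i) => _ + _; apply.
pose N := \max_i N0 i; pose p i := a i ^+ (N - N0 i) * p0 i.
have hp i : r i * f i (a i) ^+ N = f i (p i).
  rewrite rmorphM -hp0 rmorphXn mulrCA -exprD subnK //.
  exact: leq_bigmax.
have /choice[K hK] (ij : 'I_m * 'I_m) : exists k,
    (a ij.1 * a ij.2) ^+ k * (a ij.2 ^+ N * p ij.1 - a ij.1 ^+ N * p ij.2) = 0.
  case: ij => i j /=.
  have [[b Sb] _ Sker] := loc_localization (a i * a j).
  apply: Sker; set S := loc (a i * a j) in Sb *.
  have [|g eg] := loc_lift (g := S) (locf i).
    by exists (S (a j) * b); rewrite mulrA -rmorphM.
  have [|h eh] := loc_lift (g := S) (locf j).
    by exists (S (a i) * b); rewrite mulrA -rmorphM [a j * _]mulrC.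
  have grhr := compat i j _ g h (etrans eg (esym eh)).
  have gE x : g (f i x) = S x by rewrite -eg.
  have hE x : h (f j x) = S x by rewrite -eh.
  rewrite rmorphB (rmorphM _ _ (p i)) (rmorphM _ _ (p j)).
  rewrite -(gE (p i)) -hp -(hE (p j)) -hp !rmorphM grhr.
  by rewrite -!rmorphXn gE hE rmorphXn; ring.
pose M := \max_ij K ij; pose p' i := a i ^+ M * p i.
have hp' i j : a j ^+ (N + M) * p' i = a i ^+ (N + M) * p' j.
  apply/eqP; rewrite -subr_eq0; apply/eqP.
  transitivity ((a i * a j) ^+ M * (a j ^+ N * p i - a i ^+ N * p j)).
    by rewrite /p' exprMn !exprD; ring.
  have /subnK <- : (K (i, j) <= M)%N by apply: leq_bigmax.
  by rewrite exprD -mulrA (hK (i, j)) mulr0.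
have [b ab] := a1; have [c ac] := unit_ideal_pow (N + M) ab.
exists (\sum_i c i * p' i) => j.
have [[d fjd] _ _] := locf j.
have unit_pow l : f j (a j) ^+ l * d ^+ l = 1 by rewrite -exprMn fjd expr1n.
have e : a j ^+ (N + M) * (\sum_i c i * p' i) = p' j.
  rewrite big_distrr -[RHS]mul1r -ac big_distrl; apply: eq_bigr => i _ /=.
  by rewrite mulrCA hp' mulrA.
rewrite -[LHS]mulr1 -(unit_pow (N + M)%N) mulrA [_ * f j (a j) ^+ _]mulrC.
rewrite -rmorphXn -rmorphM e /p' rmorphM -hp rmorphXn.
transitivity (r j * (f j (a j) ^+ (N + M) * d ^+ (N + M))).
  by rewrite !exprD; ring.
by rewrite unit_pow mulr1.
Qed.

End Glue.

Lemma Spec_sheaf (B : alg F) : zariski_sheaf (Spec B).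
Proof.
move=> R m a Ri f x a1 locf compat.
have /choice[y hy] b : exists y : R, forall i, f i y = x i b.
  apply: (glue_elem a1 locf) => i j S g h e.
  by have /(congr1 (fun k : algHom B S => k b)) := compat i j S g h e.
have y1 : y 1 = 1.
  by apply: (glue_uniq a1 locf) => i; rewrite hy !rmorph1.
have yD u v : y (u + v) = y u + y v.
  by apply: (glue_uniq a1 locf) => i; rewrite rmorphD !hy rmorphD.
have yM u v : y (u * v) = y u * y v.
  by apply: (glue_uniq a1 locf) => i; rewrite rmorphM !hy rmorphM.
have ystr c : mk_rmorphism y1 yD yM (alg_str B c) = alg_str R c.
  by apply: (glue_uniq a1 locf) => i; rewrite mk_rmorphismE hy !algHom_str.
exists (AlgHom ystr); split=> [i | z hz].
  by apply: algHomP => b; apply: hy.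
apply: algHomP => b; apply: (glue_uniq a1 locf) => i.
by rewrite [LHS]hy -hz.
Qed.

Lemma Spec_scheme (B : alg F) : scheme (Spec B).
Proof.
split; first exact: Spec_sheaf.
pose i : mor (Spec B) (Spec B) := Mor (fun R S f x => erefl (fmap f x)).
exists unit, (fun _ => B), (fun _ => i); split=> [j|L x _]; last by exists tt, x.
split=> [R x y|R x]; first by [].
 exists [set 1]%classic => S f; split=> _; last by exists (fmap f x).
apply: (@generates_unit_inv _ _ _ _ _ 1) => //.
by exists 1; rewrite rmorph1 mulr1.
Qed.

(** If the sets [E j] together did not generate the unit ideal, they would vanish in some residue
    field; but the point over that field lies in a chart, whose [E j] generates the unit ideal
    there. *)
Lemma affine_cover (X : functor F) (J : Type) (B : J -> alg F)
    (i : forall j, mor (Spec (B j)) X) (R : alg F) (y : X R) (E : J -> set R) :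
  affine_open_cover i ->
  (forall j S (f : algHom R S),
     range (i j S) (fmap f y) -> generates_unit f (E j)) ->
  exists m (a : 'I_m -> R) (jj : 'I_m -> J),
    (forall l, E (jj l) (a l)) /\ exists b : 'I_m -> R, \sum_l b l * a l = 1.
Proof.
move=> [_ icov] hE.
have [[m [e [s [Ee es]]]]|nE] :=
    pselect (generates_unit (algHom_id R) (fun x => exists j, E j x)).
  have [jj hjj] := choice Ee.
  by exists m, e, jj; split=> //; exists s.
have [M [f [Mf fE]]] := exists_residue_field nE.
have [j /hE[m [e [s [Ee es]]]]] := icov M (fmap f y) Mf.
case: Mf => M1 _; case: M1; rewrite -es big1 // => l _.
by rewrite fE ?mulr0 //; exists j.
Qed.

Section Sheaf.
Variables (X : functor F) (shX : zariski_sheaf X).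

Lemma sheaf_uniq (R : alg F) m (a : 'I_m -> R) (y z : X R) :
  (exists b : 'I_m -> R, \sum_i b i * a i = 1) ->
  (forall i, fmap (loc (a i)) y = fmap (loc (a i)) z) -> y = z.
Proof.
move=> a1 yz.
have [||w [hw uw]] := @shX R m a _ (fun i => loc (a i))
    (fun i => fmap (loc (a i)) y) a1.
- by move=> i; apply: loc_localization.
- by move=> i j S g h e; rewrite -!fmap_comp e.
by rewrite -(uw y) // -(uw z) // => i; rewrite yz.
Qed.

(** The empty family is a Zariski cover of the zero ring. *)
Lemma sheaf_zero_ring (R : alg F) (y z : X R) : (1 : R) = 0 -> y = z.
Proof.
move=> R0; apply: (@sheaf_uniq R 0 (fun _ => 0)) => [|[]//].
by exists (fun _ => 0); rewrite big_ord0.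
Qed.

End Sheaf.
End Cover.

(** * Invariants of a tensor power in characteristic p *)

Section PGroupSum.
Local Open Scope group_scope.

(** Orbits of a p-group have p-power size and [h] is constant on each, so every orbit other than a
    fixed point contributes a multiple of p. *)
Lemma sum_pgroup_fix (gT : finGroupType) (X : finType)
    (to : {action gT &-> X}) (V : nmodType) (p : nat) (h : X -> V) :
  p.-group [set: gT] -> (forall v : V, v *+ p = 0)%R ->
  (forall g x, h (to x g) = h x) ->
  (\sum_x h x = \sum_(x in 'Fix_to([set: gT])) h x)%R.
Proof.
move=> pG p0 hinv; rewrite (bigID (mem 'Fix_to([set: gT]))) /=.
rewrite [X in (_ + X)%R](_ : _ = 0%R) ?addr0 //.
rewrite (partition_big (orbit to [set: gT]) predT) //= big1 // => O _.
have [x0 /andP[nfix /eqP <-{O}]|none] :=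
    pickP (fun x => (x \notin 'Fix_to([set: gT])) && (orbit to [set: gT] x == O));
  last by rewrite big_pred0.
rewrite (eq_bigl (mem (orbit to [set: gT] x0))); last first.
  move=> x /=; rewrite -orbit_eq_mem; apply/andP/idP=> [[_ /eqP->]|]; first exact: eqxx.
  move=> /eqP e; rewrite e eqxx; split=> //; apply: contra nfix.
  move=> /orbit1P ex; rewrite ex in e.
  have : x0 \in orbit to [set: gT] x0 by apply: orbit_refl.
  rewrite -e => /set1P ->; apply/orbit1P; exact: ex.
rewrite (eq_bigr (fun _ => h x0)); last by move=> x /orbitP[g _ <-].
rewrite sumr_const.
have /p_natP[d ed] : p.-nat #|orbit to [set: gT] x0|.
  by apply: pnat_dvd pG; apply: dvdn_orbit.
case: d ed => [|d] ed; last by rewrite ed expnS mulrnA p0 mul0rn.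
case/negP: nfix; apply/orbit1P/eqP; rewrite eq_sym eqEcard finset.sub1set orbit_refl.
by rewrite ed cards1.
Qed.

(** A right action; as left translation is transitive on [gT], its fixed points are the constant
    functions. *)
Definition trans_act (gT : finGroupType) (X : finType) (x : {ffun gT -> X})
  (g : gT) : {ffun gT -> X} := [ffun i => x (g * i)].

Fact trans_act1 (gT : finGroupType) (X : finType) : @trans_act gT X ^~ 1 =1 id.
Proof. by move=> x; apply/ffunP => i; rewrite ffunE mul1g. Qed.
Fact trans_actM (gT : finGroupType) (X : finType) (x : {ffun gT -> X}) :
  act_morph (@trans_act gT X) x.
Proof. by move=> g h; apply/ffunP => i; rewrite !ffunE mulgA. Qed.

Definition trans_action (gT : finGroupType) (X : finType) :=
  @TotalAction gT {ffun gT -> X} (@trans_act gT X)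
    (@trans_act1 gT X) (@trans_actM gT X).

End PGroupSum.

Section Linearized.
Variables (F : finFieldType) (B : alg F).
Local Notation q := #|F|.
Local Notation s := (alg_str B).

Lemma frobXE m (x : B) : x ^+ (q ^ m) = iter m (frob B) x.
Proof.
elim: m => [|m IHm]; first by rewrite expn0 expr1.
by rewrite expnSr exprM IHm.
Qed.

Lemma frobXD m (x y : B) : (x + y) ^+ (q ^ m) = x ^+ (q ^ m) + y ^+ (q ^ m).
Proof. by rewrite !frobXE; elim: m => //= m ->; rewrite rmorphD. Qed.

Lemma frobX_sum m I (r : seq I) (P : pred I) (f : I -> B) :
  (\sum_(i <- r | P i) f i) ^+ (q ^ m) = \sum_(i <- r | P i) f i ^+ (q ^ m).
Proof.
elim/big_rec2: _ => [|i x y _ <-]; last by rewrite frobXD.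
by rewrite expr0n expn_eq0 -leqn0 leqNgt (ltnW (card_finNzRing_gt1 F)).
Qed.

Lemma frobX_str m c : s c ^+ (q ^ m) = s c.
Proof.
by rewrite frobXE; elim: m => //= m ->; rewrite (algHom_str (frob B)).
Qed.

(** These are the q-polynomials, also called linearized polynomials; they are F-linear because
    scalars satisfy c ^ q = c. *)
Definition linearized N (P : B -> B) :=
  exists w : nat -> B, forall b, P b = \sum_(j < N) w j * b ^+ (q ^ j).

Lemma linearized_widen N N' P : (N <= N')%N -> linearized N P -> linearized N' P.
Proof.
move=> NN' [w hw]; exists (fun j => if (j < N)%N then w j else 0) => b.
rewrite hw (big_ord_widen_cond N' predT (fun j => w j * b ^+ (q ^ j))) //=.
rewrite big_mkcond; apply: eq_bigr => j _.
by case: ifP; rewrite // mul0r.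
Qed.

Lemma linearizedD N P x y : linearized N P -> P (x + y) = P x + P y.
Proof.
move=> [w hw]; rewrite !hw -big_split; apply: eq_bigr => j _.
by rewrite frobXD mulrDr.
Qed.

Lemma linearizedZ N P c x : linearized N P -> P (s c * x) = s c * P x.
Proof.
move=> [w hw]; rewrite !hw big_distrr; apply: eq_bigr => j _ /=.
by rewrite exprMn frobX_str mulrCA.
Qed.

Fixpoint Fspan (e : seq B) (b : B) : Prop :=
  if e is x :: e' then exists c, Fspan e' (b - s c * x) else b = 0.

Lemma Fspan_nth e i : (i < size e)%N -> Fspan e e`_i.
Proof.
have s0 e' : Fspan e' 0.
  elim: e' => // x e' IHe; exists 0; by rewrite rmorph0 mul0r subr0.
elim: e i => // x e IHe [_|i /IHe si] /=.
  by exists 1; rewrite rmorph1 mul1r subrr.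
by exists 0; rewrite rmorph0 mul0r subr0.
Qed.

Lemma Fspan_cons x e b : Fspan e b -> Fspan (x :: e) b.
Proof. by exists 0; rewrite rmorph0 mul0r subr0. Qed.

Lemma Fspan_coef e b : Fspan e b ->
  exists c : nat -> F, b = \sum_(i < size e) s (c i) * e`_i.
Proof.
elim: e b => [|x e IHe] b /=; first by exists (fun _ => 0); rewrite big_ord0.
move=> [c0 /IHe[c e1]]; exists (fun i => if i is i'.+1 then c i' else c0).
by rewrite big_ord_recl /= -e1 addrC subrK.
Qed.

(* The homogenization of prod_c (X - c) = X ^ q - X *)
Lemma prod_sub_scalar (x y : B) :
  \prod_(c : F) (x - s c * y) = x ^+ q - x * y ^+ q.-1.
Proof.
pose h d (p : {poly F}) := \sum_(j < d.+1) s p`_j * x ^+ j * y ^+ (d - j).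
have hXsub d (p : {poly F}) c : (size p <= d.+1)%N ->
    h d.+1 (p * ('X - c%:P)) = h d p * (x - s c * y).
  move=> sp; have -> : h d.+1 (p * ('X - c%:P)) =
      \sum_(j < d.+2) s (p * 'X)`_j * x ^+ j * y ^+ (d.+1 - j) -
      s c * \sum_(j < d.+2) s p`_j * x ^+ j * y ^+ (d.+1 - j).
    rewrite big_distrr -sumrB; apply: eq_bigr => j _ /=.
    by rewrite mulrBr coefB coefMC rmorphB rmorphM; ring.
  rewrite big_ord_recl coefMX /= rmorph0 !mul0r add0r.
  rewrite [X in _ - _ * X]big_ord_recr /= nth_default // rmorph0 !mul0r addr0.
  rewrite mulrBr !big_distrl big_distrr /=; congr (_ - _); apply: eq_bigr => j _.
    by rewrite coefMX /= subSS exprS; ring.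
  have -> : (d.+1 - j = (d - j).+1)%N by rewrite subSn // -ltnS.
  by rewrite exprS; ring.
have hprod (l : seq F) :
    h (size l) (\prod_(c <- l) ('X - c%:P)) = \prod_(c <- l) (x - s c * y).
  elim: l => [|c l IHl]; first by rewrite !big_nil /h big_ord1 coef1 rmorph1 !mul1r.
  rewrite !big_cons mulrC hXsub ?IHl 1?mulrC //.
  by rewrite size_prod_XsubC.
have := hprod (index_enum F).
rewrite -finField_genPoly => <-.
have hX d i : (i <= d)%N -> h d 'X^i = x ^+ i * y ^+ (d - i).
  rewrite -ltnS => id1; rewrite /h (bigD1 (Ordinal id1)) //= coefXn eqxx.
  rewrite rmorph1 mul1r big1 ?addr0 // => j /negPf nj.
  by rewrite coefXn -[(_ == i)%N]/(j == Ordinal id1) nj rmorph0 !mul0r.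
have hB d p p' : h d (p - p') = h d p - h d p'.
  rewrite /h -sumrB; apply: eq_bigr => j _.
  by rewrite coefB rmorphB !mulrBl.
have -> : size (index_enum F) = q by rewrite cardE enumT.
have q0 : (0 < q)%N := ltnW (card_finNzRing_gt1 F).
by rewrite hB -['X]expr1 !hX // subnn mulr1 expr1 subn1.
Qed.

Hypothesis Bdom : is_domain B.

Lemma domain_prod_eq0 I (r : seq I) (f : I -> B) :
  \prod_(i <- r) f i = 0 -> exists i, f i = 0.
Proof.
case: Bdom => B1 Bint; elim: r => [|i r IHr]; first by rewrite big_nil.
by rewrite big_cons => /Bint[fi|/IHr//]; exists i.
Qed.

Lemma domain_exp_eq0 (x : B) m : x ^+ m = 0 -> x = 0.
Proof.
case: Bdom => B1 Bint; elim: m => [|m IHm]; first by rewrite expr0.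
by rewrite exprS => /Bint[].
Qed.

(* The polynomial of F x + V is P(X)^q - P(x)^(q-1) P(X), for P that of V. *)
Lemma linearized_span e :
  exists N P, linearized N P /\ forall b, P b = 0 <-> Fspan e b.
Proof.
elim: e => [|x e [N [P [linP spanP]]]].
  exists 1%N, id; split=> //; exists (fun _ => 1) => b.
  by rewrite big_ord1 expn0 expr1 mul1r.
have PB b c : P (b - s c * x) = P b - s c * P x.
  have -> : b - s c * x = b + s (- c) * x by rewrite rmorphN mulNr.
  by rewrite (linearizedD _ _ linP) (linearizedZ _ _ linP) rmorphN mulNr.
have q0 : (0 < q)%N := ltnW (card_finNzRing_gt1 F).
have [Px0|Px0] := pselect (P x = 0).
  exists N, P; split=> // b; split=> [/spanP|[c /spanP]]; first exact: Fspan_cons.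
  by rewrite PB Px0 mulr0 subr0.
exists N.+1, (fun b => P b ^+ q - P b * P x ^+ q.-1); split; last first.
  move=> b; split=> [|[c /spanP]].
    rewrite -prod_sub_scalar => /domain_prod_eq0[c e0]; exists c; apply/spanP.
    by rewrite PB.
  rewrite PB -prod_sub_scalar (bigD1 c) //= => ->; exact: mul0r.
have [w hw] := linP.
exists (fun j => (if j is j'.+1 then w j' ^+ q else 0) -
                 (if (j < N)%N then w j * P x ^+ q.-1 else 0)) => b.
under [RHS]eq_bigr do rewrite mulrBl.
rewrite sumrB; congr (_ - _).
  rewrite big_ord_recl mul0r add0r hw -[X in _ ^+ X]expn1 frobX_sum.
  by apply: eq_bigr => j _; rewrite exprMn -!exprM expn1 -expnSr.
rewrite big_ord_recr /= ltnn mul0r addr0 hw big_distrl.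
by apply: eq_bigr => j _ /=; rewrite ltn_ord mulrAC.
Qed.

Fixpoint free_seq (e : seq B) : Prop :=
  if e is x :: e' then ~ Fspan e' x /\ free_seq e' else True.

Lemma exists_free_seq (l : seq B) :
  exists e, free_seq e /\ forall b, b \in l -> Fspan e b.
Proof.
elim: l => [|x l [e [efree le]]]; first by exists [::].
have [ex|nex] := pselect (Fspan e x).
  by exists e; split=> // b; rewrite inE => /orP[/eqP->|/le].
exists (x :: e); split=> // b; rewrite inE => /orP[/eqP->|/le eb].
  exact: (@Fspan_nth (x :: e) 0).
exact: Fspan_cons.
Qed.

(** [P i] is the q-polynomial of the span of the elements after the i-th one, so it kills these and
    not the i-th. Its values on earlier elements are unconstrained: the system is triangular. *)
Lemma exists_linearized_family e : free_seq e -> exists N (P : nat -> B -> B),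
  forall i, (i < size e)%N -> [/\ linearized N (P i), P i e`_i <> 0 &
    forall j, (i < j < size e)%N -> P i e`_j = 0].
Proof.
elim: e => [_|x e IHe [nx /IHe[N [P hP]]]]; first by exists 0%N, (fun _ => id).
have [M [P0 [linP0 spanP0]]] := linearized_span e.
exists (maxn M N), (fun i => if i is i'.+1 then P i' else P0) => -[_|i /= ie].
  split=> /=; first exact: linearized_widen (leq_maxl _ _) linP0.
    by move/spanP0.
  by move=> [|j] // ?; apply/spanP0/Fspan_nth.
have [linP Pi Pij] := hP i ie; split=> //; last by move=> [|j] //; apply: Pij.
exact: linearized_widen (leq_maxr _ _) linP.
Qed.

End Linearized.

Section Invariant.
Variables (F : finFieldType) (B : alg F).
Hypothesis Bdom : is_domain B.
Local Notation q := #|F|.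
Local Notation s := (alg_str B).

Lemma alg_str_neq0 c : c != 0 -> s c <> 0.
Proof.
move=> c0 sc0; case: Bdom => + _; apply.
by rewrite -(rmorph1 s) -(mulfV c0) rmorphM sc0 mul0r.
Qed.

(** A q-polynomial is a combination of the powers q^j, so a suitable combination of the given
    relations over all [m] replaces each Frobenius power of e_j by a value of a q-polynomial at e_j.
    The triangular family then isolates one coefficient. *)
Lemma frob_pow_indep (e : seq B) (I : finType)
    (d : {ffun I -> 'I_(size e)} -> F) :
  free_seq e ->
  (forall m : I -> nat,
     \sum_x s (d x) * \prod_i e`_(x i) ^+ (q ^ m i) = 0) ->
  forall x, d x = 0.
Proof.
move=> /(exists_linearized_family Bdom)[N [P hP]] d0 x1.
apply/eqP; apply: contrapT => /negP dx1.
(* [x0] has the least sum of indices among the nonzero coefficients. Any other [x] with nonzero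
   coefficient exceeds [x0] at some place, where the q-polynomial kills the factor, so only the term
   of [x0] remains. *)
case: (@arg_minnP _ x1 (fun x => d x != 0) (fun x => \sum_i x i)%N dx1) => x0 dx0 x0min.
have /choice[w hw] i : exists w : nat -> B, forall b,
    P (x0 i) b = \sum_(j < N) w j * b ^+ (q ^ j).
  by have [] := hP (x0 i) (ltn_ord _).
have : \sum_x s (d x) * \prod_i P (x0 i) e`_(x i) = 0.
  transitivity (\sum_(m : {ffun I -> 'I_N}) (\prod_i w i (m i)) *
      \sum_x s (d x) * \prod_i e`_(x i) ^+ (q ^ m i)); last first.
    by rewrite big1 // => m _; rewrite (d0 (fun i => m i)) mulr0.
  under [RHS]eq_bigr do rewrite big_distrr.
  rewrite [RHS]exchange_big; apply: eq_bigr => x _ /=.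
  under eq_bigr do rewrite hw.
  rewrite bigA_distr_bigA big_distrr; apply: eq_bigr => m _ /=.
  by rewrite big_split mulrCA.
rewrite (bigD1 x0) //= [X in _ + X]big1 ?addr0 => [|x /eqP nx].
  move=> e0; case: Bdom => _ Bint; have [/(alg_str_neq0 dx0)//|] := Bint _ _ e0.
  move=> /(domain_prod_eq0 Bdom)[i].
  by have [_] := hP (x0 i) (ltn_ord _).
have [->|dx] := eqVneq (d x) 0; first by rewrite rmorph0 mul0r.
have [i lti|le] := pickP (fun i => x0 i < x i)%N.
  have [_ _ Pij] := hP (x0 i) (ltn_ord _).
  by rewrite (bigD1 i) //= Pij ?mul0r ?mulr0 // lti ltn_ord.
case: nx; apply/ffunP => i; apply/val_inj/eqP; rewrite eqn_leq.
have lei j : (x j <= x0 j)%N by rewrite leqNgt le.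
rewrite lei /= leqNgt; apply/negP => lti.
have := x0min x dx; rewrite leqNgt => /negP; apply.
rewrite (bigD1 i) //= [X in (_ < X)%N](bigD1 i) //= -addSn.
by apply: leq_add => //; apply: leq_sum => j _; apply: lei.
Qed.

Variable gT : finGroupType.
Hypothesis card_gT : #|gT| = q.

(* An invariant tensor is a combination of orbit sums of monomials in a basis;
   on the diagonal, an orbit that is not reduced to a constant monomial
   contributes a multiple of p, hence 0. *)
Lemma invariant_is_frob K (b : 'I_K -> gT -> B) :
  (forall (g : gT) (m : gT -> nat),
     \sum_k \prod_i b k i ^+ (q ^ m (g * i)%g) =
     \sum_k \prod_i b k i ^+ (q ^ m i)) ->
  exists c, \sum_k \prod_i b k i = c ^+ q.
Proof.
move=> binv.
have [e [efree le]] := exists_free_seq [seq b p.1 p.2 | p : 'I_K * gT].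
have /choice[beta hbeta] (p : 'I_K * gT) : exists c : nat -> F,
    b p.1 p.2 = \sum_(y < size e) s (c y) * e`_y.
  by apply: Fspan_coef; apply: le; apply: (codom_f (fun p => b p.1 p.2)).
pose c (x : {ffun gT -> 'I_(size e)}) := \sum_k \prod_i beta (k, i) (x i).
have expand (m : gT -> nat) : \sum_k \prod_i b k i ^+ (q ^ m i) =
    \sum_x s (c x) * \prod_i e`_(x i) ^+ (q ^ m i).
  transitivity (\sum_k \sum_(x : {ffun gT -> 'I_(size e)})
      s (\prod_i beta (k, i) (x i)) * \prod_i e`_(x i) ^+ (q ^ m i)).
    apply: eq_bigr => k _.
    under eq_bigr => i _.
      rewrite (hbeta (k, i)) frobX_sum.
      under eq_bigr do rewrite exprMn frobX_str.
      over.
    rewrite bigA_distr_bigA; apply: eq_bigr => x _ /=.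
    by rewrite big_split rmorph_prod.
  rewrite exchange_big; apply: eq_bigr => x _ /=.
  by rewrite -big_distrl rmorph_sum.
(* Independence turns an equality of functions of [m] into an equality of coefficients; this is why
   [binv] is required for all [m]. *)
have cinv g x : c (trans_action gT _ x g) = c x.
  apply/eqP; rewrite -subr_eq0; apply/eqP; move: x.
  apply: (frob_pow_indep efree) => m.
  under eq_bigr do rewrite rmorphB mulrBl.
  rewrite sumrB; apply/eqP; rewrite subr_eq0; apply/eqP.
  rewrite -(expand m) -(binv g m) (expand (fun i => m (g * i)%g)).
  rewrite [RHS](reindex_inj (act_inj (trans_action gT 'I_(size e)) g)) /=.
  apply: eq_bigr => x _; congr (_ * _).
  rewrite [RHS](reindex_inj (mulgI (g^-1)%g)) /=.
  by apply: eq_bigr => i _; rewrite ffunE mulKVg.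
have [p pr_p pF] := finPcharP F.
have [n qp] : exists n, #|F| = (p ^ n)%N.
  by eexists; apply: (card_pprimeChar pF).
have pB (v : B) : v *+ p = 0.
  by rewrite -mulr_natr -(rmorph_nat s) (pcharf0 pF) rmorph0 mulr0.
(* Only the constant families survive, with monomials e_y^q; the scalars are their own q-th powers,
   hence this root. *)
exists (\sum_(y < size e) s (c [ffun=> y]) * e`_y).
have := expand (fun _ => 0%N); rewrite expn0 => ->.
rewrite (@sum_pgroup_fix gT _ (trans_action gT _) _ p) //; first last.
- move=> g x; rewrite cinv; congr (_ * _).
  rewrite [RHS](reindex_inj (mulgI g)) /=.
  by apply: eq_bigr => i _; rewrite ffunE.
- by rewrite /pgroup cardsT card_gT qp pnatX pnat_id.
rewrite -[X in _ ^+ X]expn1 frobX_sum.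
rewrite (reindex_onto (fun y : 'I_(size e) => [ffun=> y] : {ffun gT -> 'I_(size e)})
   (fun x => x 1%g)) /=; last first.
  move=> x /afixP xfix; apply/ffunP => i; rewrite ffunE.
  by have := xfix i (finset.in_setT _) => /ffunP/(_ 1%g); rewrite ffunE mulg1.
apply: eq_big => [y|y _].
  rewrite ffunE eqxx andbT; apply/afixP => g _.
  by apply/ffunP => i; rewrite !ffunE.
under eq_bigr do rewrite ffunE expr1.
by rewrite prodr_const card_gT exprMn frobX_str expn1.
Qed.

End Invariant.

(* The subring of the functions (gT -> nat) -> B generated by the functions
   m |-> b ^ (q ^ m i); an element is represented by the list of the products
   in a sum of products.  It is used in place of the tensor power of B over F
   indexed by gT. *)
Section TensorPower.
Variables (F : finFieldType) (B : alg F) (gT : finGroupType).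
Local Notation q := #|F|.
Local Notation s := (alg_str B).
Local Notation rank i := (nat_of_ord (enum_rank (i : gT))).

(** The factors of a product are indexed by [nat] through [enum_rank], since functions on [gT] would
    leave [Set]. At m = 0 the value is the image under multiplication. *)
Definition tp_ev (t : seq (nat -> B)) (m : gT -> nat) : B :=
  \sum_(b <- t) \prod_i b (rank i) ^+ (q ^ m i).

Definition tp_single (i : gT) (b : B) : seq (nat -> B) :=
  [:: fun j => if j == rank i then b else 1].

Lemma tp_ev_single i b m : tp_ev (tp_single i b) m = b ^+ (q ^ m i).
Proof.
rewrite /tp_ev big_seq1 (bigD1 i) //= eqxx big1 ?mulr1 // => j /negPf ji.
by rewrite [_ == rank i](inj_eq (inj_comp val_inj enum_rank_inj)) ji expr1n.
Qed.

Definition tp_mul (t u : seq (nat -> B)) : seq (nat -> B) :=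
  [seq (fun j => b j * c j) | b <- t, c <- u].
(** The number q is 0 in [B], so q - 1 copies of a sum are its negative. *)
Definition tp_opp (t : seq (nat -> B)) := flatten (nseq q.-1 t).

Lemma tp_evD t u m : tp_ev (t ++ u) m = tp_ev t m + tp_ev u m.
Proof. by rewrite /tp_ev big_cat. Qed.

Lemma tp_evM t u m : tp_ev (tp_mul t u) m = tp_ev t m * tp_ev u m.
Proof.
rewrite /tp_ev big_allpairs_dep big_distrl; apply: eq_bigr => b _ /=.
rewrite big_distrr; apply: eq_bigr => c _ /=.
by rewrite -big_split; apply: eq_bigr => i _; rewrite exprMn.
Qed.

Lemma tp_evN t m : tp_ev (tp_opp t) m = - tp_ev t m.
Proof.
have -> : tp_ev (tp_opp t) m = tp_ev t m *+ q.-1.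
  rewrite /tp_opp; elim: q.-1 => [|n IHn]; first by rewrite /tp_ev big_nil.
  by rewrite /= tp_evD IHn mulrS.
apply/eqP; rewrite -addr_eq0 -mulrSr prednK ?(ltnW (card_finNzRing_gt1 F)) //.
rewrite -mulr_natr -(rmorph_nat s); have [p pr_p pF] := finPcharP F.
have [n qp] : exists n, q = (p ^ n)%N.
  by eexists; apply: (card_pprimeChar pF).
have n0 : (0 < n)%N.
  by case: n qp => // q1; have := card_finNzRing_gt1 F; rewrite q1.
by rewrite qp natrX (pcharf0 pF) expr0n -(prednK n0) rmorph0 mulr0.
Qed.

Lemma tp_ev0 m : tp_ev [::] m = 0.
Proof. by rewrite /tp_ev big_nil. Qed.

Lemma tp_ev1 m : tp_ev (tp_single 1%g 1) m = 1.
Proof. by rewrite tp_ev_single expr1n. Qed.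

Definition tp_evE := (tp_ev0, tp_ev1, tp_evD, tp_evN, tp_evM).

Program Definition tp_setoid : setoidRing :=
  @SetoidRing (seq (nat -> B)) (fun t u => forall m, tp_ev t m = tp_ev u m)
    [::] (tp_single 1%g 1) tp_opp cat tp_mul
    _ _ _ _ _ _ _ _ _ _ _ _ _ _.
Next Obligation. by []. Qed.
Next Obligation. by move=> t u e m. Qed.
Next Obligation. by move=> t u v e e' m; rewrite e. Qed.
Next Obligation. by move=> t u e m; rewrite !tp_evE e. Qed.
Next Obligation. by move=> t t' u u' e e' m; rewrite !tp_evE e e'. Qed.
Next Obligation. by move=> t t' u u' e e' m; rewrite !tp_evE e e'. Qed.
Next Obligation. by move=> t u v m; rewrite !tp_evE addrA. Qed.
Next Obligation. by move=> t u m; rewrite !tp_evE addrC. Qed.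
Next Obligation. by move=> t m; rewrite !tp_evE add0r. Qed.
Next Obligation. by move=> t m; rewrite !tp_evE addNr. Qed.
Next Obligation. by move=> t u v m; rewrite !tp_evE mulrA. Qed.
Next Obligation. by move=> t u m; rewrite !tp_evE mulrC. Qed.
Next Obligation. by move=> t m; rewrite !tp_evE mul1r. Qed.
Next Obligation. by move=> t u v m; rewrite !tp_evE mulrDl. Qed.

Local Notation pi := (squot_pi (S := tp_setoid)).

Let ein (i : gT) (b : B) : squot tp_setoid := pi (tp_single i b).

Fact tp_in1 i : ein i 1 = 1.
Proof. by apply/squot_piP => m; rewrite !tp_ev_single !expr1n. Qed.
Fact tp_inD i x y : ein i (x + y) = ein i x + ein i y.
Proof.
rewrite -squot_piD; apply/squot_piP => m.
by rewrite !tp_evE !tp_ev_single frobXD.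
Qed.
Fact tp_inM i x y : ein i (x * y) = ein i x * ein i y.
Proof.
rewrite -squot_piM; apply/squot_piP => m /=.
by rewrite !tp_evE !tp_ev_single exprMn.
Qed.

Definition tp_in_hom i := mk_rmorphism (tp_in1 i) (tp_inD i) (tp_inM i).

Definition tpower : alg F := @Alg F (squot tp_setoid) (tp_in_hom 1%g \o s).

Fact tp_in_str i c : tp_in_hom i (s c) = alg_str tpower c.
Proof. by apply/squot_piP => m; rewrite !tp_ev_single !frobX_str. Qed.

Definition tp_in i : algHom B tpower := @AlgHom F B tpower (tp_in_hom i) (tp_in_str i).

(* The multiplication map b_1 (x) ... (x) b_q |-> b_1 * ... * b_q *)
Fact tp_diag_eq (t u : tp_setoid) :
  setoid_rel t u -> tp_ev t (fun _ => 0%N) = tp_ev u (fun _ => 0%N).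
Proof. exact. Qed.
Definition tp_diag_hom : {rmorphism tpower -> B} :=
  squot_lift (S := tp_setoid) (f := fun t => tp_ev t (fun _ => 0%N))
    tp_diag_eq (tp_ev1 _) (fun t u => tp_evD t u _) (fun t u => tp_evM t u _).

Lemma tp_diag_homE t : tp_diag_hom (pi t) = tp_ev t (fun=> 0%N).
Proof. by rewrite /tp_diag_hom mk_rmorphismE squot_liftE //; apply: tp_diag_eq. Qed.

Fact tp_diag_str c : tp_diag_hom (alg_str tpower c) = s c.
Proof. by rewrite [LHS]tp_diag_homE tp_ev_single expn0 expr1. Qed.

Definition tp_diag : algHom tpower B :=
  @AlgHom F tpower B tp_diag_hom tp_diag_str.

Lemma tp_diag_in i : algHom_comp tp_diag (tp_in i) = algHom_id B.
Proof.
by apply: algHomP => b; rewrite [LHS]tp_diag_homE tp_ev_single expn0 expr1.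
Qed.

Let shift (g : gT) (t : seq (nat -> B)) : seq (nat -> B) :=
  [seq (fun j => b (rank (g^-1 * nth 1 (enum gT) j)%g)) | b <- t].

Lemma tp_ev_shift g t m : tp_ev (shift g t) m = tp_ev t (fun i => m (g * i)%g).
Proof.
rewrite /tp_ev big_map; apply: eq_bigr => b _.
rewrite (reindex_inj (mulgI g)) /=; apply: eq_bigr => i _.
by rewrite nth_enum_rank mulKg.
Qed.

Fact tp_shift_eq g (t u : tp_setoid) : setoid_rel t u -> pi (shift g t) = pi (shift g u).
Proof. by move=> e; apply/squot_piP => m; rewrite !tp_ev_shift. Qed.
Fact tp_shift1 g : pi (shift g (setoid1 tp_setoid)) = 1.
Proof. by apply/squot_piP => m; rewrite tp_ev_shift !tp_ev1. Qed.
Fact tp_shiftD g (t u : tp_setoid) :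
  pi (shift g (setoidD t u)) = pi (shift g t) + pi (shift g u).
Proof. by rewrite -squot_piD; apply/squot_piP => m; rewrite /= !(tp_ev_shift, tp_evE). Qed.
Fact tp_shiftM g (t u : tp_setoid) :
  pi (shift g (setoidM t u)) = pi (shift g t) * pi (shift g u).
Proof. by rewrite -squot_piM; apply/squot_piP => m; rewrite /= !(tp_ev_shift, tp_evE). Qed.

Definition tp_act_hom g : {rmorphism tpower -> tpower} :=
  squot_lift (tp_shift_eq g) (tp_shift1 g) (tp_shiftD g) (tp_shiftM g).

Lemma tp_act_homE g t : tp_act_hom g (pi t) = pi (shift g t).
Proof. by rewrite /tp_act_hom mk_rmorphismE squot_liftE //; apply: tp_shift_eq. Qed.

Fact tp_act_str g c : tp_act_hom g (alg_str tpower c) = alg_str tpower c.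
Proof.
by rewrite [LHS]tp_act_homE; apply/squot_piP => m; rewrite tp_ev_shift !tp_ev_single !frobX_str.
Qed.

Definition tp_act g : algHom tpower tpower := 
  @AlgHom F tpower tpower (tp_act_hom g) (tp_act_str g).

Lemma tp_act_in g i : algHom_comp (tp_act g) (tp_in i) = tp_in (g * i)%g.
Proof.
apply: algHomP => b; rewrite [LHS]tp_act_homE.
by apply/squot_piP => m; rewrite tp_ev_shift !tp_ev_single.
Qed.

Lemma tp_act1 t : tp_act 1%g t = t.
Proof.
have [u ->] := squot_surj t; rewrite [LHS]tp_act_homE; apply/squot_piP => m.
by rewrite tp_ev_shift; congr tp_ev; apply/funext => i; rewrite mul1g.
Qed.

Lemma tp_actM g h t : tp_act g (tp_act h t) = tp_act (g * h)%g t.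
Proof.
have [u ->] := squot_surj t; rewrite [tp_act h _]tp_act_homE [LHS]tp_act_homE.
rewrite [RHS]tp_act_homE; apply/squot_piP => m; rewrite !tp_ev_shift.
by congr tp_ev; apply/funext => i; rewrite mulgA.
Qed.

Lemma tp_diag_act g : algHom_comp tp_diag (tp_act g) = tp_diag.
Proof.
apply: algHomP => t; have [u ->] := squot_surj t.
rewrite algHom_compE [tp_act g _]tp_act_homE.
by rewrite [LHS]tp_diag_homE [RHS]tp_diag_homE tp_ev_shift.
Qed.

Lemma tp_invariant_diag (t : tpower) : is_domain B -> #|gT| = q ->
  (forall g, tp_act g t = t) -> exists c, tp_diag t = c ^+ q.
Proof.
have [u ->] := squot_surj t => Bdom cardgT uinv.
have evE m : tp_ev u m =
    \sum_(k < size u) \prod_i nth (fun=> 0) u k (rank i) ^+ (q ^ m i).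
  by rewrite /tp_ev (big_nth (fun=> 0)) big_mkord.
have [|c hc] := @invariant_is_frob F B Bdom gT cardgT (size u)
    (fun k i => nth (fun=> 0) u k (rank i)).
  move=> g m; rewrite -(evE (fun i => m (g * i)%g)) -evE -tp_ev_shift.
  have /squot_piP : pi (shift g u) = pi u.
    by rewrite -tp_act_homE; apply: uinv.
  by apply.
exists c; rewrite -hc [LHS]tp_diag_homE evE.
by apply: eq_bigr => k _; apply: eq_bigr => i _; rewrite expn0 expr1.
Qed.

End TensorPower.

(** The exponent #|F| alone expresses that Frobenius is injective; iteration covers all nilpotent
    elements. *)
Definition reduced (F : finFieldType) (R : alg F) :=
  forall x : R, x ^+ #|F| = 0 -> x = 0.

(** * Linear forms and tensor products of reduced algebras *)

Section LinearForm.
Variables (F : finFieldType) (B : alg F).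
Local Notation s := (alg_str B).

Definition subspace (M : set B) :=
  [/\ M 0, forall x y, M x -> M y -> M (x + y) & forall c x, M x -> M (s c * x)].

Lemma subspace_Fspan (e : seq B) : subspace (Fspan e).
Proof.
elim: e => [|y e [M0 MD MZ]]; split.
- by [].
- by move=> x y /= -> ->; rewrite addr0.
- by move=> c x /= ->; rewrite mulr0.
- by exists 0; rewrite rmorph0 mul0r subr0.
- move=> x z [c /MD Mx] [d /Mx Mz]; exists (c + d).
  by have -> : x + z - s (c + d) * y = x - s c * y + (z - s d * y) by rewrite rmorphD; ring.
- move=> c x [d Mx]; exists (c * d); have := MZ c _ Mx.
  by have -> : s c * (x - s d * y) = s c * x - s (c * d) * y by rewrite rmorphM; ring.
Qed.

(** A subspace maximal among those that contain [e] and avoid [x] is a complement of the line F x;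
    [lam] is the coordinate along [x]. *)
Lemma exists_linear_form (e : seq B) (x : B) : ~ Fspan e x ->
  exists lam : B -> F, [/\ forall y z, lam (y + z) = lam y + lam z,
    forall c y, lam (s c * y) = c * lam y, lam x = 1 & forall i, (i < size e)%N -> lam e`_i = 0].
Proof.
move=> nex.
pose P (M : set B) := [/\ subspace M, ~ M x & (Fspan e `<=` M)%classic].
have [||M [[[M0 MD MZ] nM eM] Mmax]] := @Zorn_above B P (Fspan e).
- by split=> //; apply: subspace_Fspan.
- move=> C [A CA] CP totC; split.
  + have [[A0 _ _] _ _] := CP _ CA; split; first by exists A.
      move=> y z [M CM My] [M' CM' Mz].
      have [MM|MM] := totC _ _ CM CM'.
        by exists M' => //; have [[_ D _] _ _] := CP _ CM'; apply: D => //; apply: MM.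
      by exists M => //; have [[_ D _] _ _] := CP _ CM; apply: D => //; apply: MM.
    move=> c y [M CM My]; exists M => //.
    by have [[_ _ Z] _ _] := CP _ CM; apply: Z.
  + by move=> [M /CP[]].
  + by move=> y ey; exists A => //; have [_ _] := CP _ CA; apply.
have MN y : M y -> M (- y) by move=> /(MZ (-1)); rewrite rmorphN1 mulN1r.
have MB y z : M y -> M z -> M (y - z) by move=> My /MN; apply: MD.
have /choice[lam hlam] y : exists c, M (y - s c * x).
  have [My|nMy] := pselect (M y); first by exists 0; rewrite rmorph0 mul0r subr0.
  pose N : set B := fun z => exists c, M (z - s c * y).
  have subN : subspace N.
    split; first by exists 0; rewrite rmorph0 mul0r subr0.
      move=> z t [c Mz] [d Mt]; exists (c + d); have := MD _ _ Mz Mt.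
      by have -> : z - s c * y + (t - s d * y) = z + t - s (c + d) * y by rewrite rmorphD; ring.
    move=> c z [d Mz]; exists (c * d); have := MZ c _ Mz.
    by have -> : s c * (z - s d * y) = s c * z - s (c * d) * y by rewrite rmorphM; ring.
  have MN' : (M `<=` N)%classic by move=> z Mz; exists 0; rewrite rmorph0 mul0r subr0.
  have [[c Mx]|nN] := pselect (N x); last first.
    case: nMy; rewrite -(Mmax N) //; first by exists 1; rewrite rmorph1 mul1r subrr.
    by split=> // z /eM /MN'.
  have [c0|c0] := eqVneq c 0.
    by case: nM; rewrite c0 rmorph0 mul0r subr0 in Mx.
  exists c^-1; have := MZ (- c^-1) _ Mx.
  have -> : s (- c^-1) * (x - s c * y) = s (c^-1 * c) * y - s c^-1 * x.
    by rewrite rmorphN rmorphM; ring.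
  by rewrite mulVf // rmorph1 mul1r.
have lam_uniq y c : M (y - s c * x) -> lam y = c.
  move=> Mc; apply/eqP; rewrite -subr_eq0; apply/eqP; apply: contrapT => /eqP d0.
  have Md : M (s (lam y - c) * x).
    have := MB _ _ Mc (hlam y).
    by have -> : y - s c * x - (y - s (lam y) * x) = s (lam y - c) * x by rewrite rmorphB; ring.
  by apply: nM; have := MZ (lam y - c)^-1 _ Md; rewrite mulrA -rmorphM mulVf // rmorph1 mul1r.
exists lam; split.
- move=> y z; apply: lam_uniq; have := MD _ _ (hlam y) (hlam z).
  by have -> : y - s (lam y) * x + (z - s (lam z) * x) = y + z - s (lam y + lam z) * x
    by rewrite rmorphD; ring.
- move=> c y; apply: lam_uniq; have := MZ c _ (hlam y).
  by have -> : s c * (y - s (lam y) * x) = s c * y - s (c * lam y) * x by rewrite rmorphM; ring.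
- by apply: lam_uniq; rewrite rmorph1 mul1r subrr.
- by move=> i ie; apply: lam_uniq; rewrite rmorph0 mul0r subr0; apply/eM/Fspan_nth.
Qed.

Hypothesis Bred : reduced B.

Lemma Fspan_frob (e : seq B) x : Fspan (map (frob B) e) (frob B x) -> Fspan e x.
Proof.
elim: e x => [|y e IHe] x /=; first exact: Bred.
move=> [c hc]; exists c; apply: IHe.
by rewrite rmorphB rmorphM /= (algHom_str (frob B)).
Qed.

(** Frobenius is F-linear, because c ^ #|F| = c for scalars, and it is injective on a reduced
    algebra. *)
Lemma free_seq_frob (e : seq B) : free_seq e -> free_seq (map (frob B) e).
Proof. by elim: e => //= x e IHe [nx /IHe]; split=> // /Fspan_frob. Qed.

End LinearForm.

Section TensorAlg.
Variables (F : finFieldType) (B B' : alg F).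

Definition str_central (R : alg F) : central_hom F R :=
  CentralHom (fun r (a : R) => mulrC (alg_str R r) a).

Local Notation cls := (@tens_cls F B B' (str_central B) (str_central B')).
Local Notation ten := (tens (str_central B) (str_central B')).

Definition ta_mul (t u : seq (B * B')) : seq (B * B') :=
  [seq (p.1 * r.1, p.2 * r.2) | p <- t, r <- u].

Lemma ta_clsD t u : cls (t ++ u) = cls t + cls u.
Proof. by rewrite [RHS]tens_addE. Qed.
Lemma ta_clsN t : cls (tens_neg t) = - cls t.
Proof.
apply/eqP; rewrite -addr_eq0 -ta_clsD; apply/eqP/tens_clsP/tens_negK.
Qed.
Lemma ta_clsM t u : cls (ta_mul t u) = cls t * cls u.
Proof. by rewrite [RHS]tens_mulE tens_cls_sum big_allpairs_dep. Qed.

Lemma ta_mulC (x y : tensor (str_central B) (str_central B')) : x * y = y * x.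
Proof.
elim/tens_ind: x => [|x x' ex ex'|a b]; first by rewrite mul0r mulr0.
  by rewrite mulrDl mulrDr ex ex'.
elim/tens_ind: y => [|y y' ey ey'|a' b']; first by rewrite mul0r mulr0.
  by rewrite mulrDl mulrDr ey ey'.
by rewrite !tensM [a * _]mulrC [b * _]mulrC.
Qed.

(** This is [tensor] again, carried by formal sums so that the result is a small ring. *)
Program Definition ta_setoid : setoidRing :=
  @SetoidRing (seq (B * B')) (fun t u => cls t = cls u)
    [::] [:: (1, 1)] (@tens_neg B B') cat ta_mul
    _ _ _ _ _ _ _ _ _ _ _ _ _ _.
Next Obligation. by []. Qed.
Next Obligation. by []. Qed.
Next Obligation. by move=> t u v e e1; exact: etrans e e1. Qed.
Next Obligation. by move=> t u e /=; rewrite !ta_clsN e. Qed.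
Next Obligation. by move=> t t' u u' e e' /=; rewrite !ta_clsD e e'. Qed.
Next Obligation. by move=> t t' u u' e e' /=; rewrite !ta_clsM e e'. Qed.
Next Obligation. by move=> t u v /=; rewrite !ta_clsD addrA. Qed.
Next Obligation. by move=> t u /=; rewrite !ta_clsD addrC. Qed.
Next Obligation. by []. Qed.
Next Obligation. by move=> t /=; rewrite ta_clsD ta_clsN addNr. Qed.
Next Obligation. by move=> t u v /=; rewrite !ta_clsM mulrA. Qed.
Next Obligation. by move=> t u /=; rewrite !ta_clsM ta_mulC. Qed.
Next Obligation. by move=> t /=; rewrite ta_clsM mul1r. Qed.
Next Obligation. by move=> t u v /=; rewrite ta_clsM !ta_clsD !ta_clsM mulrDl. Qed.

Local Notation pi := (squot_pi (S := ta_setoid)).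
Let pure b b' : squot ta_setoid := pi [:: (b, b')].

Let pureDl a a' b : pure (a + a') b = pure a b + pure a' b.
Proof. by rewrite -squot_piD; apply/squot_piP; apply/tens_clsP; apply: tens_Dl. Qed.
Let pureDr a b b' : pure a (b + b') = pure a b + pure a b'.
Proof. by rewrite -squot_piD; apply/squot_piP; apply/tens_clsP; apply: tens_Dr. Qed.
Let pureM a b a' b' : pure a b * pure a' b' = pure (a * a') (b * b').
Proof. by rewrite -squot_piM; apply/squot_piP. Qed.
Let pure_bal a c b : pure (alg_str B c * a) b = pure a (alg_str B' c * b).
Proof.
rewrite mulrC; apply/squot_piP.
exact: (tens_balanced (str_central B) (str_central B')).
Qed.

Fact ta_in1M x y : pure (x * y) 1 = pure x 1 * pure y 1.
Proof. by rewrite pureM mulr1. Qed.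
Fact ta_in2M x y : pure 1 (x * y) = pure 1 x * pure 1 y.
Proof. by rewrite pureM mulr1. Qed.

Definition ta_in1_hom : {rmorphism B -> squot ta_setoid} :=
  mk_rmorphism (f := fun x => pure x 1) (erefl _) (fun x y => pureDl x y 1) ta_in1M.
Definition ta_in2_hom : {rmorphism B' -> squot ta_setoid} :=
  mk_rmorphism (f := fun x => pure 1 x) (erefl _) (fun x y => pureDr 1 x y) ta_in2M.

Definition tensor_alg : alg F := @Alg F (squot ta_setoid) (ta_in1_hom \o alg_str B).

Definition ta_in1 : algHom B tensor_alg :=
  @AlgHom F B tensor_alg ta_in1_hom (fun c => erefl _).
Fact ta_in2_str c : ta_in2_hom (alg_str B' c) = alg_str tensor_alg c.
Proof.
have := pure_bal 1 c 1; rewrite !mulr1 => e; exact: esym e.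
Qed.
Definition ta_in2 : algHom B' tensor_alg :=
  @AlgHom F B' tensor_alg ta_in2_hom ta_in2_str.

Let pi_cons p t :
  pi (p :: t) = ta_in1 p.1 * ta_in2 p.2 + pi t :> tensor_alg.
Proof.
have e : ta_in1 p.1 * ta_in2 p.2 = pure p.1 p.2.
  by rewrite [LHS]pureM mulr1 mul1r.
by rewrite e; case: p {e} => a b; exact: (squot_piD (S := ta_setoid) [:: (a, b)] t).
Qed.

Lemma ta_sum (x : tensor_alg) :
  exists t : seq (B * B'), x = \sum_(p <- t) ta_in1 p.1 * ta_in2 p.2.
Proof.
have [t ->] := squot_surj x; exists t; elim: t => [|p t IHt].
  by rewrite big_nil.
by rewrite big_cons -IHt pi_cons.
Qed.

Section Lift.
Variables (R : alg F) (h : algHom B R) (h' : algHom B' R).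
Let ta_f (t : seq (B * B')) : R := \sum_(p <- t) h p.1 * h' p.2.

Fact ta_lift_eq (t u : ta_setoid) : setoid_rel t u -> ta_f t = ta_f u.
Proof.
apply: (@tens_lift F B B' (str_central B) (str_central B') R (fun b b' => h b * h' b')).
- by move=> a a' b; rewrite rmorphD mulrDl.
- by move=> a b b'; rewrite rmorphD mulrDr.
- by move=> a r b; rewrite !rmorphM /= !algHom_str mulrA.
Qed.
Fact ta_lift1 : ta_f (setoid1 ta_setoid) = 1.
Proof. by rewrite /ta_f big_seq1 !rmorph1 mulr1. Qed.
Fact ta_liftD (t u : ta_setoid) : ta_f (setoidD t u) = ta_f t + ta_f u.
Proof. by rewrite /ta_f big_cat. Qed.
Fact ta_liftM (t u : ta_setoid) : ta_f (setoidM t u) = ta_f t * ta_f u.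
Proof.
rewrite /ta_f big_allpairs_dep big_distrl; apply: eq_bigr => p _ /=.
rewrite big_distrr; apply: eq_bigr => r _ /=.
by rewrite !rmorphM; ring.
Qed.

Definition ta_lift_hom : {rmorphism tensor_alg -> R} :=
  squot_lift ta_lift_eq ta_lift1 ta_liftD ta_liftM.

Lemma ta_lift_homE t : ta_lift_hom (pi t) = ta_f t.
Proof. by rewrite /ta_lift_hom mk_rmorphismE squot_liftE //; apply: ta_lift_eq. Qed.

Fact ta_lift_str c : ta_lift_hom (alg_str tensor_alg c) = alg_str R c.
Proof. by rewrite [LHS]ta_lift_homE /ta_f big_seq1 /= rmorph1 mulr1 algHom_str. Qed.

Lemma ta_lift : exists g : algHom tensor_alg R,
  algHom_comp g ta_in1 = h /\ algHom_comp g ta_in2 = h'.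
Proof.
exists (@AlgHom F tensor_alg R ta_lift_hom ta_lift_str).
split; apply: algHomP => b; rewrite [LHS]ta_lift_homE /ta_f big_seq1 rmorph1.
  by rewrite mulr1.
by rewrite mul1r.
Qed.

End Lift.

(** A linear form that is 1 on the head of [e] and 0 on the rest, applied to the second factor,
    isolates the first coefficient. *)
Lemma ta_free (e : seq B') (b : nat -> B) : free_seq e ->
  \sum_(i < size e) ta_in1 (b i) * ta_in2 e`_i = 0 ->
  forall i, (i < size e)%N -> b i = 0.
Proof.
elim: e b => // x e IHe b [nx efree] sum0.
have b0 : b 0%N = 0.
  have [lam [lamD lamZ lamx lame]] := exists_linear_form nx.
  have : cls [seq (b i, (x :: e)`_i) | i <- iota 0 (size (x :: e))] = cls [::].
    suff /squot_piP : pi [seq (b i, (x :: e)`_i) | i <- iota 0 (size (x :: e))] = pi [::] by [].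
    rewrite -[RHS]sum0 -(big_mkord predT (fun i => ta_in1 (b i) * ta_in2 (x :: e)`_i)).
    rewrite /index_iota subn0; elim: (iota _ _) => [|i l IHl]; first by rewrite big_nil.
    by rewrite big_cons -IHl [LHS]pi_cons.
  move/(@tens_lift F B B' (str_central B) (str_central B') B
    (fun b b' => b * alg_str B (lam b'))).
  rewrite big_nil big_map /= big_cons lamx rmorph1 mulr1 big_seq big1 ?addr0.
    apply=> [a a' c|a c c'|a r c] /=.
    - by rewrite mulrDl.
    - by rewrite lamD rmorphD mulrDr.
    - by rewrite lamZ rmorphM mulrA.
  move=> i; rewrite mem_iota => /andP[]; case: i => // i _ /=; rewrite add1n ltnS => ie.
  by rewrite lame // rmorph0 mulr0.
move=> [|i] //; apply: (IHe (fun i => b i.+1)) => //.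
by move: sum0; rewrite big_ord_recl [b _]b0 rmorph0 mul0r add0r.
Qed.

(** Writing an element as the sum of the tensors of b_i and e_i with free e_i, its Frobenius is the
    sum of the tensors of b_i^q and e_i^q. The e_i^q are free as well, so all b_i^q vanish. *)
Lemma tensor_reduced : reduced B -> reduced B' -> reduced tensor_alg.
Proof.
move=> Bred Bred' x; have [t ->] := ta_sum x.
have [e [efree le]] := exists_free_seq [seq p.2 | p <- t].
have [b eb] : exists b : nat -> B, \sum_(p <- t) ta_in1 p.1 * ta_in2 p.2 =
    \sum_(i < size e) ta_in1 (b i) * ta_in2 e`_i.
  elim: t le => [|p t IHt] le.
    by exists (fun _ => 0); rewrite big_nil big1 // => i _; rewrite rmorph0 mul0r.
  have [|b hb] := IHt; first by move=> y yt; apply: le; rewrite inE yt orbT.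
  have [|c hc] := @Fspan_coef F B' e p.2; first by apply: le; rewrite inE eqxx.
  exists (fun i => p.1 * alg_str B (c i) + b i); rewrite big_cons hb.
  under [RHS]eq_bigr do rewrite rmorphD mulrDl.
  rewrite big_split; congr (_ + _).
  rewrite {1}hc rmorph_sum big_distrr; apply: eq_bigr => i _.
  rewrite !rmorphM (algHom_str ta_in1) (algHom_str ta_in2); exact: mulrA.
rewrite eb -[X in X = 0]/(frob tensor_alg _) rmorph_sum => sum0.
rewrite big1 // => i _.
suff -> : b i = 0 by rewrite rmorph0 mul0r.
apply: Bred.
have efree' := free_seq_frob Bred' efree.
apply: (ta_free (b := fun i => b i ^+ #|F|) efree'); last by rewrite size_map.
rewrite size_map -[RHS]sum0; apply: eq_bigr => j _.
rewrite (nth_map 0) //.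
transitivity ((ta_in1 (b j) * ta_in2 e`_j) ^+ #|F|); last by [].
by rewrite exprMn -!rmorphXn.
Qed.

End TensorAlg.

(** * The Verschiebung *)

(* A copy of F whose carrier is in Set *)
Section SmallField.
Variable F : finFieldType.
Let el (x : nat) : F := (enum F)`_x.
Let code (c : F) : nat := index c (enum F).
Let elK c : el (code c) = c.
Proof. by rewrite /el nth_index ?mem_enum. Qed.

Program Definition sf_setoid : setoidRing :=
  @SetoidRing nat (fun x y => el x = el y) (code 0) (code 1)
    (fun x => code (- el x)) (fun x y => code (el x + el y))
    (fun x y => code (el x * el y)) _ _ _ _ _ _ _ _ _ _ _ _ _ _.
Next Obligation. by []. Qed.
Next Obligation. by []. Qed.
Next Obligation. by move=> x y z e e'; exact: etrans e e'. Qed.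
Next Obligation. by move=> x x' /= ->. Qed.
Next Obligation. by move=> x x' y y' /= -> ->. Qed.
Next Obligation. by move=> x x' y y' /= -> ->. Qed.
Next Obligation. by move=> x y z /=; rewrite !elK addrA. Qed.
Next Obligation. by move=> x y /=; rewrite addrC. Qed.
Next Obligation. by move=> x /=; rewrite !elK add0r. Qed.
Next Obligation. by move=> x /=; rewrite !elK addNr. Qed.
Next Obligation. by move=> x y z /=; rewrite !elK mulrA. Qed.
Next Obligation. by move=> x y /=; rewrite mulrC. Qed.
Next Obligation. by move=> x /=; rewrite !elK mul1r. Qed.
Next Obligation. by move=> x y z /=; rewrite !elK mulrDl. Qed.

Local Notation pi := (squot_pi (S := sf_setoid)).
Fact sf_inD x y : pi (code (x + y)) = pi (code x) + pi (code y).
Proof. by rewrite -squot_piD; apply/squot_piP => /=; rewrite !elK. Qed.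
Fact sf_inM x y : pi (code (x * y)) = pi (code x) * pi (code y).
Proof. by rewrite -squot_piM; apply/squot_piP => /=; rewrite !elK. Qed.
Definition sf_in : {rmorphism F -> squot sf_setoid} :=
  mk_rmorphism (f := fun c => pi (code c)) (erefl _) sf_inD sf_inM.

Definition small_field : alg F := Alg sf_in.

Fact sf_out1 : el (setoid1 sf_setoid) = 1. Proof. exact: elK. Qed.
Fact sf_outD (x y : sf_setoid) : el (setoidD x y) = el x + el y. Proof. exact: elK. Qed.
Fact sf_outM (x y : sf_setoid) : el (setoidM x y) = el x * el y. Proof. exact: elK. Qed.
Definition sf_out : {rmorphism small_field -> F} :=
  squot_lift (S := sf_setoid) (f := el) (fun x y e => e) sf_out1 sf_outD sf_outM.

Lemma sf_outE x : sf_out (pi x) = el x.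
Proof. by rewrite /sf_out mk_rmorphismE squot_liftE. Qed.

Lemma sf_outK c : sf_out (alg_str small_field c) = c.
Proof. by rewrite [LHS]sf_outE elK. Qed.

Lemma sf_inK x : alg_str small_field (sf_out x) = x.
Proof. by have [y ->] := squot_surj x; rewrite sf_outE; apply/squot_piP; rewrite /= elK. Qed.

Lemma small_field_is_field : is_field small_field.
Proof.
split=> [e|x x0]; first by have := oner_neq0 F; rewrite -(rmorph1 sf_out) e rmorph0 eqxx.
exists (alg_str small_field (sf_out x)^-1).
rewrite -{1}(sf_inK x) -rmorphM mulfV ?rmorph1 //.
by apply/eqP => e; apply: x0; rewrite -(sf_inK x) e rmorph0.
Qed.

End SmallField.

Section ChartDomain.
Variables (F : finFieldType) (X : functor F).
Hypothesis geomX : geometrically_integral X.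

(** Geometric integrality is applied to the copy of F in [Set]. The copy is isomorphic to F, so
    [down] and [up] make a chart over F into a chart over the copy. *)
Lemma chart_domain (B : alg F) (i : mor (Spec B) X) :
  open_immersion i -> (1 : B) <> 0 -> is_domain B.
Proof.
move=> [iinj iopen] B1.
pose M := small_field F; pose BM := @Alg M B (alg_str B \o sf_out F).
have toF (R : alg M) (b : algHom BM R) c : b (alg_str B c) = alg_str (alg_restr (alg_str M) R) c.
  by rewrite -{1}(sf_outK c); apply: (algHom_str b).
have toM (R : alg M) (b : algHom B (alg_restr (alg_str M) R)) c :
    b (alg_str BM c) = alg_str R c.
  by rewrite -{2}(sf_inK c); apply: (algHom_str b).
pose down (R : alg M) (b : algHom BM R) := @AlgHom F B (alg_restr (alg_str M) R) b (@toF R b).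
pose up (R : alg M) (b : algHom B (alg_restr (alg_str M) R)) := @AlgHom M BM R b (@toM R b).
have [_ /(_ BM)] := geomX (small_field_is_field F).
have iME R S (f : algHom R S) (b : Spec BM R) :
    i _ (down S (fmap f b)) = fmap (algHom_restr (alg_str M) f) (i _ (down R b)).
  by rewrite -morE; congr (i _ _); apply: algHomP.
pose iM := @Mor M (Spec BM) (base_change (alg_str M) X) (fun R b => i _ (down R b)) iME.
move=> /(_ iM); apply=> //.
split=> [R b c /iinj e|R x].
  by apply: algHomP => y; have := congr1 (fun k : algHom B _ => k y) e.
have [E hE] := iopen _ x; exists E => S f.
rewrite -[generates_unit f E]/(generates_unit (algHom_restr (alg_str M) f) E).
split=> [[b _ e]|/hE[b _ e]].
  by apply/hE; exists (down S b).
exists (up S b) => //; rewrite -[RHS]e /=; congr (i _ _); exact: algHomP.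
Qed.

End ChartDomain.

Section Reduced.
Variable F : finFieldType.
Implicit Types R S B : alg F.

Lemma domain_reduced R : is_domain R -> reduced R.
Proof. by move=> Rdom x; apply: domain_exp_eq0. Qed.

Lemma zero_ring_reduced R : (1 : R) = 0 -> reduced R.
Proof. by move=> R0 x _; rewrite -[x]mulr1 R0 mulr0. Qed.

Lemma loc_reduced R (a : R) : reduced R -> reduced (loc_alg a).
Proof.
move=> Rred x; have [[b ab] lsurj lker] := loc_localization a.
have [m [r e]] := lsurj x => xq.
have [k ek] : exists k, a ^+ k * r ^+ #|F| = 0.
  by apply: lker; rewrite rmorphXn -e exprMn xq mul0r.
have ar0 : a ^+ k * r = 0.
  apply: Rred; rewrite exprMn -exprM.
  have le : (k <= k * #|F|)%N by rewrite leq_pmulr // ltnW // card_finNzRing_gt1.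
  by rewrite -(subnK le) exprD -mulrA ek mulr0.
have unit_pow l : loc a a ^+ l * b ^+ l = 1 by rewrite -exprMn ab expr1n.
rewrite -[x]mulr1 -(unit_pow m) mulrA e -[_ * _]mulr1 -(unit_pow k).
transitivity (loc a (a ^+ k * r) * (b ^+ m * b ^+ k)).
  by rewrite rmorphM rmorphXn; ring.
by rewrite ar0 rmorph0 mul0r.
Qed.

(** Roots of exponent #|F| are unique in a reduced algebra, so choosing them yields a ring
    homomorphism. *)
Lemma frob_factor R C (psi : algHom C R) : reduced R ->
  (forall b, exists c, psi b = c ^+ #|F|) ->
  exists chi : algHom C R, psi = algHom_comp (frob R) chi.
Proof.
move=> Rred /choice[chi hchi].
have frob_inj x y : frob R x = frob R y -> x = y.
  move=> /eqP; rewrite -subr_eq0 -rmorphB => /eqP/Rred/eqP.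
  by rewrite subr_eq0 => /eqP.
have chiE x : frob R (chi x) = psi x by rewrite hchi.
have chi1 : chi 1 = 1 by apply: frob_inj; rewrite chiE !rmorph1.
have chiD x y : chi (x + y) = chi x + chi y.
  by apply: frob_inj; rewrite rmorphD !chiE rmorphD.
have chiM x y : chi (x * y) = chi x * chi y.
  by apply: frob_inj; rewrite rmorphM !chiE rmorphM.
have chi_str c : mk_rmorphism chi1 chiD chiM (alg_str C c) = alg_str R c.
  by apply: frob_inj; rewrite mk_rmorphismE chiE !algHom_str.
by exists (AlgHom chi_str); apply: algHomP => b; rewrite algHom_compE chiE.
Qed.

End Reduced.

Section FrobRange.
Variables (F : finFieldType) (A : gfunctor F).
Hypotheses (shA : zariski_sheaf A) (sepA : separated A).
Local Notation q := #|F|.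

(** By separatedness the locus y = z in Spec R is V(E); the set [E] maps to 0 in [R'], hence is 0
    already in [R]. *)
Lemma gmap_inj (R R' : alg F) (f : algHom R R') (y z : gpts A R) :
  injective f -> gmap A f y = gmap A f z -> y = z.
Proof.
move=> finj e; have [E hE] := sepA (y, z).
have E0 : forall a, E a -> a = 0.
  move=> a Ea; apply: finj; rewrite rmorph0; move: a Ea.
  exact: ((hE _ f).1 e).
have := (hE _ (algHom_id R)).2 E0.
by rewrite /= !gmap_id.
Qed.

Lemma gmap_frob_inj (R : alg F) (y z : gpts A R) : reduced R ->
  gmap A (frob R) y = gmap A (frob R) z -> y = z.
Proof.
move=> Rred; apply: gmap_inj => a b /eqP.
by rewrite -subr_eq0 -rmorphB => /eqP/Rred/eqP; rewrite subr_eq0 => /eqP.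
Qed.

Lemma gmap_frob (R S : alg F) (f : algHom R S) (y : gpts A R) :
  gmap A f (gmap A (frob R) y) = gmap A (frob S) (gmap A f y).
Proof. by have := ghomE (frobenius A) f y. Qed.

Lemma frob_range_local (R : alg F) (z : gpts A R) m (a : 'I_m -> R) :
  reduced R -> (exists b : 'I_m -> R, \sum_l b l * a l = 1) ->
  (forall l, exists v, gmap A (frob (loc_alg (a l))) v = gmap A (loc (a l)) z) ->
  exists v, gmap A (frob R) v = z.
Proof.
move=> Rred a1 /fin_all_exists[v hv].
have [||w [hw _]] := @shA R m a _ (fun l => loc (a l)) v a1.
- by move=> l; apply: loc_localization.
- move=> l l' S g h e.
  (* The test algebra [S] need not be reduced, so the comparison takes place in the localization at
     the product, through which both [g] and [h] factor. *)
  pose aa := a l * a l'.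
  have [[b ab] _ _] := loc_localization aa.
  have [|g1 eg1] := loc_lift (g := loc aa) (loc_localization (a l)).
    by exists (loc aa (a l') * b); rewrite mulrA -rmorphM.
  have [|h1 eh1] := loc_lift (g := loc aa) (loc_localization (a l')).
    by exists (loc aa (a l) * b); rewrite mulrA -rmorphM [a l' * _]mulrC.
  have [|k ek] := loc_lift (g := algHom_comp g (loc (a l))) (loc_localization aa).
    have [[c ac] _ _] := loc_localization (a l).
    have [[d ad] _ _] := loc_localization (a l').
    exists (g c * h d); rewrite [_ aa]rmorphM.
    transitivity (g (loc (a l) (a l) * c) * h (loc (a l') (a l') * d)); last first.
      by rewrite ac ad !rmorph1 mulr1.
    rewrite !rmorphM; have -> : h (loc (a l') (a l')) = g (loc (a l) (a l')).
      by have /(congr1 (fun f : algHom R S => f (a l'))) := e.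
    by rewrite algHom_compE; ring.
  have -> : g = algHom_comp k g1.
    apply: (loc_hom_ext (loc_localization (a l))); apply: algHomP => x.
    rewrite -ek; have /(congr1 (fun f : algHom R _ => f x)) := eg1.
    by rewrite !algHom_compE => ->.
  have -> : h = algHom_comp k h1.
    apply: (loc_hom_ext (loc_localization (a l'))); apply: algHomP => x.
    rewrite -e -ek; have /(congr1 (fun f : algHom R _ => f x)) := eh1.
    by rewrite !algHom_compE => ->.
  rewrite !fmap_comp; congr (fmap _ _).
  apply: gmap_frob_inj; first exact: loc_reduced.
  by rewrite -!gmap_frob !hv -!gmap_comp eg1 eh1.
exists w; apply: (sheaf_uniq shA a1) => l.
by rewrite [LHS]gmap_frob [gmap _ _ w]hw hv.
Qed.

End FrobRange.

Section ChartRange.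
Variables (F : finFieldType) (A : gfunctor F).
Hypotheses (shA : zariski_sheaf A) (sepA : separated A).
Variables (J : Type) (C : J -> alg F) (i : forall j, mor (Spec (C j)) A).
Hypothesis icov : affine_open_cover i.
Local Notation q := #|F|.

Lemma chart_inj j (R : alg F) : injective (i j R).
Proof. by have [/(_ j)[]] := icov. Qed.

Section Key.
Variables (gT : finGroupType) (B : alg F) (x : gpts A B).
Hypotheses (card_gT : #|gT| = q) (Bdom : is_domain B).
Local Notation T := (tpower B gT).

Let sx : gpts A T := \sum_g gmap A (tp_in B g) x.

Let sx_act g : gmap A (tp_act B g) sx = sx.
Proof.
rewrite raddf_sum [RHS](reindex_inj (mulgI g)); apply: eq_bigr => h _ /=.
by rewrite -gmap_comp tp_act_in.
Qed.

Let sx_diag : gmap A (tp_diag B gT) sx = x *+ q.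
Proof.
rewrite raddf_sum -card_gT -sumr_const; apply: eq_bigr => h _ /=.
by rewrite -gmap_comp tp_diag_in gmap_id.
Qed.

(* The tensors e are made invariant by taking norms; on the open subset D(a') of
   Spec T the sum sx of the conjugates of x is given by a homomorphism from a
   chart to the invariants, and the diagonal maps these to q-th powers. *)
Let local_range j (E : set T) (e : T) : E e ->
  (forall S (f : algHom T S), range (i j S) (fmap f (sx : A T)) <-> generates_unit f E) ->
  let a := tp_diag B gT e in
  exists v, gmap A (frob (loc_alg a)) v = gmap A (loc a) (x *+ q).
Proof.
move=> Ee hE a.
pose a' : T := \prod_g tp_act B g e.
have act_a' h : tp_act B h a' = a'.
  rewrite rmorph_prod [RHS](reindex_inj (mulgI h)); apply: eq_bigr => g _ /=.
  exact: tp_actM.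
have diag_a' : tp_diag B gT a' = a ^+ q.
  rewrite rmorph_prod -card_gT -prodr_const; apply: eq_bigr => g _.
  by rewrite -[LHS]algHom_compE tp_diag_act.
have [[b' ab'] surj' ker'] := loc_localization a'.
have [phi _ phiE] : range (i j _) (fmap (loc a') (sx : A T)).
  apply/hE; apply: (generates_unit_inv Ee).
  have [r er] : exists r, a' = e * r.
    exists (\prod_(g | g != 1%g) tp_act B g e).
    by rewrite /a' (bigD1 1%g) // tp_act1.
  by exists (loc a' r * b'); rewrite mulrA -rmorphM -er.
(* The chart is injective on points, so the point [phi] of the chart lying over the invariant [sx]
   is itself invariant under the action extended to the localization. *)
have phi_act g : exists act' : algHom (loc_alg a') (loc_alg a'),
    algHom_comp act' (loc a') = algHom_comp (loc a') (tp_act B g) /\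
    algHom_comp act' phi = phi.
  have [|act' eact] := loc_lift (g := algHom_comp (loc a') (tp_act B g))
      (loc_localization a').
    by exists b'; rewrite algHom_compE act_a'.
  exists act'; split=> //; apply: (@chart_inj j).
  rewrite -[algHom_comp act' phi]/(fmap act' (phi : Spec (C j) _)) morE phiE.
  by rewrite -fmap_comp eact fmap_comp [fmap (tp_act B g) _]sx_act.
(* An invariant fraction has an invariant numerator only up to powers of [a']; one power that serves
   for the whole group is absorbed into the numerator. *)
have phi_inv y : exists n t, phi y * loc a' a' ^+ n = loc a' t /\
    forall g, tp_act B g t = t.
  have [n [t et]] := surj' (phi y).
  have /choice[N hN] g : exists N, a' ^+ N * (tp_act B g t - t) = 0.
    apply: ker'; rewrite rmorphB; apply/eqP; rewrite subr_eq0; apply/eqP.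
    have [act' [e1 e2]] := phi_act g.
    have e1x z : act' (loc a' z) = loc a' (tp_act B g z).
      by have /(congr1 (fun f : algHom T _ => f z)) := e1.
    have e2x : act' (phi y) = phi y.
      by have /(congr1 (fun f : algHom (C j) _ => f y)) := e2.
    by rewrite -e1x -et rmorphM rmorphXn e2x e1x act_a'.
  pose M := (\max_g N g)%N.
  exists (n + M)%N, (a' ^+ M * t); split=> [|g].
    by rewrite exprD mulrA et rmorphM rmorphXn mulrC.
  rewrite rmorphM rmorphXn act_a'; apply/eqP; rewrite -subr_eq0 -mulrBr.
  have /subnK <- : (N g <= M)%N by apply: leq_bigmax.
  by rewrite exprD -mulrA hN mulr0.
have [[d ad] _ _] := loc_localization a.
have adn n : loc a a ^+ n * d ^+ n = 1 by rewrite -exprMn ad expr1n.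
have [|mu' emu] := loc_lift (g := algHom_comp (loc a) (tp_diag B gT))
    (loc_localization a').
  by exists (d ^+ q); rewrite algHom_compE diag_a' rmorphXn adn.
have emux z : mu' (loc a' z) = loc a (tp_diag B gT z).
  by have /(congr1 (fun f : algHom T _ => f z)) := emu.
have locred : reduced (loc_alg a) by apply/loc_reduced/domain_reduced.
have [y|chi echi] := frob_factor (psi := algHom_comp mu' phi) locred.
  have [n [t [et tinv]]] := phi_inv y.
  have [c hc] := tp_invariant_diag Bdom card_gT tinv.
  (* The diagonal sends [phi y] = t / a'^n to c^q / (a^q)^n, the q-th power of c / a^n; [d] is the
     inverse of [a]. *)
  exists (loc a c * d ^+ n); rewrite algHom_compE exprMn -rmorphXn -hc -emux -et.
  rewrite rmorphM rmorphXn emux diag_a' -mulrA -exprM rmorphXn -exprM.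
  by rewrite [(n * q)%N]mulnC adn mulr1.
exists (i j _ chi).
rewrite -[LHS](morE (i j) (frob _)) /= -echi.
rewrite -[algHom_comp mu' phi]/(fmap mu' (phi : Spec (C j) _)) morE phiE.
by rewrite -fmap_comp emu fmap_comp; exact: (congr1 (gmap A (loc a)) sx_diag).
Qed.

(** The diagonal images of the sets [E j] that describe the charts for [sx] also describe the charts
    for its restriction q x, so finitely many localizations of the kind treated in [local_range]
    cover Spec B. *)
Lemma domain_frob_range_group : exists v, gmap A (frob B) v = x *+ q.
Proof.
have /choice[E hE] j : exists E : set T, forall S (f : algHom T S),
    range (i j S) (fmap f (sx : A T)) <-> generates_unit f E.
  by have [/(_ j)[_ /(_ T sx)]] := icov.
pose E' j : set B := (tp_diag B gT @` E j)%classic.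
have [|m [a [jj [Ea a1]]]] := affine_cover (y := x *+ q : A B) (E := E') icov.
  move=> j S f; rewrite -[x *+ q]sx_diag -[gmap A _ sx]/(fmap (tp_diag B gT) (sx : A T)).
  rewrite -fmap_comp => /hE[m [e [s [Ee es]]]].
  by exists m, (fun l => tp_diag B gT (e l)), s; split=> // l; exists (e l).
apply: (frob_range_local shA sepA _ a1); first exact: domain_reduced.
move=> l; have [e Ee <-] := Ea l.
exact: (local_range Ee (hE _)).
Qed.

End Key.

Lemma domain_frob_range (B : alg F) (x : gpts A B) : is_domain B ->
  exists v, gmap A (frob B) v = x *+ q.
Proof.
apply: (@domain_frob_range_group 'Z_q).
by rewrite card_ord Zp_cast // card_finNzRing_gt1.
Qed.

End ChartRange.

(** * Gluing the Verschiebung from the charts *)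

Section Verschiebung.
Variables (F : finFieldType) (A : gfunctor F).
Hypotheses (shA : zariski_sheaf A) (sepA : separated A).
Variables (J : Type) (C : J -> alg F) (i : forall j, mor (Spec (C j)) A).
Hypothesis icov : affine_open_cover i.
Hypothesis Cdom : forall j, (1 : C j) <> 0 -> is_domain (C j).
Local Notation q := #|F|.

Let C_reduced j : reduced (C j).
Proof.
have [C0|C1] := pselect ((1 : C j) = 0); first exact: zero_ring_reduced.
exact/domain_reduced/Cdom.
Qed.

Let pt j : gpts A (C j) := i j (C j) (algHom_id (C j)).

Let chart_pt j (R : alg F) (h : algHom (C j) R) : i j R h = gmap A h (pt j).
Proof.
rewrite -[RHS](morE (i j) h (algHom_id _ : Spec _ _)); congr (i j R _).
exact: algHomP.
Qed.

Let exists_vpt : exists vpt : forall j, gpts A (C j),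
  forall j, gmap A (frob (C j)) (vpt j) = pt j *+ q.
Proof.
have H j : exists v, gmap A (frob (C j)) v = pt j *+ q.
  (* A chart may be the spectrum of the zero ring, over which all points agree. *)
  have [C0|/Cdom Cj] := pselect ((1 : C j) = 0).
    by exists 0; apply: (sheaf_zero_ring shA).
  exact: (domain_frob_range shA sepA icov).
by exists (fun j => projT1 (cid (H j))) => j; case: cid.
Qed.

Section VPoints.
Variable vpt : forall j, gpts A (C j).
Hypothesis vptE : forall j, gmap A (frob (C j)) (vpt j) = pt j *+ q.

(** [S] need not be reduced. Over the localizations of [C j] at functions defining the overlap,
    which are reduced, the Frobenius equation forces equality, and the corresponding localizations
    of [S] inherit it. *)
Let vpt_overlap j k (S : alg F) (h : algHom (C j) S) (h' : algHom (C k) S) :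
  gmap A h (pt j) = gmap A h' (pt k) -> gmap A h (vpt j) = gmap A h' (vpt k).
Proof.
move=> ehh'; have [E hE] : exists E : set (C j), forall S' (f : algHom (C j) S'),
    range (i k S') (gmap A f (pt j)) <-> generates_unit f E.
  by have [/(_ k)[_ /(_ _ (pt j))]] := icov.
have [m [e [s [Ee es]]]] : generates_unit h E.
  by apply/hE; exists h' => //; rewrite chart_pt -ehh'.
apply: (sheaf_uniq shA (a := fun l => h (e l))); first by exists s.
move=> l; have [|h1 eh1] := loc_lift (g := algHom_comp (loc (h (e l))) h)
    (loc_localization (e l)).
  by have [[b hb] _ _] := loc_localization (h (e l)); exists b.
have [psi _ epsi] : range (i k _) (gmap A (loc (e l)) (pt j)).
  by apply/hE; apply: (generates_unit_inv (Ee l)); have [] := loc_localization (e l).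
have v_psi : gmap A (loc (e l)) (vpt j) = gmap A psi (vpt k).
  apply: (gmap_frob_inj sepA); first exact/loc_reduced/C_reduced.
  by rewrite -!gmap_frob !vptE !raddfMn /= -epsi chart_pt.
rewrite -[LHS]gmap_comp -[RHS]gmap_comp -eh1 gmap_comp v_psi -gmap_comp.
congr (gmap A _ _).
apply: (chart_inj icov); rewrite !chart_pt !gmap_comp -chart_pt epsi -gmap_comp eh1.
by rewrite gmap_comp ehh'.
Qed.

(* v is the image of y under the morphism that is vpt on the charts *)
Let good (R : alg F) (y v : gpts A R) :=
  forall j S (f : algHom R S) (h : algHom (C j) S),
    gmap A f y = gmap A h (pt j) -> gmap A f v = gmap A h (vpt j).

Let local_chart (R : alg F) (y : gpts A R) : exists m (a : 'I_m -> R),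
  (exists b : 'I_m -> R, \sum_l b l * a l = 1) /\
  forall l, exists j (h : algHom (C j) (loc_alg (a l))),
    gmap A (loc (a l)) y = gmap A h (pt j).
Proof.
have /choice[E hE] j : exists E : set R, forall S (f : algHom R S),
    range (i j S) (fmap f (y : A R)) <-> generates_unit f E.
  by have [/(_ j)[_ /(_ R y)]] := icov.
have [|m [a [jj [Ea a1]]]] := affine_cover (y := y : A R) (E := E) icov.
  by move=> j S f /hE.
exists m, a; split=> // l; exists (jj l).
have [h _ eh] : range (i (jj l) _) (fmap (loc (a l)) (y : A R)).
  by apply/hE; apply: (generates_unit_inv (Ea l)); have [] := loc_localization (a l).
by exists h; rewrite -chart_pt eh.
Qed.

Let good_uniq (R : alg F) (y v v' : gpts A R) : good y v -> good y v' -> v = v'.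
Proof.
move=> gv gv'; have [m [a [a1 loc_a]]] := local_chart y.
apply: (sheaf_uniq shA a1) => l; have [j [h eh]] := loc_a l.
by rewrite [LHS](gv _ _ _ _ eh) [RHS](gv' _ _ _ _ eh).
Qed.

Let good_gmap (R S : alg F) (f : algHom R S) (y v : gpts A R) :
  good y v -> good (gmap A f y) (gmap A f v).
Proof. by move=> gv j S' g h; rewrite -!gmap_comp; apply: gv. Qed.

Let good_exists (R : alg F) (y : gpts A R) : exists v, good y v.
Proof.
have [m [a [a1 /fin_all_exists[jj /fin_all_exists[h eh]]]]] := local_chart y.
have [||v [hv _]] := @shA R m a _ (fun l => loc (a l)) (fun l => gmap A (h l) (vpt (jj l))) a1.
- by move=> l; apply: loc_localization.
- move=> l l' S g g' e; rewrite -[LHS]gmap_comp -[RHS]gmap_comp.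
  by apply: vpt_overlap; rewrite !gmap_comp -!eh -!gmap_comp e.
exists v => j S f k efk; have [b ab] := a1.
apply: (sheaf_uniq shA (a := fun l => f (a l))).
  exists (fun l => f (b l)); rewrite -(rmorph1 f) -ab rmorph_sum.
  by apply: eq_bigr => l _; rewrite rmorphM.
move=> l; have [|f1 ef1] := loc_lift (g := algHom_comp (loc (f (a l))) f)
    (loc_localization (a l)).
  by have [[c hc] _ _] := loc_localization (f (a l)); exists c.
have := hv l; rewrite [fmap _ _]/= => hvl.
rewrite [LHS]/= [RHS]/= -!gmap_comp -ef1 gmap_comp hvl -gmap_comp.
apply: vpt_overlap; rewrite !gmap_comp -eh -efk -!gmap_comp.
by rewrite ef1.
Qed.

Let V_fun (R : alg F) (y : gpts A R) : gpts A R := projT1 (cid (good_exists y)).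
Let V_good (R : alg F) (y : gpts A R) : good y (V_fun y).
Proof. by rewrite /V_fun; case: cid. Qed.

Let V_gmap (R S : alg F) (f : algHom R S) (y : gpts A R) :
  V_fun (gmap A f y) = gmap A f (V_fun y).
Proof. by apply: (good_uniq (@V_good _ _)); apply/good_gmap/V_good. Qed.

Let V_frob (R : alg F) (y : gpts A R) : gmap A (frob R) (V_fun y) = y *+ q.
Proof.
have [m [a [a1 loc_a]]] := local_chart y.
apply: (sheaf_uniq shA a1) => l; have [j [h eh]] := loc_a l.
rewrite [LHS]gmap_frob [RHS](raddfMn (gmap A (loc (a l)))) eh.
by rewrite (V_good eh) -gmap_frob vptE raddfMn.
Qed.

(** The universal pair of points in two charts lives over the tensor product of their rings. It is
    reduced, and there both sides have the same image under Frobenius. *)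
Let V_add2 j k (R : alg F) (h : algHom (C j) R) (h' : algHom (C k) R) :
  V_fun (gmap A h (pt j) + gmap A h' (pt k)) =
  V_fun (gmap A h (pt j)) + V_fun (gmap A h' (pt k)).
Proof.
have [g [<- <-]] := ta_lift h h'.
rewrite !gmap_comp -raddfD !V_gmap -raddfD; congr (gmap A g _).
apply: (gmap_frob_inj sepA); first exact: tensor_reduced.
by rewrite [RHS]raddfD V_frob -[gmap A (ta_in1 _ _) (V_fun _)]V_gmap
  -[gmap A (ta_in2 _ _) (V_fun _)]V_gmap !V_frob mulrnDl.
Qed.

Let V_add1 j (R : alg F) (h : algHom (C j) R) (z : gpts A R) :
  V_fun (gmap A h (pt j) + z) = V_fun (gmap A h (pt j)) + V_fun z.
Proof.
have [m [a [a1 loc_a]]] := local_chart z.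
apply: (sheaf_uniq shA a1) => l; have [k [h' eh']] := loc_a l.
by rewrite /= raddfD /= -!V_gmap raddfD /= eh' -gmap_comp V_add2.
Qed.

Let V_add (R : alg F) (y z : gpts A R) : V_fun (y + z) = V_fun y + V_fun z.
Proof.
have [m [a [a1 loc_a]]] := local_chart y.
apply: (sheaf_uniq shA a1) => l; have [j [h eh]] := loc_a l.
by rewrite /= raddfD /= -!V_gmap raddfD /= eh V_add1.
Qed.

Lemma verschiebung_of_points : exists V : End A, V * frobenius A = 1 *+ q.
Proof.
exists (@GHom F A A V_fun V_gmap V_add).
apply: ghomP => R y.
have -> : (1 *+ q : End A) R y = y *+ q.
  by elim: q => [|n IHn] //; rewrite !mulrS -IHn.
by rewrite -V_frob; apply: V_gmap.
Qed.

End VPoints.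

Lemma verschiebung_charts : exists V : End A, V * frobenius A = 1 *+ q.
Proof. by have [vpt vptE] := exists_vpt; apply: verschiebung_of_points vptE. Qed.

End Verschiebung.

Lemma verschiebung (F : finFieldType) (A : gfunctor F) :
  abelian_variety A -> exists V : End A, V * frobenius A = 1 *+ #|F|.
Proof.
move=> [[shA [J [C [i icov]]]] [_ sepA _] geomA].
apply: (verschiebung_charts shA sepA icov) => j.
by have [/(_ j) oi _] := icov; apply: chart_domain oi.
Qed.

(** * The Galois decomposition of a base change *)

Lemma size_fixed_pow (F : fieldType) N (l : seq F) : (1 < N)%N -> uniq l ->
  (forall c, c \in l -> c ^+ N = c) -> (size l <= N)%N.
Proof.
move=> N1 ul fixl; have sp : size ('X^N - 'X : {poly F}) = N.+1.
  by rewrite size_polyDl ?size_polyXn // size_polyN size_polyX ltnS.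
rewrite -ltnS -sp; apply: max_poly_roots => //.
  by rewrite -size_poly_eq0 sp.
by apply/allP => c cl; rewrite rootE !hornerE fixl // subrr.
Qed.

(** Over the zero ring the zero map has both properties; otherwise [R] is packed as a nonzero ring,
    where polynomial evaluation applies. *)
Lemma exists_poly_ev (F : comNzRingType) (R : comPzRingType)
    (f : {rmorphism F -> R}) (x : R) :
  exists ev : {rmorphism {poly F} -> R}, (forall c, ev c%:P = f c) /\ ev 'X = x.
Proof.
have [R0|R1] := pselect ((1 : R) = 0).
  have R00 (y z : R) : y = z by rewrite -[y]mul1r -[z]mul1r R0 !mul0r.
  have i1 : (fun _ : {poly F} => 0 : R) 1 = 1 by [].
  have iD (p p' : {poly F}) : (fun _ : {poly F} => 0 : R) (p + p') = 0 + 0 by [].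
  have iM (p p' : {poly F}) : (fun _ : {poly F} => 0 : R) (p * p') = 0 * 0 by [].
  by exists (mk_rmorphism i1 iD iM).
pose R' : comNzRingType := HB.pack (GRing.ComPzRing.sort R)
  (GRing.PzSemiRing_isNonZero.Build (GRing.ComPzRing.sort R) (introN eqP R1)).
pose f' : {rmorphism F -> R'} := f.
have cfu : commr_rmorph f' (x : R') by move=> c; apply: mulrC.
exists (horner_morph cfu : {rmorphism {poly F} -> R'}); split=> [c|].
  exact: (horner_morphC cfu).
exact: (horner_morphX cfu).
Qed.

Section Idempotents.
Variables (k F : finFieldType) (iota : {rmorphism k -> F}) (n : nat).
Hypothesis card_F : #|F| = (#|k| ^ n)%N.
Local Notation q := #|k|.

Lemma ext_degree_gt0 : (0 < n)%N.
Proof. by case: n card_F (card_finNzRing_gt1 F) => // ->. Qed.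

Lemma expq_eq0 m : (q ^ m == 0)%N = false.
Proof. by rewrite expn_eq0 -leqn0 leqNgt (ltnW (card_finNzRing_gt1 k)). Qed.

Lemma expq_add (R : comPzRingType) (f : {rmorphism k -> R}) m (x y : R) :
  (x + y) ^+ (q ^ m) = x ^+ (q ^ m) + y ^+ (q ^ m).
Proof.
have [p pr_p pk] := finPcharP k.
have p0 : p%:R = 0 :> R by rewrite -(rmorph_nat f) (pcharf0 pk) rmorph0.
have [d ->] : exists d, q = (p ^ d)%N.
  by eexists; apply: (card_pprimeChar pk).
rewrite -expnM; elim: (d * m)%N => [|e IHe]; rewrite ?expr1 // expnSr !exprM IHe.
exact: exprD_pz.
Qed.

Lemma expq_iota m c : iota c ^+ (q ^ m) = iota c.
Proof.
rewrite -rmorphXn; congr (iota _); elim: m => [|m IHm]; first by rewrite expr1.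
by rewrite expnSr exprM IHm expf_card.
Qed.

Lemma expq_n (c : F) : c ^+ (q ^ n) = c.
Proof. by rewrite -card_F expf_card. Qed.

(** The image of k already supplies q roots of X^q - X. *)
Lemma expq_fixed (c : F) : c ^+ q = c -> exists a, c = iota a.
Proof.
move=> cq; have [/mapP[a _ ->]|nc] := boolP (c \in [seq iota a | a <- enum k]).
  by exists a.
have := @size_fixed_pow F q (c :: [seq iota a | a <- enum k]) (card_finNzRing_gt1 k).
rewrite /= nc (map_inj_uniq (fmorph_inj iota)) enum_uniq size_map -cardE ltnn.
move=> /(_ isT) H. exfalso; apply: notF; apply: H => d.
rewrite inE => /orP[/eqP->//|/mapP[a _ ->]].
by have := expq_iota 1 a; rewrite expn1.
Qed.

Fact exists_generator : exists th : F, forall c, c != 0 -> exists m, c = th ^+ m.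
Proof.
have /cyclicP[x ex] := field_unit_group_cyclic [set: {unit F}]%G.
exists (val x) => c c0; have uc : c \is a GRing.unit by rewrite unitfE.
have : FinRing.unit F uc \in [set: {unit F}]%g by rewrite finset.in_setT.
rewrite ex => /cycleP[m em]; exists m.
by have := congr1 val em; rewrite /= => ->; rewrite FinRing.val_unitX.
Qed.

Definition gen_elt : F := projT1 (cid exists_generator).
Local Notation th i := (gen_elt ^+ (q ^ i)).

Lemma gen_eltP c : c != 0 -> exists m, c = gen_elt ^+ m.
Proof. by move=> c0; rewrite /gen_elt; case: cid => x /= /(_ c c0). Qed.

(** If two conjugates of the generator agree, the power q^(j-i) fixes every element of F; but
    X^(q^(j-i)) - X has fewer than q^n roots. *)
Lemma conj_inj (i j : 'I_n) : th i = th j -> i = j.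
Proof.
wlog le_ij : i j / (i <= j)%N.
  by move=> H; case: (leqP i j) => [/H//|/ltnW/H] H' /esym/H'.
move=> eij; apply/val_inj/eqP; rewrite eqn_leq le_ij leqNgt; apply/negP => lt_ij.
have all_eq (c : F) : c ^+ (q ^ i) = c ^+ (q ^ j).
  have [->|/gen_eltP[m ->]] := eqVneq c 0.
    by rewrite !expr0n !expq_eq0.
  by rewrite -!exprM ![(m * _)%N]mulnC !exprM eij.
have d0 : (0 < j - i)%N by rewrite subn_gt0.
have fixd (c : F) : c ^+ (q ^ (j - i)) = c.
  have := all_eq (c ^+ (q ^ (n - i))).
  rewrite -!exprM -!expnD subnK ?expq_n; last exact/ltnW/ltn_ord.
  have -> : (n - i + j = n + (j - i))%N.
    by rewrite addnBA // addnBAC // ltnW.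
  by rewrite expnD exprM expq_n.
have := @size_fixed_pow F (q ^ (j - i)) (enum F).
rewrite enum_uniq -cardE card_F leq_exp2l ?card_finNzRing_gt1 //.
have -> : (1 < q ^ (j - i))%N by rewrite -(expn0 q) ltn_exp2l ?card_finNzRing_gt1.
move=> /(_ isT isT (fun c _ => fixd c)).
by rewrite leqNgt (leq_ltn_trans (leq_subr _ _)) // ltn_ord.
Qed.

(** The minimal polynomial of the generator over k. *)
Definition conj_poly : {poly F} := \prod_(i < n) ('X - (th i)%:P).

(** The q-th power permutes the conjugates cyclically, so it fixes the coefficients. *)
Lemma conj_poly_coef j : exists a, conj_poly`_j = iota a.
Proof.
apply: expq_fixed.
have fD (x y : F) : (fun x : F => x ^+ q) (x + y) = x ^+ q + y ^+ q.
  by have := expq_add iota 1 x y; rewrite expn1.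
have fM (x y : F) : (fun x : F => x ^+ q) (x * y) = x ^+ q * y ^+ q.
  by rewrite exprMn.
have [f fE] : exists f : {rmorphism F -> F}, forall x, f x = x ^+ q.
  by exists (mk_rmorphism (f := fun x : F => x ^+ q) (expr1n _ _) fD fM).
have : map_poly f conj_poly = conj_poly.
  rewrite /conj_poly rmorph_prod; case: n ext_degree_gt0 expq_n => // n' _ fixn.
  rewrite [LHS]big_ord_recr [RHS]big_ord_recl [LHS]mulrC /=; congr (_ * _).
    rewrite rmorphB /= map_polyX map_polyC /= fE -exprM -expnSr fixn.
    by rewrite expn0 expr1.
  apply: eq_bigr => i _.
  by rewrite rmorphB /= map_polyX map_polyC /= fE -exprM -expnSr.
by move/(congr1 (fun p : {poly F} => p`_j)); rewrite coef_map /= fE.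
Qed.

Definition lagrange (i : 'I_n) : {poly F} :=
  \prod_(j < n | j != i) (('X - (th j)%:P) * ((th i - th j)^-1)%:P).

Lemma size_lagrange i : (size (lagrange i) <= n)%N.
Proof.
rewrite /lagrange big_split /= -rmorph_prod mulrC mul_polyC.
apply: leq_trans (size_scale_leq _ _) _.
rewrite -big_filter size_prod_XsubC size_filter.
rewrite -sum1_count (_ : (\sum_(j < n | j != i) 1 = n.-1)%N) ?prednK //.
  exact: ext_degree_gt0.
by rewrite (eq_bigl (mem (predC1 i))) // sum1_card cardC1 card_ord.
Qed.

(** The difference has degree less than n and vanishes at the n distinct conjugates. *)
Lemma lagrange_sum : \sum_i lagrange i = 1.
Proof.
apply/eqP; rewrite -subr_eq0; apply/eqP.
apply: (@roots_geq_poly_eq0 _ _ [seq th (nat_of_ord i) | i <- enum 'I_n]).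
- apply/allP => _ /mapP[i _ ->]; rewrite rootE !hornerE horner_sum.
  rewrite (bigD1 i) //= big1 ?addr0 => [|j ji]; last first.
    by rewrite horner_prod (bigD1 i) 1?eq_sym //= !hornerE subrr mul0r mul0r.
  rewrite horner_prod big1 ?subrr // => j ji; rewrite !hornerE mulfV //.
  by rewrite subr_eq0; apply: contra ji => /eqP/conj_inj ->.
- by rewrite map_inj_uniq ?enum_uniq // => i j /conj_inj.
rewrite size_map -cardE card_ord (leq_trans (size_polyD _ _)) // geq_max.
rewrite size_polyN size_poly1 ext_degree_gt0 andbT.
apply: (leq_trans (size_sum _ _ _)); apply/bigmax_leqP => i _.
exact: size_lagrange.
Qed.

Section Eps.
Variables (R : comPzRingType) (f : {rmorphism F -> R}) (x : R).

(** The value of [lagrange i] at [x]. If [x] is a root of [conj_poly], these are orthogonal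
    idempotents, and the i-th one cuts out the part of [R] where [x] is the i-th conjugate. *)
Definition eps (i : 'I_n) : R :=
  \prod_(j < n | j != i) ((x - f (th j)) * f (th i - th j)^-1).

Hypothesis x_root : \sum_(j < size conj_poly) f conj_poly`_j * x ^+ j = 0.

Let eps_ev : exists ev : {rmorphism {poly F} -> R},
  [/\ forall i, eps i = ev (lagrange i), forall c, ev c%:P = f c,
      ev 'X = x & ev conj_poly = 0].
Proof.
have [ev [evC evX]] := exists_poly_ev f x; exists ev; split=> // [i|].
  rewrite /eps /lagrange rmorph_prod; apply: eq_bigr => j _.
  by rewrite rmorphM rmorphB evX !evC.
rewrite -[conj_poly]coefK poly_def rmorph_sum -[RHS]x_root; apply: eq_bigr => j _.
by rewrite -mul_polyC rmorphM rmorphXn evX evC.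
Qed.

Lemma eps_sum : \sum_i eps i = 1.
Proof.
have [ev [epsE _ _ _]] := eps_ev; rewrite -(rmorph1 ev) -lagrange_sum rmorph_sum.
by apply: eq_bigr => i _.
Qed.

Lemma eps_eigen i : x * eps i = f (th i) * eps i.
Proof.
have [ev [epsE evC evX ev0]] := eps_ev.
apply/eqP; rewrite -subr_eq0 -mulrBl -{1}evX -evC -rmorphB epsE -rmorphM.
rewrite /lagrange big_split mulrA /= -(bigD1 i (P := predT)) //= -/conj_poly.
by rewrite rmorphM ev0 mul0r.
Qed.

Lemma eps_orth i j : i != j -> eps i * eps j = 0.
Proof.
move=> ij; have d0 : th i - th j != 0.
  by rewrite subr_eq0; apply: contra ij => /eqP/conj_inj ->.
have : f (th i - th j) * (eps i * eps j) = 0.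
  rewrite rmorphB mulrBl mulrA -eps_eigen [eps i * _]mulrC [f (th j) * _]mulrA.
  by rewrite -eps_eigen; ring.
move/(congr1 (fun y => f (th i - th j)^-1 * y)).
by rewrite mulrA -rmorphM mulVf // rmorph1 mul1r mulr0.
Qed.

Lemma eps_idem i : eps i * eps i = eps i.
Proof.
rewrite -[RHS]mulr1 -eps_sum [in RHS](bigD1 i) //= mulrDr big_distrr /=.
rewrite [X in _ = _ + X]big1 ?addr0 // => j ji.
by apply: eps_orth; rewrite eq_sym.
Qed.

End Eps.

Lemma ring_hom_root (R : comPzRingType) (f z : {rmorphism F -> R}) :
  (forall a, z (iota a) = f (iota a)) ->
  \sum_(j < size conj_poly) f conj_poly`_j * z gen_elt ^+ j = 0.
Proof.
move=> zf; transitivity (z (conj_poly.[gen_elt])).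
  rewrite horner_coef rmorph_sum; apply: eq_bigr => j _.
  by have [a ->] := conj_poly_coef j; rewrite rmorphM rmorphXn zf.
rewrite /conj_poly horner_prod (bigD1 (Ordinal ext_degree_gt0)) //=.
by rewrite !hornerE subrr mul0r rmorph0.
Qed.

(** [eps_eigen] is the case of the generator, whose powers exhaust the nonzero elements of F. Thus
    two homomorphisms that agree on k differ, on each part, by a power of the q-Frobenius. *)
Lemma ring_hom_eps (R : comPzRingType) (f z : {rmorphism F -> R}) i c :
  (forall a, z (iota a) = f (iota a)) ->
  z c * eps f (z gen_elt) i = f (c ^+ (q ^ i)) * eps f (z gen_elt) i.
Proof.
move=> zf; have eig := eps_eigen (ring_hom_root zf) i.
have [->|/gen_eltP[m ->]] := eqVneq c 0.
  by rewrite expr0n expq_eq0 !rmorph0 !mul0r.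
rewrite rmorphXn -exprM mulnC exprM rmorphXn.
elim: m => [|m IHm]; first by rewrite !expr0.
by rewrite !exprS -mulrA IHm mulrCA eig mulrCA mulrA.
Qed.

End Idempotents.

(** * Twists of an algebra and their product *)

Section Twists.
Variables (k F : finFieldType) (iota : {rmorphism k -> F}) (n : nat).
Hypothesis card_F : #|F| = (#|k| ^ n)%N.
Local Notation q := #|k|.
Local Notation restr := (alg_restr iota).

Definition frobq (R : comPzRingType) (f : {rmorphism k -> R}) m : {rmorphism R -> R} :=
  mk_rmorphism (f := fun x : R => x ^+ (q ^ m)) (expr1n _ _) (expq_add f m)
    (fun x y => exprMn (q ^ m) x y).

Definition frobqk (R : alg k) m : algHom R R :=
  @AlgHom k R R (frobq (alg_str R) m)
    (fun c => etrans (esym (rmorphXn (alg_str R) (q ^ m) c))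
                     (congr1 (alg_str R) (expq_iota idfun m c))).

Definition twist (m : nat) (S : alg F) : alg F :=
  @Alg F S (alg_str S \o frobq iota m).

Lemma twist_strE m S c : alg_str (twist m S) c = alg_str S (c ^+ (q ^ m)).
Proof. by []. Qed.

Definition twist_map m S S' (f : algHom S S') : algHom (twist m S) (twist m S') :=
  @AlgHom F (twist m S) (twist m S') f (fun c => algHom_str f _).

Definition to_twist m S : algHom (restr S) (restr (twist m S)) :=
  @AlgHom k (restr S) (restr (twist m S)) idfun
    (fun c => esym (congr1 (alg_str S) (expq_iota iota m c))).

Definition frob_to_twist m S : algHom S (twist m S) :=
  @AlgHom F S (twist m S) (frobq (alg_str S \o iota) m)
    (fun c => esym (rmorphXn (alg_str S) (q ^ m) c)).

Fact frob_of_twist_str m i S (c : F) : (m + i = n)%N ->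
  frobq (alg_str S \o iota) i (alg_str (twist m S) c) = alg_str S c.
Proof.
move=> min; rewrite mk_rmorphismE /= -rmorphXn -exprM -expnD min.
by rewrite expq_n.
Qed.

(** This induces the relative Frobenius Fr_i: the power q^i turns the twisted scalar c^(q^m) into
    c^(q^n) = c. *)
Definition frob_of_twist m i S (min : (m + i = n)%N) : algHom (twist m S) S :=
  @AlgHom F (twist m S) S (frobq (alg_str S \o iota) i)
    (fun c => frob_of_twist_str S c min).

(** A copy of ['I_n] in [Set], so that products indexed by it are small. *)
Definition ord_set : Set := {i : nat | (i < n)%N}.
Definition to_ord_set (i : 'I_n) : ord_set := exist _ (val i) (ltn_ord i).
Definition of_ord_set (i : ord_set) : 'I_n := Ordinal (svalP i).

Lemma to_ord_setK i : of_ord_set (to_ord_set i) = i.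
Proof. exact: val_inj. Qed.
Lemma of_ord_setK i : to_ord_set (of_ord_set i) = i.
Proof. by case: i => i h; apply: eq_exist. Qed.

Section Product.
Variable S : alg F.
Local Notation P := (ord_set -> S).

Fact prod_DA : associative (fun x y : P => fun i => x i + y i).
Proof. by move=> x y z; apply/funext => i; rewrite addrA. Qed.
Fact prod_DC : commutative (fun x y : P => fun i => x i + y i).
Proof. by move=> x y; apply/funext => i; rewrite addrC. Qed.
Fact prod_D0 : left_id (fun _ => 0) (fun x y : P => fun i => x i + y i).
Proof. by move=> x; apply/funext => i; rewrite add0r. Qed.
Fact prod_DN : left_inverse (fun _ => 0) (fun x : P => fun i => - x i)
  (fun x y : P => fun i => x i + y i).
Proof. by move=> x; apply/funext => i; rewrite addNr. Qed.
Fact prod_MA : associative (fun x y : P => fun i => x i * y i).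
Proof. by move=> x y z; apply/funext => i; rewrite mulrA. Qed.
Fact prod_MC : commutative (fun x y : P => fun i => x i * y i).
Proof. by move=> x y; apply/funext => i; rewrite mulrC. Qed.
Fact prod_M1 : left_id (fun _ => 1) (fun x y : P => fun i => x i * y i).
Proof. by move=> x; apply/funext => i; rewrite mul1r. Qed.
Fact prod_MD : left_distributive (fun x y : P => fun i => x i * y i)
  (fun x y : P => fun i => x i + y i).
Proof. by move=> x y z; apply/funext => i; rewrite mulrDl. Qed.

Definition prod_ring : smallRing :=
  SmallRing prod_DA prod_DC prod_D0 prod_DN prod_MA prod_MC prod_M1 prod_MD.

Let pr_fun (i : 'I_n) (x : prod_ring) : S := x (to_ord_set i).

Lemma prod_ext (x y : prod_ring) : (forall i, pr_fun i x = pr_fun i y) -> x = y.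
Proof. by move=> e; apply/funext => i; rewrite -(of_ord_setK i); apply: e. Qed.

Let str_fun (c : F) : prod_ring :=
  fun i => alg_str (twist (n - of_ord_set i) S) c.

Fact prod_str1 : str_fun 1 = 1.
Proof. by apply/funext => i; apply: rmorph1. Qed.
Fact prod_strD c d : str_fun (c + d) = str_fun c + str_fun d.
Proof. by apply/funext => i; apply: rmorphD. Qed.
Fact prod_strM c d : str_fun (c * d) = str_fun c * str_fun d.
Proof. by apply/funext => i; apply: rmorphM. Qed.

(* This is S (x)_k F; prod_extend is its universal property. *)
Definition prod_alg : alg F :=
  @Alg F prod_ring (mk_rmorphism prod_str1 prod_strD prod_strM).

Definition pr_hom (i : 'I_n) : {rmorphism prod_ring -> S} :=
  mk_rmorphism (f := pr_fun i) (erefl _) (fun x y => erefl _) (fun x y => erefl _).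

Fact pr_str i c : pr_hom i (alg_str prod_alg c) = alg_str (twist (n - i) S) c.
Proof. by rewrite /= /pr_fun /str_fun to_ord_setK. Qed.

Definition pr (i : 'I_n) : algHom prod_alg (twist (n - i) S) :=
  @AlgHom F prod_alg (twist (n - i) S) (pr_hom i) (pr_str i).

Definition diag_hom : {rmorphism S -> prod_ring} :=
  mk_rmorphism (f := fun x : S => (fun _ => x) : prod_ring)
    (erefl _) (fun x y => erefl _) (fun x y => erefl _).

Fact diag_str c : diag_hom (alg_str (restr S) c) = alg_str (restr prod_alg) c.
Proof.
by apply/funext => i; rewrite /= /str_fun twist_strE expq_iota.
Qed.

Definition diag : algHom (restr S) (restr prod_alg) :=
  @AlgHom k (restr S) (restr prod_alg) diag_hom diag_str.

Lemma pr_diag i : algHom_comp (algHom_restr iota (pr i)) diag = to_twist (n - i) S.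
Proof. exact: algHomP. Qed.

Definition prod_unit (i : 'I_n) : prod_alg := fun j => (of_ord_set j == i)%:R.

Lemma pr_unit i j : pr i (prod_unit j) = (i == j)%:R.
Proof. by rewrite /= /pr_fun /prod_unit to_ord_setK. Qed.

Lemma pr_surj (i : 'I_n) (y : twist (n - i) S) : exists x, pr i x = y.
Proof. by exists ((fun _ => y) : prod_ring). Qed.

Lemma pr_localization i : is_localization (pr i) (prod_unit i).
Proof.
split=> [|y|x prx].
- by exists 1; rewrite pr_unit eqxx mulr1.
- by have [x <-] := pr_surj y; exists 0%N, x; rewrite mulr1.
exists 1%N; rewrite expr1; apply: prod_ext => j.
rewrite -[LHS]/(pr j (prod_unit i * x)) rmorphM pr_unit.
by have [->|_] := eqVneq j i; rewrite ?prx ?mul0r ?mulr0.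
Qed.

Lemma prod_unit_sum : \sum_i 1 * prod_unit i = 1 :> prod_alg.
Proof.
apply: prod_ext => j; rewrite -[LHS]/(pr j _) rmorph_sum (bigD1 j) //=.
rewrite big1 ?addr0 => [|i ij]; rewrite mul1r -[LHS]/(pr j _) pr_unit ?eqxx //.
by rewrite eq_sym (negPf ij).
Qed.

(** The coordinate idempotents give a Zariski cover whose pieces are the twists; two different
    pieces meet in the spectrum of the zero ring, so the coordinates are independent of each
    other. *)
Lemma sheaf_prod (A : gfunctor F) (shA : zariski_sheaf A)
    (a : forall i : 'I_n, gpts A (twist (n - i) S)) :
  exists! b : gpts A prod_alg, forall i, gmap A (pr i) b = a i.
Proof.
apply: (@shA prod_alg n prod_unit _ pr a).
- by exists (fun _ => 1); apply: prod_unit_sum.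
- exact: pr_localization.
move=> i j T g h e; have [eij|nij] := eqVneq i j.
  subst j; have -> // : g = h; apply: algHomP => y; have [x <-] := pr_surj y.
  by have /(congr1 (fun f : algHom _ _ => f x)) := e.
apply: (sheaf_zero_ring shA).
rewrite -(rmorph1 g) -(rmorph0 h).
have : g (pr i (prod_unit i)) = h (pr j (prod_unit i)).
  by have /(congr1 (fun f : algHom _ _ => f (prod_unit i))) := e.
by rewrite !pr_unit eqxx eq_sym (negPf nij).
Qed.

Section Extend.
Variables (S' : alg F) (z : algHom (restr S) (restr S')).
Local Notation epsz := (@eps k F n S' (alg_str S') (z (alg_str S (gen_elt F)))).

Let zstr : {rmorphism F -> S'} := (z : {rmorphism S -> S'}) \o alg_str S.
Let zstr_iota a : zstr (iota a) = alg_str S' (iota a).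
Proof. exact: (algHom_str z). Qed.

Let ext_fun (x : prod_ring) : S' := \sum_(i < n) z (pr_hom i x) * epsz i.

Let eps_facts := ring_hom_root card_F zstr_iota.

Fact ext_fun1 : ext_fun 1 = 1.
Proof.
rewrite -(eps_sum card_F eps_facts); apply: eq_bigr => i _.
by rewrite !rmorph1 mul1r.
Qed.
Fact ext_funD x y : ext_fun (x + y) = ext_fun x + ext_fun y.
Proof. by rewrite -big_split; apply: eq_bigr => i _; rewrite !rmorphD mulrDl. Qed.
Fact ext_funM x y : ext_fun (x * y) = ext_fun x * ext_fun y.
Proof.
rewrite /ext_fun big_distrl; apply: eq_bigr => i _ /=.
rewrite big_distrr (bigD1 i) //= big1 ?addr0 => [|j ji].
  rewrite mulrACA (eps_idem card_F eps_facts) -rmorphM.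
  by congr (z _ * _).
by rewrite mulrACA (eps_orth card_F eps_facts) ?mulr0 // eq_sym.
Qed.

Definition ext_hom : {rmorphism prod_alg -> S'} :=
  mk_rmorphism ext_fun1 ext_funD ext_funM.

Fact ext_str c : ext_hom (alg_str prod_alg c) = alg_str S' c.
Proof.
rewrite mk_rmorphismE /ext_fun.
transitivity (\sum_(i < n) alg_str S' c * epsz i); last first.
  by rewrite -big_distrr /= (eps_sum card_F eps_facts) mulr1.
(* The i-th coordinate of the scalar [c] is c^(q^(n-i)); on the i-th part of [S'] the map [z]
   contributes a further power q^i, and c^(q^n) = c. *)
apply: eq_bigr => i _; rewrite pr_str twist_strE.
rewrite (ring_hom_eps card_F i _ zstr_iota) -exprM -expnD subnK ?(ltnW (ltn_ord i)) //.
by rewrite (expq_n card_F).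
Qed.

Definition prod_extend : algHom prod_alg S' := @AlgHom F prod_alg S' ext_hom ext_str.

Lemma prod_extendE x : prod_extend x = \sum_(i < n) z (pr_hom i x) * epsz i.
Proof. by []. Qed.

Lemma prod_extend_diag : algHom_comp (algHom_restr iota prod_extend) diag = z.
Proof.
apply: algHomP => x; rewrite [LHS]prod_extendE.
transitivity (\sum_(i < n) z x * epsz i); first by [].
by rewrite -big_distrr /= (eps_sum card_F eps_facts) mulr1.
Qed.

End Extend.

Lemma prod_extend_comp (S' S'' : alg F) (z : algHom (restr S) (restr S'))
    (f : algHom S' S'') :
  prod_extend (algHom_comp (algHom_restr iota f) z) = algHom_comp f (prod_extend z).
Proof.
apply: algHomP => x; rewrite algHom_compE !prod_extendE rmorph_sum.
apply: eq_bigr => i _; rewrite rmorphM; congr (_ * _).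
rewrite /eps rmorph_prod; apply: eq_bigr => j _.
by rewrite rmorphM rmorphB !algHom_str.
Qed.

(** In the twist the image of the generator is the scalar given by its i-th conjugate. Lagrange
    polynomials take the values 0 and 1 at this node, so only the i-th coordinate survives. *)
Lemma prod_extend_to_twist (i : 'I_n) : prod_extend (to_twist (n - i) S) = pr i.
Proof.
apply: algHomP => x; rewrite prod_extendE.
set f := alg_str _; set y := _ (alg_str S _).
have y_eq : y = f (gen_elt F ^+ (q ^ i)).
  rewrite [RHS]twist_strE -exprM -expnD addnC subnK ?(ltnW (ltn_ord i)) //.
  by rewrite (expq_n card_F).
have eps0 j : j != i -> eps k f y j = 0.
  by move=> ji; rewrite /eps (bigD1 i) 1?eq_sym //= y_eq subrr !mul0r.
have eps1 : eps k f y i = 1.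
  have zi a : (to_twist (n - i) S) (alg_str S (iota a)) = f (iota a).
    exact: (algHom_str (to_twist (n - i) S)).
  pose z := alg_str S : {rmorphism F -> twist (n - i) S}.
  rewrite -(eps_sum card_F (ring_hom_root card_F (z := z) zi)).
  by rewrite (bigD1 i) //= big1 ?addr0.
by rewrite (bigD1 i) //= eps1 mulr1 big1 ?addr0 // => j /eps0 ->; rewrite mulr0.
Qed.

End Product.
End Twists.

(** * Endomorphisms of the Weil restriction *)

Section WeilRestriction.
Variables (k F : comPzRingType) (iota : {rmorphism k -> F}).
Variables (A : gfunctor F) (W : gfunctor k) (u : ghom (gbase_change iota W) A).
Hypothesis W_weil : is_weil_restriction u.
Local Notation restr := (alg_restr iota).

(** The existence half of the universal property for Z = Spec R, combined with Yoneda: a morphism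
    from Spec R to W is the point that it assigns to the identity. [weil_ext] is the uniqueness
    half. *)
Lemma weil_point (R : alg k) (f : mor (base_change iota (Spec R)) A) :
  exists w : gpts W R, forall S (z : algHom R (restr S)),
    u S (gmap W z w) = f S z.
Proof.
have [g [hg _]] := W_weil (Spec_scheme R) f.
exists (g R (algHom_id R)) => S z; rewrite -hg.
rewrite -[gmap W z _](morE g z (algHom_id R : Spec R R)); congr (u S (g _ _)).
exact: algHomP.
Qed.

Lemma weil_ext (R : alg k) (w w' : gpts W R) :
  (forall S (z : algHom R (restr S)), u S (gmap W z w) = u S (gmap W z w')) ->
  w = w'.
Proof.
move=> ww'.
have yonE (v : gpts W R) R1 R2 (f : algHom R1 R2) (x : Spec R R1) :
    gmap W (fmap f x : algHom R R2) v = fmap f (gmap W x v : W R1).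
  exact: gmap_comp.
pose yon v := @Mor k (Spec R) W (fun R1 x => gmap W x v) (yonE v).
have fE S1 S2 (h : algHom S1 S2) (x : base_change iota (Spec R) S1) :
    u S2 (gmap W (fmap h x : algHom R (restr S2)) w) =
    fmap h (u S1 (gmap W (x : algHom R (restr S1)) w) : A S1).
  by rewrite [gmap W _ w]gmap_comp -[RHS]ghomE.
pose f := @Mor F (base_change iota (Spec R)) A
  (fun S z => u S (gmap W (z : algHom R (restr S)) w)) fE.
have [g [hg ug]] := W_weil (Spec_scheme R) f.
have gw : g = yon w by apply: ug.
have gw' : g = yon w' by apply: ug => S z; rewrite [RHS]ww'.
have : yon w R (algHom_id R) = yon w' R (algHom_id R) by rewrite -gw gw'.
by rewrite /= !gmap_id.
Qed.

(** The universal property speaks of morphisms of schemes; additivity of the morphism that it yields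
    follows because [u] separates the points of W. *)
Lemma weil_mor (B : gfunctor k) (f : ghom (gbase_change iota B) A) : scheme B ->
  exists mu : ghom B W, ghom_comp u (ghom_base_change iota mu) = f.
Proof.
move=> schB; have fE S1 S2 (h : algHom S1 S2) (x : base_change iota B S1) :
    f S2 (fmap h x) = fmap h (f S1 x : A S1) by apply: ghomE.
have [g [hg _]] := W_weil schB (@Mor F (base_change iota B) A (fun S => f S) fE).
have gD R (x y : gpts B R) : g R (x + y) = (g R x : gpts W R) + (g R y : gpts W R).
  apply: weil_ext => S z; rewrite raddfD /= ghomD.
  rewrite -[gmap W z (g R (x + y))](morE g) -[gmap W z (g R x)](morE g).
  rewrite -[gmap W z (g R y)](morE g) /=.
  by rewrite [LHS]hg [X in _ = X + _]hg [X in _ = _ + X]hg /= raddfD ghomD.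
exists (@GHom k B W (fun R => g R) (fun R1 R2 h x => morE g h x) gD).
by apply: ghomP => S x; apply: hg.
Qed.

Lemma weil_mor_inj (B : gfunctor k) (mu nu : ghom B W) :
  ghom_comp u (ghom_base_change iota mu) = ghom_comp u (ghom_base_change iota nu) ->
  mu = nu.
Proof.
move=> e; apply: ghomP => R x; apply: weil_ext => S z.
have := congr1 (fun f : ghom (gbase_change iota B) A => f S (gmap B z x)) e.
by rewrite /= !ghomE.
Qed.

Hypothesis schW : scheme W.
Local Notation res := (weil_res u u : End A -> End W).

Lemma weil_resE (lam : End A) :
  ghom_comp u (ghom_base_change iota (res lam)) = ghom_comp lam u.
Proof.
have [mu hmu] := weil_mor (ghom_comp lam u) schW.
by rewrite /weil_res; case: xgetP => [nu _|/(_ mu)].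
Qed.

Lemma weil_res_app (lam : End A) S (w : gpts W (restr S)) :
  u S (res lam (restr S) w) = lam S (u S w).
Proof.
exact: (congr1 (fun f : ghom (gbase_change iota W) A => f S w) (weil_resE lam)).
Qed.

Lemma weil_end_ext (mu nu : End W) :
  (forall S (w : gpts W (restr S)), u S (mu (restr S) w) = u S (nu (restr S) w)) ->
  mu = nu.
Proof. by move=> e; apply: weil_mor_inj; apply: ghomP. Qed.

Lemma weil_res_add (lam mu : End A) : res (lam + mu) = res lam + res mu.
Proof. by apply: weil_end_ext => S w; rewrite weil_res_app ghomD !weil_res_app. Qed.
Lemma weil_res_mul (lam mu : End A) : res (lam * mu) = res lam * res mu.
Proof. by apply: weil_end_ext => S w; rewrite !weil_res_app. Qed.
Lemma weil_res1 : res 1 = 1.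
Proof. by apply: weil_end_ext => S w; rewrite weil_res_app. Qed.

Definition weil_res_hom : {rmorphism End A -> End W} :=
  mk_rmorphism weil_res1 weil_res_add weil_res_mul.

End WeilRestriction.

Section Decomposition.
Variables (k F : finFieldType) (iota : {rmorphism k -> F}) (n : nat).
Hypothesis card_F : #|F| = (#|k| ^ n)%N.
Variables (A : gfunctor F) (W : gfunctor k) (u : ghom (gbase_change iota W) A).
Hypotheses (W_weil : is_weil_restriction u) (schW : scheme W) (shA : zariski_sheaf A).
Local Notation q := #|k|.
Local Notation restr := (alg_restr iota).
Local Notation res := (weil_res u u : End A -> End W).
Local Notation tw i S := (twist iota (n - nat_of_ord i) S).

Lemma frobenius_expE (R : alg k) m (w : gpts W R) :
  (frobenius W ^+ m) R w = gmap W (frobqk R m) w.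
Proof.
elim: m w => [|m IHm] w.
  rewrite expr0 -[LHS]gmap_id; congr (gmap W _ w).
  by apply: algHomP => x; rewrite [RHS]expr1.
rewrite exprSr -[LHS]/((frobenius W ^+ m) R (gmap W (frob R) w)) IHm -gmap_comp.
congr (gmap W _ w); apply: algHomP => x.
by rewrite [RHS]/= expnS exprM.
Qed.

Lemma weil_res_frobenius : res (frobenius A) = frobenius W ^+ n.
Proof.
apply: (weil_end_ext W_weil) => S w; rewrite weil_res_app // frobenius_expE.
rewrite -[LHS]ghomE; congr (u S (gmap W _ w)); apply: algHomP => x.
by rewrite /= /frob_fun card_F.
Qed.

Definition weil_proj (i : 'I_n) (S : alg F) (w : gpts W (restr S)) : gpts A (tw i S) :=
  u (tw i S) (gmap W (to_twist iota (n - i) S) w).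

Lemma weil_proj_surj (S : alg F) (a : forall i : 'I_n, gpts A (tw i S)) :
  exists w, forall i, weil_proj i w = a i.
Proof.
have [b [hb _]] := sheaf_prod shA a.
have fE S1 S2 (h : algHom S1 S2) (z : base_change iota (Spec (restr S)) S1) :
    gmap A (prod_extend card_F (fmap h z)) b =
    fmap h (gmap A (prod_extend card_F (z : algHom (restr S) (restr S1))) b : A S1).
  by rewrite [RHS]/= -gmap_comp -prod_extend_comp.
have [w hw] := weil_point W_weil (@Mor F (base_change iota (Spec (restr S))) A
   (fun S' z => gmap A (prod_extend card_F (z : algHom (restr S) (restr S'))) b) fE).
exists w => i; rewrite /weil_proj hw /= prod_extend_to_twist; exact: hb.
Qed.

(** Every k-algebra map from [S] to an F-algebra factors through the diagonal into [prod_alg], and a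
    point of A over [prod_alg] is determined by its coordinates on the twists. *)
Lemma weil_proj_inj (S : alg F) (w w' : gpts W (restr S)) :
  (forall i, weil_proj i w = weil_proj i w') -> w = w'.
Proof.
move=> e; apply: (weil_ext W_weil) => S' z.
rewrite -(prod_extend_diag card_F z) !gmap_comp.
set d := gmap W (diag _ _ _) w; set d' := gmap W (diag _ _ _) w'.
have := ghomE u (prod_extend card_F z) d => /= ->.
have := ghomE u (prod_extend card_F z) d' => /= ->.
congr (gmap A _ _).
have [b [_ ub]] := sheaf_prod shA (fun i => weil_proj i w).
have uE (v : gpts W (restr S)) (i : 'I_n) : gmap A (pr iota S i) (u (prod_alg iota n S)
    (gmap W (diag iota n S) v)) = weil_proj i v.
  by rewrite -[LHS]ghomE /weil_proj -(pr_diag iota) gmap_comp.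
transitivity b; first by symmetry; apply: ub => i; apply: uE.
by apply: ub => i; rewrite uE e.
Qed.

Lemma weil_proj_add i S (w w' : gpts W (restr S)) :
  weil_proj i (w + w') = weil_proj i w + weil_proj i w'.
Proof. by rewrite /weil_proj raddfD ghomD. Qed.

Lemma weil_proj_gmap i S S' (h : algHom S S') (w : gpts W (restr S)) :
  weil_proj i (gmap W (algHom_restr iota h) w) =
  gmap A (twist_map iota (n - i) h) (weil_proj i w).
Proof.
rewrite /weil_proj -[RHS]ghomE -gmap_comp.
transitivity (u (tw i S') (gmap W (algHom_comp (algHom_restr iota
    (twist_map iota (n - i) h)) (to_twist iota (n - i) S)) w)).
  by congr (u _ (gmap W _ w)); apply: algHomP.
by rewrite gmap_comp.
Qed.

Let min (i : 'I_n) : (n - i + i = n)%N.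
Proof. exact/subnK/ltnW/ltn_ord. Qed.

(** The identity of S, read as a map to the twist and followed by [frob_of_twist], is the power q^i,
    and on W this is the i-th power of Frobenius. *)
Lemma weil_proj_frob i S (w : gpts W (restr S)) :
  gmap A (frob_of_twist iota card_F S (min i)) (weil_proj i w) =
  u S ((frobenius W ^+ i) (restr S) w).
Proof.
rewrite frobenius_expE /weil_proj -[LHS]ghomE.
transitivity (u S (gmap W (algHom_comp (algHom_restr iota
    (frob_of_twist iota card_F S (min i))) (to_twist iota (n - i) S)) w)).
  by rewrite gmap_comp.
by congr (u S (gmap W _ w)); apply: algHomP.
Qed.

Lemma weil_proj_sum i S I (r : seq I) (P : pred I) (w : I -> gpts W (restr S)) :
  weil_proj i (\sum_(j <- r | P j) w j) = \sum_(j <- r | P j) weil_proj i (w j).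
Proof.
apply: (big_morph (@weil_proj i S) (@weil_proj_add i S)).
by apply: (@addIr _ (weil_proj i 0)); rewrite -weil_proj_add !add0r.
Qed.

Section Inclusion.
Variable j : 'I_n.

Let weil_in_ex (S : alg F) (a : gpts A (tw j S)) : exists w : gpts W (restr S),
  weil_proj j w = a /\ forall i, i != j -> weil_proj i w = 0.
Proof.
have [w hw] := @weil_proj_surj S (dfwith (fun i => 0 : gpts A (tw i S)) a).
exists w; split=> [|i ij]; rewrite hw ?dfwith_in //.
by rewrite dfwith_out // 1?eq_sym.
Qed.

(** The preimage is chosen, but [weil_proj_inj] makes it unique, whence its additivity and
    naturality. *)
Definition weil_in (S : alg F) (a : gpts A (tw j S)) : gpts W (restr S) :=
  projT1 (cid (weil_in_ex a)).

Lemma weil_proj_in S a : weil_proj j (@weil_in S a) = a.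
Proof. by rewrite /weil_in; case: cid => w []. Qed.

Lemma weil_proj_in_neq S a i : i != j -> weil_proj i (@weil_in S a) = 0.
Proof. by rewrite /weil_in; case: cid => w [_ /=]; apply. Qed.

Lemma weil_in_eq S (a : gpts A (tw j S)) w : weil_proj j w = a ->
  (forall i, i != j -> weil_proj i w = 0) -> weil_in a = w.
Proof.
move=> wj wi; apply: weil_proj_inj => i.
by have [->|ij] := eqVneq i j; rewrite ?weil_proj_in // weil_proj_in_neq // wi.
Qed.

Lemma weil_in_add S (a b : gpts A (tw j S)) : weil_in (a + b) = weil_in a + weil_in b.
Proof.
apply: weil_in_eq => [|i ij]; rewrite weil_proj_add ?weil_proj_in //.
by rewrite !weil_proj_in_neq // addr0.
Qed.

Lemma weil_in_mulrn S (a : gpts A (tw j S)) m : weil_in (a *+ m) = weil_in a *+ m.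
Proof.
have in0 : weil_in (0 : gpts A (tw j S)) = 0.
  by apply: (@addIr _ (weil_in 0)); rewrite -weil_in_add !add0r.
by elim: m => [|m IHm]; rewrite ?mulr0n // !mulrS weil_in_add IHm.
Qed.

Lemma weil_in_gmap S S' (h : algHom S S') (a : gpts A (tw j S)) :
  weil_in (gmap A (twist_map iota (n - j) h) a) =
  gmap W (algHom_restr iota h) (weil_in a).
Proof.
apply: weil_in_eq => [|i ij]; rewrite weil_proj_gmap ?weil_proj_in //.
by rewrite weil_proj_in_neq // raddf0.
Qed.

End Inclusion.

Lemma weil_decomp S (w : gpts W (restr S)) : w = \sum_j weil_in (weil_proj j w).
Proof.
apply: weil_proj_inj => i; rewrite weil_proj_sum (bigD1 i) //= weil_proj_in.
by rewrite big1 ?addr0 // => j ji; rewrite weil_proj_in_neq // eq_sym.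
Qed.

Lemma End_sumE (E : comPzRingType) (B : gfunctor E) I (r : seq I) (P : pred I)
    (f : I -> End B) R x :
  (\sum_(j <- r | P j) f j) R x = \sum_(j <- r | P j) f j R x.
Proof. exact: (big_morph (fun g : End B => g R x)). Qed.

Lemma End_mulrnE (E : comPzRingType) (B : gfunctor E) (f : End B) m R x :
  (f *+ m) R x = f R x *+ m.
Proof. by elim: m => // m IHm; rewrite !mulrS -IHm. Qed.

Lemma ghom_mulrn (E : comPzRingType) (B C : gfunctor E) (f : ghom B C) m R x :
  f R (x *+ m) = f R x *+ m.
Proof.
have f0 : f R 0 = 0 by apply: (@addIr _ (f R 0)); rewrite -ghomD !add0r.
by elim: m => [|m IHm]; rewrite ?mulr0n // !mulrS ghomD IHm.
Qed.

Variable V : End A.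
Hypothesis VP : V * frobenius A = 1 *+ #|F|.

Let frobV S (y : gpts A S) : gmap A (frob S) (V S y) = y *+ #|F|.
Proof.
have := congr1 (fun g : End A => g S y) VP; rewrite End_mulrnE => <-.
exact: (congr1 (fun g : End A => g S y) (frobenius_central V)).
Qed.

Section Component.
Variables (f : ghom (gbase_change iota W) A) (j : 'I_n).

(* Up to isogeny, composition with the component of f on the j-th twist of A is
   composition with an endomorphism after the Frobenius from that twist to A. *)
Let comp_fun S (y : gpts A S) : gpts A S :=
  f S (weil_in (gmap A (frob_to_twist iota (n - j) S) (V S y))).

Let comp_nat S S' (h : algHom S S') y : comp_fun (gmap A h y) = gmap A h (comp_fun y).
Proof.
rewrite /comp_fun ghomE -[RHS]ghomE /= -weil_in_gmap -!gmap_comp.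
congr (f S' (weil_in (gmap A _ _))); apply: algHomP => x.
by rewrite /= rmorphXn.
Qed.

Let comp_add S (y z : gpts A S) : comp_fun (y + z) = comp_fun y + comp_fun z.
Proof. by rewrite /comp_fun ghomD raddfD /= weil_in_add ghomD. Qed.

Definition component : End A := @GHom F A A comp_fun comp_nat comp_add.

(** By naturality [V] moves past Fr_j to the twist. There Fr_j followed by [frob_to_twist] is the
    Frobenius, and together with [V] it is multiplication by #|F|. *)
Lemma componentE S (w : gpts W (restr S)) :
  component S (u S ((frobenius W ^+ j) (restr S) w)) =
  f S (weil_in (weil_proj j w)) *+ #|F|.
Proof.
rewrite -weil_proj_frob /= /comp_fun ghomE -gmap_comp.
have -> : algHom_comp (frob_to_twist iota (n - j) S)
    (frob_of_twist iota card_F S (min j)) = frob (tw j S).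
  apply: algHomP => x; rewrite /= /frob_fun -exprM -expnD addnC min.
  by rewrite card_F.
by rewrite frobV weil_in_mulrn [LHS]ghom_mulrn.
Qed.

End Component.

Lemma weil_end_span (mu : End W) : exists lam : 'I_n -> End A,
  mu *+ #|F| = \sum_i res (lam i) * frobenius W ^+ i.
Proof.
pose f := ghom_comp u (ghom_base_change iota mu).
exists (component f); apply: (weil_end_ext W_weil) => S w.
have u0 : u S 0 = 0 by apply: (@addIr _ (u S 0)); rewrite -ghomD !add0r.
have usum I (r : seq I) P (x : I -> gpts W (restr S)) :
    u S (\sum_(i <- r | P i) x i) = \sum_(i <- r | P i) u S (x i).
  exact: (big_morph (u S) (@ghomD _ _ _ u S) u0).
rewrite End_mulrnE [LHS]ghom_mulrn End_sumE usum.
transitivity (\sum_i f S (weil_in (weil_proj i w)) *+ #|F|); last first.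
  apply: eq_bigr => i _; rewrite -componentE.
  by rewrite -[RHS]/(u S (res _ (restr S) _)) weil_res_app.
rewrite sumrMnl {1}(weil_decomp w); congr (_ *+ _).
rewrite -[RHS]usum; congr (u S _).
have mu0 : mu (restr S) 0 = 0 by apply: (@addIr _ (mu _ 0)); rewrite -ghomD !add0r.
exact: (big_morph (mu (restr S)) (@ghomD _ _ _ mu (restr S)) mu0).
Qed.

(** The relation is evaluated at a point [w] with a single coordinate, the j-th, obtained from [y]
    by Frobenius. All other terms vanish and [lam j] kills the full Frobenius of [y]; multiplication
    by [V] then gives #|F|. *)
Lemma weil_end_free (lam : 'I_n -> End A) :
  \sum_i res (lam i) * frobenius W ^+ i = 0 -> forall j, lam j *+ #|F| = 0.
Proof.
move=> sum0 j; rewrite -mulr_natr -VP.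
suff lamF : lam j * frobenius A = 0.
  by rewrite -(frobenius_central V) mulrA lamF mul0r.
apply: ghomP => S y.
pose w := weil_in (gmap A (frob_to_twist iota (n - j) S) y).
have u0 : u S 0 = 0 by apply: (@addIr _ (u S 0)); rewrite -ghomD !add0r.
have : u S ((\sum_i res (lam i) * frobenius W ^+ i : End W) (restr S) w) = 0.
  by rewrite sum0.
rewrite End_sumE (big_morph (u S) (@ghomD _ _ _ u S) u0) (bigD1 j) //= big1 ?addr0.
  rewrite weil_res_app // -weil_proj_frob weil_proj_in -gmap_comp => <-.
  congr (lam j S (gmap A _ y)); apply: algHomP => x.
  by rewrite /= /frob_fun -exprM -expnD min card_F.
move=> i ij; rewrite weil_res_app // -weil_proj_frob weil_proj_in_neq // raddf0.
by apply: (@addIr _ (lam i S 0)); rewrite -ghomD !add0r.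
Qed.

End Decomposition.

(** * Tensor products and rationalization *)

Section TensorHom.
Variables (R A B C : pzRingType) (f : central_hom R A) (g : central_hom R B).
Variables (phi : {rmorphism A -> C}) (psi : {rmorphism B -> C}).
Hypotheses (phi_psi : forall r, phi (f r) = psi (g r))
  (comm_phi_psi : forall a b, GRing.comm (phi a) (psi b)).

Let lift_fun (x : tensor f g) : C := \sum_(p <- generic_quotient.repr x) phi p.1 * psi p.2.

Let lift_cls s : lift_fun (tens_cls f g s) = \sum_(p <- s) phi p.1 * psi p.2.
Proof.
apply: (@tens_lift R A B f g C (fun a b => phi a * psi b)).
- by move=> a a' b; rewrite rmorphD mulrDl.
- by move=> a b b'; rewrite rmorphD mulrDr.
- by move=> a r b; rewrite !rmorphM -mulrA phi_psi.
- by rewrite /tens_cls generic_quotient.reprK.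
Qed.

Fact tens_hom1 : lift_fun 1 = 1.
Proof. by rewrite [LHS]lift_cls big_seq1 !rmorph1 mulr1. Qed.
Fact tens_homD x y : lift_fun (x + y) = lift_fun x + lift_fun y.
Proof.
have [[s ->] [t ->]] := conj (tens_clsE x) (tens_clsE y).
by rewrite [_ + _ in LHS]tens_addE !lift_cls big_cat.
Qed.
Fact tens_homM x y : lift_fun (x * y) = lift_fun x * lift_fun y.
Proof.
have lift0 : lift_fun 0 = 0.
  by apply: (@addIr _ (lift_fun 0)); rewrite -tens_homD !add0r.
elim/tens_ind: x => [|x x' ex ex'|a b]; first by rewrite mul0r lift0 mul0r.
  by rewrite mulrDl !tens_homD ex ex' mulrDl.
elim/tens_ind: y => [|y y' ey ey'|a' b']; first by rewrite mulr0 lift0 mulr0.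
  by rewrite mulrDr !tens_homD ey ey' mulrDr.
rewrite tensM !lift_cls !big_seq1 /= !rmorphM.
by rewrite -!mulrA; congr (_ * _); rewrite !mulrA comm_phi_psi.
Qed.

Definition tens_hom : {rmorphism tensor f g -> C} :=
  mk_rmorphism tens_hom1 tens_homD tens_homM.

Lemma tens_homE a b : tens_hom (tens f g a b) = phi a * psi b.
Proof. by rewrite mk_rmorphismE lift_cls big_seq1. Qed.

End TensorHom.

Section PolEval.
Variables (R : comPzRingType).

Lemma pcoefD (p p' : pol R) i : pcoef (p + p') i = pcoef p i + pcoef p' i.
Proof. by []. Qed.

Lemma pcoef_sum I (r : seq I) (P : pred I) (p : I -> pol R) i :
  pcoef (\sum_(j <- r | P j) p j) i = \sum_(j <- r | P j) pcoef (p j) i.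
Proof. exact: (big_morph (fun p => pcoef p i)). Qed.

Lemma pcoef_constM c (p : pol R) i : pcoef (pol_const c * p) i = c * pcoef p i.
Proof.
rewrite [LHS]big_ord_recl subn0 /= mulr1n big1 ?addr0 // => j _.
by rewrite mulr0n mul0r.
Qed.

Lemma pcoefXn m i : pcoef (polX R ^+ m) i = (i == m)%:R.
Proof.
elim: m i => [|m IHm] i; first by rewrite expr0 /= -mulr_natr mul1r.
rewrite exprS [LHS](_ : _ = \sum_(j < i.+1) pcoef (polX R) j * pcoef (polX R ^+ m) (i - j)) //.
case: i => [|i]; first by rewrite big_ord1 mul0r.
rewrite big_ord_recl mul0r add0r big_ord_recl mul1r big1 ?addr0 => [|j _].
  by rewrite subSS subn0 IHm.
by rewrite mul0r.
Qed.

Lemma pol_expand (p : pol R) N : (forall i, (N <= i)%N -> pcoef p i = 0) ->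
  p = \sum_(i < N) pol_const (pcoef p i) * polX R ^+ i.
Proof.
move=> pN; apply: polP => i; rewrite pcoef_sum.
under eq_bigr do rewrite pcoef_constM pcoefXn.
have [iN|Ni] := ltnP i N.
  rewrite (bigD1 (Ordinal iN)) //= eqxx mulr1 big1 ?addr0 // => j ji.
  by rewrite eq_sym -[(_ == i)%N]/(j == Ordinal iN) (negPf ji) mulr0.
rewrite pN // big1 // => j _; rewrite gtn_eqF ?mulr0 //.
exact: leq_trans (ltn_ord j) Ni.
Qed.

Variables (C : pzRingType) (g : {rmorphism R -> C}) (x : C).
Hypothesis xC : forall y, GRing.comm x y.

Let bound (p : pol R) := projT1 (cid (pcoef_fin p)).
Let boundP p i : (bound p <= i)%N -> pcoef p i = 0.
Proof. by rewrite /bound; case: cid => N /=; apply. Qed.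

Let ev (p : pol R) : C := \sum_(i < bound p) g (pcoef p i) * x ^+ i.

(** The bound used in [ev] is a choice; every valid bound gives the same value. *)
Let ev_widen N p : (forall i, (N <= i)%N -> pcoef p i = 0) ->
  ev p = \sum_(i < N) g (pcoef p i) * x ^+ i.
Proof.
have aux M M' : (M <= M')%N -> (forall i, (M <= i)%N -> pcoef p i = 0) ->
    \sum_(i < M) g (pcoef p i) * x ^+ i = \sum_(i < M') g (pcoef p i) * x ^+ i.
  move=> MM' pM; rewrite -!(big_mkord predT (fun i => g (pcoef p i) * x ^+ i)).
  rewrite (big_cat_nat (leq0n M) MM') /= [X in _ = _ + X]big_nat_cond.
  rewrite [X in _ = _ + X]big1 ?addr0 // => i /andP[/andP[Mi _] _].
  by rewrite pM // rmorph0 mul0r.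
move=> pN; have [le|/ltnW le] := leqP (bound p) N; first exact: (aux _ _ le (@boundP p)).
exact: esym (aux _ _ le pN).
Qed.

Fact pol_eval1 : ev 1 = 1.
Proof.
by rewrite (@ev_widen 1) => [|[|i]//]; rewrite big_ord1 /= mulr1n rmorph1 mulr1.
Qed.
Fact pol_evalD p p' : ev (p + p') = ev p + ev p'.
Proof.
pose N := maxn (bound p) (bound p').
have pN i : (N <= i)%N -> pcoef p i = 0.
  by move=> Ni; apply/boundP/(leq_trans (leq_maxl _ _) Ni).
have pN' i : (N <= i)%N -> pcoef p' i = 0.
  by move=> Ni; apply/boundP/(leq_trans (leq_maxr _ _) Ni).
rewrite (ev_widen pN) (ev_widen pN') (@ev_widen N) => [|i Ni].
  by rewrite -big_split; apply: eq_bigr => i _; rewrite rmorphD mulrDl.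
by rewrite pcoefD pN // pN' // addr0.
Qed.

Let ev_mon c m : ev (pol_const c * polX R ^+ m) = g c * x ^+ m.
Proof.
rewrite (@ev_widen m.+1) => [|i mi].
  under eq_bigr do rewrite pcoef_constM pcoefXn.
  rewrite big_ord_recr /= eqxx mulr1 big1 ?add0r // => i _.
  by rewrite ltn_eqF // mulr0 rmorph0 mul0r.
by rewrite pcoef_constM pcoefXn gtn_eqF // mulr0.
Qed.

Fact pol_evalM p p' : ev (p * p') = ev p * ev p'.
Proof.
have ev0 : ev 0 = 0.
  by apply: (@addIr _ (ev 0)); rewrite -pol_evalD !add0r.
have ev_sum I (r : seq I) (h : I -> pol R) :
    ev (\sum_(j <- r) h j) = \sum_(j <- r) ev (h j).
  exact: (big_morph ev pol_evalD ev0).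
rewrite {1}(pol_expand (@boundP p)) {1}(pol_expand (@boundP p')) big_distrl ev_sum.
rewrite [X in _ = X * _]/ev big_distrl; apply: eq_bigr => i _ /=.
rewrite big_distrr ev_sum [X in _ = _ * X]/ev big_distrr; apply: eq_bigr => j _ /=.
rewrite mulrACA -rmorphM -exprD ev_mon rmorphM exprD -!mulrA; congr (_ * _).
have cx : GRing.comm (g (pcoef p' j)) (x ^+ i) by apply/commrX/commr_sym/xC.
by rewrite mulrA cx mulrA.
Qed.

Lemma pol_eval : exists h : {rmorphism pol R -> C},
  (forall c, h (pol_const c) = g c) /\ h (polX R) = x.
Proof.
exists (mk_rmorphism pol_eval1 pol_evalD pol_evalM); split=> [c|].
  by have := ev_mon c 0; rewrite !expr0 !mulr1.
by have := ev_mon 1 1; rewrite !expr1 rmorph1 !mul1r.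
Qed.

End PolEval.

Lemma pquot_lift (R : comPzRingType) (d : R) (C : pzRingType)
    (h : {rmorphism R -> C}) : h d = 0 ->
  exists h' : {rmorphism pquot d -> C}, forall x, h' (pquot_pi d x) = h x.
Proof.
move=> hd; pose lift_fun (x : pquot d) := h (generic_quotient.repr x).
have liftE x : lift_fun (pquot_pi d x) = h x.
  have [z ez] := pquot_repr d x; apply/eqP.
  by rewrite -subr_eq0 /lift_fun -rmorphB ez rmorphM hd mulr0.
have l1 : lift_fun 1 = 1 by rewrite -(rmorph1 (pquot_pi d)) liftE rmorph1.
have lD x y : lift_fun (x + y) = lift_fun x + lift_fun y.
  have [[a ->] [b ->]] := conj (pquotE x) (pquotE y).
  by rewrite -rmorphD !liftE rmorphD.
have lM x y : lift_fun (x * y) = lift_fun x * lift_fun y.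
  have [[a ->] [b ->]] := conj (pquotE x) (pquotE y).
  by rewrite -rmorphM !liftE rmorphM.
by exists (mk_rmorphism l1 lD lM).
Qed.

Section RootExt.
Variables (R : comPzRingType) (n : nat) (c : R).
Hypothesis n_gt0 : (0 < n)%N.
Local Notation X := (root_ext_X n c).
Local Notation sc := (root_ext_scalar n c).

Lemma root_ext_Xn : X ^+ n = sc c.
Proof.
rewrite -[X ^+ n]rmorphXn; apply/pquotP; exists 1; by rewrite mul1r.
Qed.

(** X^n is the scalar [c], so division of the exponent by n with remainder reduces every power of
    X. *)
Lemma root_ext_basis (b : root_ext n c) :
  exists d : 'I_n -> R, b = \sum_i sc (d i) * X ^+ i.
Proof.
pose NF (b : root_ext n c) := exists d : 'I_n -> R, b = \sum_i sc (d i) * X ^+ i.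
rewrite -/(NF b).
have NFD b1 b2 : NF b1 -> NF b2 -> NF (b1 + b2).
  move=> [d1 ->] [d2 ->]; exists (fun i => d1 i + d2 i).
  by rewrite -big_split; apply: eq_bigr => i _; rewrite rmorphD mulrDl.
have NF0 : NF 0.
  by exists (fun _ => 0); rewrite big1 // => i _; rewrite rmorph0 mul0r.
have NFX r m : NF (sc r * X ^+ m).
  have lt_m : (m %% n < n)%N by rewrite ltn_mod.
  exists (fun i => if i == Ordinal lt_m then r * c ^+ (m %/ n) else 0).
  rewrite (@big_only1 _ _ _ _ (Ordinal lt_m)) // => [|i /negPf -> _]; last first.
    by rewrite rmorph0 mul0r.
  rewrite eqxx rmorphM rmorphXn -root_ext_Xn -exprM -mulrA -exprD mulnC.
  by rewrite {1}(divn_eq m n) mulnC.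
have [p ->] := pquotE b; have [N pN] := pcoef_fin p.
rewrite (pol_expand pN) rmorph_sum; apply: big_ind => // i _.
by rewrite rmorphM rmorphXn; apply: NFX.
Qed.

End RootExt.

Section Rationalize.
Variable E : pzRingType.
Local Notation ten := (tens (central_int E) (central_int rat)).

Lemma ten_int e z : ten e z%:~R = ten (e *~ z) 1.
Proof.
have := tens_balanced (central_int E) (central_int rat) e z 1.
by rewrite mulr1 /= mulrzr => ->.
Qed.

Lemma ten_denom (e : E) (r : rat) N : (0 < N)%N ->
  ten e r = ten (e *+ N) (r / N%:R).
Proof.
move=> N0; have := tens_balanced (central_int E) (central_int rat) e N%:Z (r / N%:R).
rewrite /= mulrzr -pmulrn => ->; congr (ten e _).
by rewrite -pmulrn mulrCA divff ?mulr1 // pnatr_eq0 -lt0n.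
Qed.

Lemma rationalize_denom (x : rationalize E) :
  exists N e, (0 < N)%N /\ x = ten e N%:R^-1.
Proof.
elim/tens_ind: x => [|x y [N [e [N0 ->]]] [M [e' [M0 ->]]]|e r].
- exists 1%N, 0; split=> //; apply: (@addrI _ (ten 0 1%:R^-1)).
  by rewrite -tensDl !addr0.
- exists (N * M)%N, (e *+ M + e' *+ N); rewrite muln_gt0 N0 M0; split=> //.
  rewrite (ten_denom e _ M0) (ten_denom e' _ N0) tensDl.
  by rewrite natrM invfM [(M%:R^-1 * _)]mulrC.
- exists `|denq r|%N, (e *~ numq r); rewrite absz_gt0 denq_eq0; split=> //.
  have := tens_balanced (central_int E) (central_int rat) e (numq r) `|denq r|%N%:R^-1.
  rewrite /= mulrzr => ->; congr (ten e _).
  by rewrite -{1}[r]divq_num_den pmulrn gez0_abs.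
Qed.

(* The invariant of the balanced relations is the sum of the a * (K b), for K
   divisible enough. *)
Lemma ten_eq0 (e : E) N : (0 < N)%N -> ten e N%:R^-1 = 0 ->
  exists M, (0 < M)%N /\ e *+ M = 0.
Proof.
move=> N0 e0.
pose val (K : nat) (s : seq (E * rat)) := \sum_(p <- s) p.1 *~ numq (K%:R * p.2).
have den_int (K : nat) (b : rat) : (`|denq b| %| K)%N ->
    exists z : int, K%:R * b = z%:~R.
  move=> /dvdnP[d ->]; exists (d%:Z * numq b).
  rewrite natrM -mulrA rmorphM /= -pmulrn; congr (_ * _).
  by rewrite -{2}[b]divq_num_den pmulrn gez0_abs // mulrCA divff ?mulr1 // intr_eq0 denq_eq0.
have key s t : tens_rel (central_int E) (central_int rat) s t ->
    exists K, (0 < K)%N /\ forall K', (K %| K')%N -> val K' s = val K' t.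
  elim=> {s t}.
  - by move=> s; exists 1%N.
  - by move=> s t _ [K [K0 hK]]; exists K; split=> // K' /hK.
  - move=> s t r _ [K [K0 hK]] _ [L [L0 hL]]; exists (K * L)%N; rewrite muln_gt0 K0 L0.
    split=> // K' KL; rewrite (hK K' (dvdn_trans (dvdn_mulr _ (dvdnn _)) KL)).
    exact: (hL K' (dvdn_trans (dvdn_mull _ (dvdnn _)) KL)).
  - move=> s s' t t' _ [K [K0 hK]] _ [L [L0 hL]]; exists (K * L)%N.
    rewrite muln_gt0 K0 L0; split=> // K' KL.
    have := hK K' (dvdn_trans (dvdn_mulr _ (dvdnn _)) KL).
    have := hL K' (dvdn_trans (dvdn_mull _ (dvdnn _)) KL).
    by rewrite /val !big_cat /= => -> ->.
  - move=> s t; exists 1%N; split=> // K' _.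
    by rewrite /val !big_cat /= addrC.
  - by move=> b; exists 1%N; split=> // K' _; rewrite /val big_seq1 big_nil mul0rz.
  - move=> a a' b; exists 1%N; split=> // K' _.
    by rewrite /val !big_cons !big_nil /= mulrzDl !addr0.
  - move=> a b b'; exists (`|denq b| * `|denq b'|)%N.
    rewrite muln_gt0 !absz_gt0 !denq_eq0; split=> // K' KL.
    have [z ez] := den_int K' b (dvdn_trans (dvdn_mulr _ (dvdnn _)) KL).
    have [z' ez'] := den_int K' b' (dvdn_trans (dvdn_mull _ (dvdnn _)) KL).
    rewrite /val !big_cons !big_nil /= mulrDr ez ez' -rmorphD /= !numq_int.
    by rewrite mulrzDr !addr0.
  - move=> a r b; exists `|denq b|%N; rewrite absz_gt0 denq_eq0; split=> // K' KL.
    have [z ez] := den_int K' b KL; rewrite /val !big_seq1 /= mulrCA ez.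
    by rewrite -[1 *~ r]/(r%:~R) -intrM !numq_int mulrzr -mulrzA.
have [K [K0 hK]] := key _ _ ((tens_clsP _ _ _ _).2 (e0 : _ = tens_cls _ _ [::])).
(* At the multiple K N the tensor of [e] with 1/N has the value [e *+ K]. *)
exists K; split=> //; have := hK (K * N)%N (dvdn_mulr _ (dvdnn _)).
rewrite /val big_seq1 big_nil /= natrM mulfK ?pnatr_eq0 -?lt0n //.
by rewrite pmulrn numq_int -pmulrn.
Qed.

End Rationalize.

Lemma rationalize_hom (E E' : pzRingType) (h : {rmorphism E -> E'}) :
  exists H : {rmorphism rationalize E -> rationalize E'}, forall e r,
    H (tens (central_int E) (central_int rat) e r) =
    tens (central_int E') (central_int rat) (h e) r.
Proof.
pose phi_fun e : rationalize E' := tens (central_int E') (central_int rat) (h e) 1.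
have phi1 : phi_fun 1 = 1 by rewrite /phi_fun rmorph1.
have phiD x y : phi_fun (x + y) = phi_fun x + phi_fun y.
  by rewrite /phi_fun rmorphD tensDl.
have phiM x y : phi_fun (x * y) = phi_fun x * phi_fun y.
  by rewrite /phi_fun rmorphM [RHS]tensM mulr1.
pose phi := mk_rmorphism phi1 phiD phiM.
have phi_psi r : phi (central_int E r) = rat_scalar E' (central_int rat r).
  rewrite /phi mk_rmorphismE /phi_fun /= rmorphMz rmorph1.
  exact: (esym (ten_int 1 r)).
have comm_phi_psi a b : GRing.comm (phi a) (rat_scalar E' b).
  exact/commr_sym/centralP.
exists (tens_hom phi_psi comm_phi_psi) => e r.
by rewrite tens_homE [LHS]tensM mulr1 mul1r.
Qed.

(** * The isomorphism *)

Section Main.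
Variables (k F : finFieldType) (iota : {rmorphism k -> F}) (n : nat).
Hypothesis card_F : #|F| = (#|k| ^ n)%N.
Variables (A : gfunctor F) (W : gfunctor k) (u : ghom (gbase_change iota W) A).
Hypotheses (A_abelian : abelian_variety A) (W_abelian : abelian_variety W)
  (W_weil : is_weil_restriction u).
Local Notation res := (weil_res u u : End A -> End W).
Local Notation X := (root_ext_X n (Qfrob_pi A)).

Lemma End_weil_iso : exists Phi : {rmorphism EndQ_root A n -> EndQ W},
  [/\ forall (lam : End A) (r : rat),
        Phi (EndQ_root_tens (EndQ_of lam r) 1) = EndQ_of (res lam) r,
      Phi (EndQ_root_tens 1 X) = frobQ W & bijective Phi].
Proof.
have schW : scheme W by case: W_abelian.
have shA : zariski_sheaf A by case: A_abelian => -[].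
have [V VP] := verschiebung A_abelian.
have n0 := ext_degree_gt0 card_F.
have q0 : (0 < #|F|)%N := ltnW (card_finNzRing_gt1 F).
have [H HE] := rationalize_hom (weil_res_hom W_weil schW).
have HE' lam r : H (EndQ_of lam r) = EndQ_of (res lam) r by exact: HE.
pose g : {rmorphism Qfrob A -> EndQ W} := H \o Qfrob_incl A.
have frobC (y : EndQ W) : GRing.comm (frobQ W) y.
  exact: (rationalize_central (@frobenius_central k W)).
have [ev [evC evX]] := pol_eval g frobC.
have frobX m : frobQ W ^+ m = EndQ_of (frobenius W ^+ m) 1.
  elim: m => [|m IHm]; first by rewrite !expr0.
  by rewrite !exprS IHm [LHS]tensM mulr1.
have ev0 : ev (polX (Qfrob A) ^+ n - pol_const (Qfrob_pi A)) = 0.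
  rewrite rmorphB rmorphXn evC evX frobX /=.
  by rewrite [H _]HE' (weil_res_frobenius card_F W_weil schW) subrr.
have [psi psiE] := pquot_lift ev0.
have psi_sc r : psi (root_ext_scalar n (Qfrob_pi A) r) = g r.
  by rewrite -evC -psiE.
have psiX : psi X = frobQ W by rewrite -evX -psiE.
have phi_psi r : H (Qfrob_incl A r) = psi (root_ext_scalar n (Qfrob_pi A) r).
  by rewrite psi_sc.
(* The scalars of the root extension come from the centre of the rational endomorphisms of A, and X
   goes to Frobenius, which is central for W. *)
have comm_phi_psi a b : GRing.comm (H a) (psi b).
  have [d ->] := root_ext_basis n0 b.
  rewrite rmorph_sum; apply: commr_sum => i _; rewrite rmorphM rmorphXn psiX psi_sc.
  apply: commrM; last by apply/commrX/commr_sym/frobC.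
  have e : GRing.comm (Qfrob_incl A (d i)) a by apply: centralP.
  apply: commr_sym; rewrite /GRing.comm -[g (d i)]/(H (Qfrob_incl A (d i))).
  by rewrite -!rmorphM e.
pose Phi : {rmorphism EndQ_root A n -> EndQ W} := tens_hom phi_psi comm_phi_psi.
have PhiE a b : Phi (EndQ_root_tens a b) = H a * psi b by apply: tens_homE.
have PhiEX lam r i : Phi (EndQ_root_tens (EndQ_of lam r) (X ^+ i)) =
    EndQ_of (res lam * frobenius W ^+ i) r.
  by rewrite PhiE HE' rmorphXn psiX frobX [LHS]tensM mulr1.
exists Phi; split=> [lam r||].
- by rewrite PhiE rmorph1 mulr1 HE'.
- by rewrite PhiE rmorph1 mul1r psiX.
have EndQ_sum (E : pzRingType) I (r : seq I) (x : I -> E) (c : rat) :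
    tens (central_int E) (central_int rat) (\sum_(i <- r) x i) c =
    \sum_(i <- r) tens (central_int E) (central_int rat) (x i) c.
  apply: (big_morph (fun e => tens _ _ e c)) => [e e'|]; first exact: tensDl.
  by apply: (@addrI _ (tens (central_int E) (central_int rat) 0 c)); rewrite -tensDl !addr0.
have Phi_surj y : exists x, Phi x = y.
  elim/tens_ind: y => [|y y' [x <-] [x' <-]|mu r]; first by exists 0; rewrite rmorph0.
    by exists (x + x'); rewrite rmorphD.
  have [lam hlam] := weil_end_span card_F W_weil schW shA VP mu.
  (* Only the multiple of [mu] by #|F| is spanned integrally, hence the division of the rational
     coefficient. *)
  exists (\sum_i EndQ_root_tens (EndQ_of (lam i) (r / #|F|%:R)) (X ^+ i)).
  rewrite rmorph_sum (ten_denom mu r q0) hlam EndQ_sum.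
  by apply: eq_bigr => i _; rewrite PhiEX.
have basis (x : EndQ_root A n) :
    exists a : 'I_n -> EndQ A, x = \sum_i EndQ_root_tens (a i) (X ^+ i).
  elim/tens_ind: x => [|x x' [a ->] [a' ->]|a b].
  - exists (fun _ => 0); rewrite big1 // => i _.
    by apply: (@addrI _ (EndQ_root_tens 0 (X ^+ i))); rewrite /EndQ_root_tens -tensDl !addr0.
  - exists (fun i => a i + a' i); rewrite -big_split; apply: eq_bigr => i _.
    by rewrite /EndQ_root_tens tensDl.
  - have [d ->] := root_ext_basis n0 b; exists (fun i => a * Qfrob_incl A (d i)).
    have tens0 : EndQ_root_tens a (0 : root_ext n (Qfrob_pi A)) = 0.
      by apply: (@addrI _ (EndQ_root_tens a 0)); rewrite /EndQ_root_tens -tensDr !addr0.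
    rewrite [LHS](big_morph (fun b => EndQ_root_tens a b) (tensDr _ _ a) tens0).
    by apply: eq_bigr => i _; rewrite [RHS]tens_balanced.
have Phi_ker x : Phi x = 0 -> x = 0.
  have [a ->] := basis x => {x}.
  have /choice[N /choice[lam0 hlam0]] i :
    exists N e, (0 < N)%N /\ a i = EndQ_of e N%:R^-1 by apply: rationalize_denom.
  (* A common denominator makes the image of the element a single tensor, to which [ten_eq0]
     applies. *)
  pose M := (\prod_i N i)%N.
  have M0 : (0 < M)%N by rewrite prodn_gt0 // => i; have [] := hlam0 i.
  have /choice[lam hlam] i : exists e : End A, a i = EndQ_of e M%:R^-1.
    have [N0 ->] := hlam0 i.
    have MN : M = (\prod_(j | j != i) N j * N i)%N by rewrite /M (bigD1 i) //= mulnC.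
    have P0 : (0 < \prod_(j | j != i) N j)%N.
      by rewrite prodn_cond_gt0 // => j _; have [] := hlam0 j.
    exists (lam0 i *+ \prod_(j | j != i) N j).
    rewrite /EndQ_of (ten_denom _ _ P0) MN natrM invfM.
    by rewrite mulrC.
  rewrite rmorph_sum => sum0.
  have : EndQ_of (\sum_i res (lam i) * frobenius W ^+ i) M%:R^-1 = 0.
    by rewrite /EndQ_of EndQ_sum -[RHS]sum0; apply: eq_bigr => i _; rewrite hlam PhiEX.
  move=> /(ten_eq0 M0)[K [K0]]; rewrite -sumrMnl => sumK.
  (* The multiple by [K] turns the rational relation into one in End(W) itself; freeness there
     introduces a further factor #|F|, and the rational coefficient absorbs both. *)
  have lam0E i : lam i *+ K *+ #|F| = 0.
    move: i; apply: (weil_end_free card_F W_weil schW shA VP).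
    rewrite -[RHS]sumK; apply: eq_bigr => i _.
    have := rmorphMn (weil_res_hom W_weil schW) K (lam i).
    by rewrite !mk_rmorphismE => ->; rewrite mulrnAl.
  rewrite big1 // => i _.
  have -> : a i = 0.
    rewrite hlam /EndQ_of (ten_denom _ _ K0) (ten_denom _ _ q0) lam0E.
    set c := _ / _; apply: (@addrI _ (tens (central_int (End A)) (central_int rat) 0 c)).
    by rewrite -tensDl !addr0.
  apply: (@addrI _ (EndQ_root_tens 0 (X ^+ i))).
  by rewrite /EndQ_root_tens -tensDl !addr0.
have Phi_inj : injective Phi.
  move=> x y /eqP; rewrite -subr_eq0 -rmorphB => /eqP/Phi_ker/eqP.
  by rewrite subr_eq0 => /eqP.
have /choice[Psi hPsi] := Phi_surj.
by exists Psi => // x; apply: Phi_inj; rewrite hPsi.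
Qed.

End Main.

Theorem theorem1 (k : finFieldType) (L : fieldExtType k) (n : nat)
    (degree_n : \dim {: L} = n)
    (A : gfunctor (finvect_type L)) (W : gfunctor k)
    (u : ghom (gbase_change (in_alg (finvect_type L)) W) A)
    (A_abelian : abelian_variety A) (W_abelian : abelian_variety W)
    (W_weil : is_weil_restriction u) :
  exists Phi : {rmorphism EndQ_root A n -> EndQ W},
    [/\ forall (lam : End A) (r : rat),
          Phi (EndQ_root_tens (EndQ_of lam r) 1) = EndQ_of (weil_res u u lam) r,
        Phi (EndQ_root_tens 1 (root_ext_X n (Qfrob_pi A))) = frobQ W
      & bijective Phi].
Proof.
have card_F : #|finvect_type L| = (#|k| ^ n)%N.
  by rewrite -degree_n -(card_vspace {: finvect_type L}) card_vspacef.
exact: (@End_weil_iso k (finvect_type L) (in_alg (finvect_type L)) n card_F A W u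
  A_abelian W_abelian W_weil).
Qed.
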